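(* The pentablock $\mathcal P$ is not an analytic retract of the open unit ball of a $\mathcal J^*$ algebra of finite rank. That is, if $\mathcal A$ is a $\mathcal J^*$ algebra of finite rank and $\mathcal B$ is its open unit ball, then there are no holomorphic mappings $\phi:\mathcal P\to\mathcal B$ and $\psi:\mathcal B\to\mathcal P$ with $\psi\circ\phi=\mathrm{id}_{\mathcal P}$.
   Context: Let $\mathcal R_I=\{z\in\mathbb C^{2\times2}:\|z\|<1\}$, where $\|\cdot\|$ is the operator norm. The pentablock is the domain $\mathcal P=\pi(\mathcal R_I)\subset\mathbb C^3$, where $\pi(z)=(z_{12},\operatorname{tr}z,\det z)$ for $z=(z_{ij})$. A domain $P$ is an analytic retract of a domain $B$ if there are holomorphic maps $\phi:P\to B$ and $\psi:B\to P$ with $\psi\circ\phi=\mathrm{id}$. A $\mathcal J^*$ algebra (in the sense of Harris) is a norm-closed complex linear subspace $\mathcal A$ of the space $L(H,K)$ of bounded linear operators between complex Hilbert spaces $H,K$ such that $AA^*A\in\mathcal A$ whenever $A\in\mathcal A$; it carries the operator norm. It is of finite rank if there is $n\in\mathbb N$ such that every family of nonzero, pairwise orthogonal elements of $\mathcal A$ has at most $n$ members, where $A,B\in\mathcal A$ are orthogonal if $A^*B=0$ and $AB^*=0$. *)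

(* Defs.v *)
From HB Require Import structures.
From mathcomp Require Import all_boot all_order all_algebra.
From mathcomp Require Import sesquilinear complex.
From mathcomp Require Import all_classical all_reals all_analysis.
From mathcomp Require Import ring lra.

Set Implicit Arguments.
Unset Strict Implicit.
Unset Printing Implicit Defensive.

Import Order.TTheory GRing.Theory Num.Theory.
Import numFieldNormedType.Exports.

Local Open Scope classical_set_scope.
Local Open Scope ring_scope.
Local Open Scope complex_scope.

(* Real-valued; the [Re] of [Num] lands in [R[i]]. *)
Local Notation Re := complex.Re.

HB.mixin Record isHilbert (R : realType) H & CompleteNormedModule R[i] H := {
  hdot : {dot H for Num.conj};
  hdotE : forall x : H, hdot x x = `|x| ^+ 2
}.

#[short(type="hilbertType")]
HB.structure Definition Hilbert (R : realType) :=
  {H of isHilbert R H & CompleteNormedModule R[i] H}.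

(* The norms of normed modules over [R[i]] are [R[i]]-valued (nonnegative
   reals), hence the detour through [Re] to take a supremum in [R]. *)
Definition opnorm (R : realType) (V W : Type) (nV : V -> R[i]) (nW : W -> R[i])
    (f : V -> W) : R[i] :=
  (sup [set Re (nW (f x)) | x in [set x | nV x <= 1]])%:C.

Section BoundedOperators.
Variables (R : realType) (H K : hilbertType R).

Definition bounded_operator : pred (H -> K) :=
  [pred f | `[< linear f /\
                exists M : R, forall x, `|f x| <= M%:C * `|x| >]].

Lemma bounded_operator_submod : GRing.submod_closed bounded_operator.
Proof.
split=> [|a f g /asboolP[fl [M fM]] /asboolP[gl [N gN]]]; apply/asboolP; split.
- by move=> c x y /=; rewrite scaler0 addr0.
- by exists 0 => x /=; rewrite normr0 mul0r.
- move=> c x y; rewrite !fctE fl gl !scalerDr !scalerA [a * c]mulrC.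
  by rewrite addrACA.
- exists (Re `|a| * M + N) => x; rewrite !fctE.
  rewrite (le_trans (ler_normD _ _))// normrZ.
  have -> : (Re `|a| * M + N)%:C = `|a| * M%:C + N%:C.
    by rewrite -{2}(RRe_real (normr_real a)) -rmorphM -rmorphD.
  by rewrite mulrDl lerD// -mulrA ler_wpM2l.
Qed.

HB.instance Definition _ :=
  GRing.isSubmodClosed.Build R[i] (H -> K) bounded_operator
    bounded_operator_submod.

(* L(H, K); its norm, declared below, is the operator norm. *)
Record operator := Operator {
  operator_fun :> H -> K;
  _ : operator_fun \in bounded_operator
}.

HB.instance Definition _ := [isSub for operator_fun].
HB.instance Definition _ := [Choice of operator by <:].
HB.instance Definition _ := [SubChoice_isSubLmodule of operator by <:].

Lemma operator_linear (A : operator) : linear A.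
Proof. by have /asboolP[] := valP A. Qed.

HB.instance Definition _ (A : operator) :=
  GRing.isLinear.Build R[i] H K *:%R (A : H -> K) (operator_linear A).

Definition operator_norm (A : operator) : R[i] :=
  opnorm (fun x : H => `|x|) (fun y : K => `|y|) A.

Lemma operator_bounded (A : operator) :
  exists M : R, forall x, `|A x| <= M%:C * `|x|.
Proof. by have /asboolP[] := valP A. Qed.

Let S (A : operator) :=
  [set Re `|A x| | x in [set x : H | `|x| <= 1]].

Let ReE (V : normedModType R[i]) (x : V) : (Re `|x|)%:C = `|x|.
Proof. by rewrite RRe_real ?normr_real. Qed.

Let S_sup A : has_sup (S A).
Proof.
split; first by exists (Re `|A 0|), 0 => //=; rewrite normr0.
have [M AM] := operator_bounded A.
exists (Num.max M 0) => _ [x /= x1 <-].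
rewrite -lecR ReE (le_trans (AM x))// (@le_trans _ _ ((Num.max M 0)%:C * `|x|))//.
  by rewrite ler_wpM2r// lecR le_max lexx.
by rewrite ler_piMr// ler0c le_max lexx orbT.
Qed.

Lemma operator_norm_ge0 A : 0 <= operator_norm A.
Proof.
rewrite /operator_norm /opnorm ler0c.
have : Re `|A 0| <= sup (S A).
  by apply: ub_le_sup; [case: (S_sup A)|exists 0 => //=; rewrite normr0].
by rewrite linear0 normr0.
Qed.

Lemma operator_norm_ub (A : operator) x : `|A x| <= operator_norm A * `|x|.
Proof.
have [->|x0] := eqVneq x 0; first by rewrite linear0 !normr0 mulr0.
rewrite -ler_pdivrMr ?normr_gt0//.
have -> : `|A x| / `|x| = `|A (`|x|^-1 *: x)|.
  by rewrite linearZ normrZ normfV normr_id mulrC.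
rewrite -ReE lecR; apply: ub_le_sup; first by case: (S_sup A).
by eexists; last reflexivity; rewrite /= normrZ normfV normr_id mulVf// normr_eq0.
Qed.

Lemma operator_norm_le (A : operator) (M : R[i]) : 0 <= M ->
  (forall x, `|A x| <= M * `|x|) -> operator_norm A <= M.
Proof.
move=> M0 AM; rewrite -(RRe_real (ger0_real M0)) lecR.
apply: ge_sup; first by case: (S_sup A).
move=> _ [x /= x1 <-]; rewrite -lecR ReE RRe_real ?ger0_real//.
by rewrite (le_trans (AM x))// ler_piMr.
Qed.

Lemma operator_normD A B :
  operator_norm (A + B) <= operator_norm A + operator_norm B.
Proof.
apply: operator_norm_le => [|x]; first by rewrite addr_ge0// operator_norm_ge0.
rewrite mulrDl (le_trans (ler_normD _ _))// lerD// operator_norm_ub//.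
Qed.

Lemma operator_normZ (c : R[i]) A :
  operator_norm (c *: A) = `|c| * operator_norm A.
Proof.
have Zle (d : R[i]) B : operator_norm (d *: B) <= `|d| * operator_norm B.
  apply: operator_norm_le => [|x]; first by rewrite mulr_ge0// operator_norm_ge0.
  by rewrite -mulrA normrZ ler_wpM2l// operator_norm_ub.
apply/eqP; rewrite eq_le Zle/=.
have [->|c0] := eqVneq c 0; first by rewrite normr0 mul0r operator_norm_ge0.
rewrite -ler_pdivlMl ?normr_gt0// -normfV (le_trans _ (Zle _ _))//.
by rewrite scalerA mulVf// scale1r.
Qed.

Lemma operator_norm_eq0 A : operator_norm A = 0 -> A = 0.
Proof.
move=> A0; apply/val_inj/funext => x.
apply/eqP; rewrite -[val A x]/(A x) -[X in _ == X]/(0 : K) -normr_le0.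
by rewrite (le_trans (operator_norm_ub A x))// A0 mul0r.
Qed.

HB.instance Definition _ := Lmodule_isNormed.Build R[i] operator
  operator_normD operator_normZ operator_norm_eq0.

End BoundedOperators.

Section Riesz.
Variables (R : realType) (H : hilbertType R).
Implicit Types x v z : H.
Let n x : R := Re `|x|.
Let nE x : `|x| = (n x)%:C. Proof. by rewrite /n RRe_real ?normr_real. Qed.
Let n_ge0 x : 0 <= n x. Proof. by rewrite -ler0c -nE. Qed.
Let n2 x : hdot x x = (n x ^+ 2)%:C. Proof. by rewrite hdotE nE rmorphXn. Qed.
Let ReD (a b : R[i]) : Re (a + b) = Re a + Re b. Proof. by case: a; case: b. Qed.
Let ReN (a : R[i]) : Re (- a) = - Re a. Proof. by case: a. Qed.
Let ReM (c : R) (b : R[i]) : Re (c%:C * b) = c * Re b.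
Proof. by case: b => b1 b2 /=; rewrite mul0r subr0. Qed.
Let Recj (a : R[i]) : Re (Num.conj a) = Re a.
Proof. by case: a. Qed.

Let nD x v : n (x + v) ^+ 2 = n x ^+ 2 + n v ^+ 2 + 2 * Re (hdot x v).
Proof.
have := congr1 (@complex.Re R) (dnormD hdot x v); rewrite !n2 !ReD Recj /= => ->.
by ring.
Qed.
Let nZ (t : R) v : n (t%:C *: v) = `|t| * n v.
Proof.
apply: complexI; rewrite -nE normrZ nE.
have -> : `|t%:C| = `|t|%:C :> R[i] by rewrite normc_def/= expr0n/= addr0 sqrtr_sqr.
by rewrite -rmorphM.
Qed.


Let dotZ (t : R) x v : Re (hdot (t%:C *: x) v) = t * Re (hdot x v).
Proof. by rewrite linearZl/= ReM. Qed.

Let ReC x v : Re (hdot x v) = Re (hdot v x).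
Proof. by rewrite hermC/= expr0 mul1r Recj. Qed.

Let quad x v (t : R) :
  n (x + t%:C *: v) ^+ 2 = n x ^+ 2 + t ^+ 2 * n v ^+ 2 + 2 * t * Re (hdot v x).
Proof. by rewrite nD nZ exprMn real_normK ?num_real// ReC dotZ; ring. Qed.

Lemma hdot_Re_le x v : `|Re (hdot x v)| <= n x * n v.
Proof.
have [v0|v0] := eqVneq (n v) 0.
  have -> : v = 0 by apply/normr0_eq0; rewrite nE v0.
  by rewrite linear0r /= normr0 mulr_ge0.
rewrite -(@ler_pXn2r _ 2)// ?nnegrE ?mulr_ge0// real_normK ?num_real// exprMn.
have v2 : 0 < n v ^+ 2 by rewrite exprn_gt0// lt_def v0 n_ge0.
have := sqr_ge0 (n (x + (- Re (hdot x v) / n v ^+ 2)%:C *: v)).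
rewrite quad [Re (hdot v x)]ReC; set b := Re _; set a := n v ^+ 2 in v2 *.
have -> : n x ^+ 2 + (- b / a) ^+ 2 * a + 2 * (- b / a) * b = n x ^+ 2 - b ^+ 2 / a.
  by field; rewrite gt_eqF.
by rewrite subr_ge0 ler_pdivrMr.
Qed.

Variables (g : H -> R[i]) (m : R).
Hypotheses (gl : linear_for *%R g)
  (gm : forall x, Re (g x) <= m * Re `|x|).

Let gD x v : g (x + v) = g x + g v.
Proof. by have := gl 1 x v; rewrite scale1r mul1r. Qed.
Let gZ (c : R[i]) x : g (c *: x) = c * g x.
Proof.
have g0 : g 0 = 0 by have /eqP := gD 0 0; rewrite addr0 eq_sym -subr_eq0 addrK => /eqP.
by have := gl c x 0; rewrite !addr0 g0 addr0.
Qed.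

Let J x := n x ^+ 2 - 2 * Re (g x).

Let Jlb x : - m ^+ 2 <= J x.
Proof.
by rewrite /J; have := gm x; have := sqr_ge0 (m - n x); rewrite -/(n x); nra.
Qed.

Let I := inf (range J).

Let I_le x : I <= J x.
Proof. by apply: ge_inf; [exists (- m ^+ 2) => _ [y _ <-]|exists x]. Qed.

Let I_adh e : 0 < e -> exists x, J x < I + e.
Proof.
move=> e0; have hI : has_inf (range J).
  by split; [exists (J 0), 0|exists (- m ^+ 2) => _ [y _ <-]].
by have [_ [x _ <-] ?] := inf_adherent e0 hI; exists x.
Qed.

Let Jmid x v : n (x - v) ^+ 2 <= 2 * J x + 2 * J v - 4 * I.
Proof.
have := I_le ((2^-1)%:C *: (x + v)).
rewrite /J nZ exprMn gZ ReM gD ReD real_normK ?num_real//.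
have := quad x v 1; have := quad x v (-1).
by rewrite !rmorphN !rmorph1 scaleN1r !scale1r => -> ->; nra.
Qed.

Let F := filter_from [set e : R | 0 < e] (fun e => [set x | J x < I + e]).

Let FF : ProperFilter F.
Proof.
apply: filter_from_proper => [|e e0]; last exact: I_adh.
apply: filter_from_filter; first by exists 1; exact: ltr01.
move=> e d e0 d0; exists (Num.min e d); first by rewrite /= lt_min e0.
move=> x /= xed; split; rewrite /= (lt_le_trans xed)// lerD2l ge_min lexx//.
by rewrite orbT.
Qed.

Let ltC (e : R[i]) : 0 < e -> exists2 d : R, 0 < d & e = d%:C.
Proof.
move=> e0; have er : e = (Re e)%:C by rewrite RRe_real// gtr0_real.
by exists (Re e) => //; rewrite -ltcR -er.
Qed.

Let F_cvg : cvg F.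
Proof.
have FF' : Filter F by have [] := FF.
apply: (@cauchy_cvg H F FF); apply: cauchy_exP => _/posnumP[e].
have [d d0 ed] := @ltC e%:num ltac:(by []).
have d2 : 0 < d ^+ 2 / 8 by rewrite divr_gt0// exprn_gt0.
have [x Jx] := I_adh d2; exists x; exists (d ^+ 2 / 8) => // v /= Jv.
rewrite -ball_normE /= ed nE ltcR -(@ltr_pXn2r _ 2)// ?nnegrE ?(ltW d0)//.
by rewrite (le_lt_trans (Jmid x v))//; lra.
Qed.

Let Fapprox (e : R) : 0 < e -> exists x, n (lim F - x) < e /\ J x < I + e.
Proof.
move=> e0; have FF' : Filter F by have [] := FF.
have e0' : 0 < e%:C by rewrite ltcR.
have Fb : F (ball (lim F) e%:C) by apply: F_cvg; exact: nbhsx_ballx.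
have Fe : F [set x | J x < I + e] by exists e.
have [x] := @filter_ex _ F FF _ (filterI Fb Fe); rewrite /setI/= => -[+ Jx].
by rewrite -ball_normE/= nE ltcR => zx; exists x.
Qed.

Let Re_riesz v : Re (g v) = Re (hdot v (lim F)).
Proof.
set z := lim F; apply/eqP; rewrite eq_sym -subr_eq0; set b := _ - _.
have key t : 0 <= t ^+ 2 * n v ^+ 2 + 2 * t * b.
  apply/ler_addgt0Pr => e e0.
  have c0 : 0 < 2 * `|t| * n v + 1.
    by rewrite ltr_wpDl// mulr_ge0// mulr_ge0.
  have [x [xz Jx]] := Fapprox (divr_gt0 e0 c0).
  have := I_le (x + t%:C *: v); rewrite /J quad gD gZ ReD ReM.
  have := hdot_Re_le v (z - x); rewrite raddfB/= ReD ReN.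
  set d := e / _ in xz Jx.
  have ed : e = 2 * (`|t| * n v * d) + d.
    by rewrite /d; field; rewrite gt_eqF.
  rewrite ler_norml => /andP[h1 h2] h3.
  have h4 : `|t| * n v * n (z - x) <= `|t| * n v * d.
    by apply: ler_wpM2l; [rewrite mulr_ge0|exact: ltW].
  rewrite ed /b; move: Jx h3; rewrite /J => Jx h3.
  have h5 : - (`|t| * n v * n (z - x)) <= t * (Re (hdot v z) - Re (hdot v x)).
    have : `|t * (Re (hdot v z) - Re (hdot v x))| <= `|t| * (n v * n (z - x)).
      by rewrite normrM ler_wpM2l// ler_norml h1.
    by rewrite mulrA ler_norml => /andP[].
  by nra.
have a0 : 0 < n v ^+ 2 + 1 by rewrite ltr_wpDl// sqr_ge0.
have := key (- b / (n v ^+ 2 + 1)); set a := n v ^+ 2 in a0 *.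
have -> : (- b / (a + 1)) ^+ 2 * a + 2 * (- b / (a + 1)) * b =
   - (b ^+ 2 * ((a + 2) / (a + 1) ^+ 2)) by field; rewrite gt_eqF.
rewrite oppr_ge0 pmulr_lle0; last first.
  by rewrite divr_gt0 ?exprn_gt0//; lra.
by move=> b2; have := sqr_ge0 b; rewrite -sqrf_eq0 => b3; rewrite eq_le b2.
Qed.

Lemma riesz : exists z, forall v, g v = hdot v z.
Proof.
exists (lim F) => v; have := Re_riesz v; have := Re_riesz ('i%C *: v).
rewrite gZ linearZl/=; case: (g v) => a b; case: (hdot _ _) => c d /=.
by rewrite !mul0r !mul1r !sub0r => /oppr_inj -> ->.
Qed.
End Riesz.


Section Adjoint.
Variables (R : realType) (H K : hilbertType R) (A : operator H K).

Let hdot_inj (z z' : H) : (forall v, hdot v z = hdot v z') -> z = z'.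
Proof.
move=> zz; apply/subr0_eq/eqP; rewrite -(dnorm_eq0 hdot) linearBr/=.
by rewrite zz subrr.
Qed.

Lemma adjoint_exists :
  exists B : operator K H, forall x y, hdot (A x) y = hdot x (B y).
Proof.
have AE : `|A| = (Re `|A|)%:C by rewrite RRe_real ?normr_real.
have A0 : 0 <= Re `|A| by rewrite -ler0c -AE.
have Aub x : Re `|A x| <= Re `|A| * Re `|x|.
  rewrite -lecR rmorphM RRe_real ?normr_real//.
  have -> : (Re `|A|)%:C * (Re `|x|)%:C = `|A| * `|x|.
    by rewrite !RRe_real ?normr_real.
  exact: operator_norm_ub.
have /choice[B BE] y : exists z, forall x, hdot (A x) y = hdot x z.
  apply: (@riesz _ _ (fun x => hdot (A x) y) (Re `|A| * Re `|y|)) => [c x v|x].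
    by rewrite !linearD linearZ/= linearDl linearZl.
  have y0 : 0 <= Re `|y| by rewrite -ler0c RRe_real ?normr_real.
  rewrite (le_trans (ler_norm _))// (le_trans (hdot_Re_le _ _))//.
  by rewrite mulrAC ler_wpM2r.
have Bl : linear B.
  move=> c y y'; apply: hdot_inj => v.
  by rewrite -BE !linearDr !linearZr/= -!BE.
have Bb : exists M : R, forall y, `|B y| <= M%:C * `|y|.
  exists (Re `|A|) => y.
  have [->|By0] := eqVneq (B y) 0; first by rewrite normr0 -AE mulr_ge0.
  have nBy : 0 < Re `|B y| by rewrite -ltcR RRe_real ?normr_real// normr_gt0.
  rewrite -[leLHS]RRe_real ?normr_real// -[X in _ * X]RRe_real ?normr_real//.
  rewrite -rmorphM lecR -(ler_pM2l nBy).
  have -> : Re `|B y| * Re `|B y| = Re (hdot (A (B y)) y).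
    rewrite BE hdotE -[`|B y|]RRe_real ?normr_real//.
    by rewrite expr2 -rmorphM.
  rewrite (le_trans (ler_norm _))// (le_trans (hdot_Re_le _ _))//.
  rewrite mulrA [Re `|B y| * _]mulrC ler_wpM2r//.
  by rewrite -ler0c RRe_real ?normr_real.
have Bop : B \in @bounded_operator R K H by apply/asboolP.
by exists (Operator Bop).
Qed.

End Adjoint.

Section JStarAlgebras.
Variables (R : realType).
Implicit Types H K L : hilbertType R.

Definition adjoint H K (A : operator H K) : operator K H :=
  projT1 (cid (adjoint_exists A)).

Lemma adjointP H K (A : operator H K) x y :
  hdot (A x) y = hdot x (adjoint A y).
Proof. by rewrite /adjoint; case: cid => B BE; exact: BE. Qed.

Lemma comp_bounded H K L (A : operator K L) (B : operator H K) :
  (A : K -> L) \o B \in @bounded_operator R H L.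
Proof.
apply/asboolP; split; first by move=> c x y /=; rewrite !linearP.
have [M AM] := operator_bounded A; have [N BN] := operator_bounded B.
exists (Num.max M 0 * N) => x /=; rewrite (le_trans (AM _))//.
have M0 : 0 <= (Num.max M 0)%:C by rewrite ler0c le_max lexx orbT.
rewrite (@le_trans _ _ ((Num.max M 0)%:C * `|B x|))//.
  by rewrite ler_wpM2r// lecR le_max lexx.
by rewrite rmorphM -mulrA ler_wpM2l.
Qed.

Definition operator_comp H K L (A : operator K L) (B : operator H K) :
  operator H L := Operator (comp_bounded A B).

Record jstar_algebra H K := JStarAlgebra {
  jstar_pred :> {pred operator H K};
  jstar_submod : GRing.submod_closed jstar_pred;
  jstar_closed : closed [set A | A \in jstar_pred];
  jstar_triple : forall A, A \in jstar_pred ->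
    operator_comp A (operator_comp (adjoint A) A) \in jstar_pred
}.

Definition orthogonal_operators H K (A B : operator H K) : Prop :=
  operator_comp (adjoint A) B = 0 /\ operator_comp A (adjoint B) = 0.

Definition finite_rank H K (J : jstar_algebra H K) : Prop :=
  exists n : nat, forall S : set (operator H K),
    (forall A, S A -> A \in J /\ A != 0) ->
    (forall A B, S A -> S B -> A != B -> orthogonal_operators A B) ->
    (S #<= `I_n)%card.

End JStarAlgebras.

HB.instance Definition _ (R : realType) (H K : hilbertType R)
    (J : jstar_algebra H K) :=
  GRing.isSubmodClosed.Build R[i] (operator H K) (jstar_pred J)
    (jstar_submod J).

Section JStarNormedModule.
Variables (R : realType) (H K : hilbertType R) (J : jstar_algebra H K).

(* The algebra as a normed space in its own right, so that differentiability
   of maps defined on it makes sense. *)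
Record jstar_elt := JStarElt {
  jstar_val :> operator H K;
  _ : jstar_val \in J
}.

HB.instance Definition _ := [isSub for jstar_val].
HB.instance Definition _ := [Choice of jstar_elt by <:].
HB.instance Definition _ := [SubChoice_isSubLmodule of jstar_elt by <:].

Let jstar_norm (a : jstar_elt) : R[i] := `|jstar_val a|.

Let jstar_normD a b : jstar_norm (a + b) <= jstar_norm a + jstar_norm b.
Proof. exact: ler_normD. Qed.

Let jstar_normZ (c : R[i]) a : jstar_norm (c *: a) = `|c| * jstar_norm a.
Proof. exact: normrZ. Qed.

Let jstar_norm_eq0 a : jstar_norm a = 0 -> a = 0.
Proof. by move=> /normr0_eq0 a0; apply/val_inj. Qed.

HB.instance Definition _ := Lmodule_isNormed.Build R[i] jstar_elt
  jstar_normD jstar_normZ jstar_norm_eq0.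

Definition jstar_unit_ball : set jstar_elt := [set a | `|a| < 1].

End JStarNormedModule.

Arguments jstar_unit_ball {R H K} J.

Section Pentablock.
Variable R : realType.

Definition euclidean_norm n (v : 'cV[R[i]]_n) : R[i] :=
  sqrtC (\sum_(i < n) `|v i 0| ^+ 2).

(* Not the library norm on ['M_2], which is the largest modulus of the
   entries. *)
Definition matrix_opnorm (z : 'M[R[i]]_2) : R[i] :=
  opnorm (@euclidean_norm 2) (@euclidean_norm 2) (fun v => z *m v).

Definition matrix_unit_ball : set 'M[R[i]]_2 := [set z | matrix_opnorm z < 1].

Definition pentablock_map (z : 'M[R[i]]_2) : 'rV[R[i]]_3 :=
  \row_(j < 3) [:: z 0 1; \tr z; \det z]`_j.

Definition pentablock : set 'rV[R[i]]_3 := pentablock_map @` matrix_unit_ball.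

End Pentablock.

Arguments pentablock R : clear implicits.

(* Maps are total functions; on an open set [D], complex (Frechet)
   differentiability at every point of [D] only depends on their values
   on [D]. *)
Definition holomorphic_on (R : realType) (V W : normedModType R[i])
    (D : set V) (f : V -> W) : Prop :=
  forall x, D x -> differentiable f x.

Definition analytic_retract (R : realType) (V W : normedModType R[i])
    (P : set V) (B : set W) : Prop :=
  exists (phi : V -> W) (psi : W -> V),
    [/\ holomorphic_on P phi, holomorphic_on B psi,
        phi @` P `<=` B, psi @` B `<=` P &
        forall x, P x -> psi (phi x) = x].

(* Main.v *)
Require Import Defs.
From mathcomp Require Import all_boot all_order all_algebra sesquilinear complex.
From mathcomp Require Import all_classical all_reals all_analysis.
From mathcomp Require Import ring lra.

Set Implicit Arguments.
Unset Strict Implicit.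
Unset Printing Implicit Defensive.

Import Order.TTheory GRing.Theory Num.Theory.
Import numFieldNormedType.Exports.

Local Open Scope classical_set_scope.
Local Open Scope ring_scope.
Local Open Scope complex_scope.
Local Notation Re := complex.Re.
Local Notation Im := complex.Im.

(**
  The unit ball of a J*-algebra is symmetric: around each of its points [b] there
  is a holomorphic self-map [S] fixing [b] with differential [- id]. If the
  pentablock were a retract through [phi] and [psi], then [psi \o S \o phi],
  with [S] the symmetry at [phi 0], would be a holomorphic self-map of the
  pentablock fixing [0], whose differential there is [- id] in the directions
  of [s] and [p]; no such map exists.

  The symmetry is the rational map [x |-> e - (1 - b e* ) x (1 - e* x)^-1 (1 - b* e)]
  with [e = 2 b (1 + b* b)^-1]: it needs no square roots, only Neumann series.

  The obstruction comes from the functions [magic w : (a, s, p) |-> (2 w p - s) / (2 - w s)],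
  [`|w| = 1], which map the pentablock to the disc. If [h] fixes [0] with differential
  [- id], Schwarz's lemma forces [h (0, 0, z) = (_, 0, - z)]. Perturbing the disc
  [z |-> (0, 0, z)] to first order by the automorphisms induced by Moebius maps and
  applying Schwarz--Pick to [magic w \o h] between [0] and [1 / 2] then gives linear
  conditions on the [s]-derivative of [h] at [(0, 0, 1 / 2)] that contradict each other
  for different [w].

  Schwarz's lemma is derived from Goursat's theorem, proved by bisection on dyadic
  Riemann sums, in logarithmic polar coordinates: the mean of [f] over a circle
  around [0] is [f 0] as soon as [f] is continuous at [0] and holomorphic around it.
*)

(** Why no square root appears: the usual automorphism of the ball exchanging 0 and e contains the
    square roots of 1 - e* e and 1 - e e*. Here e is the hyperbolic double of b (compare tanh 2t = 2
    tanh t / (1 + tanh^2 t)), so b is the midpoint of 0 and e, and the roots are rational in b: c =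
    1 - e* b is self-adjoint with c^2 = 1 - e* e. A J*-algebra is closed under symmetric triple
    products but not under products or inverses, so every operator of the formula has to be met
    inside a Jordan expression, such as x (1 - e* x)^-1. Why there is no reflection: at (0, 0, z)
    the Moebius perturbation in direction a moves s with speed 2 (a + a^* z), which is only real
    linear in a; it is 2 (1 + z) for a = 1 and 2 i (1 - z) for a = i. The differential of the map is
    complex linear, and the two first-order conditions ask it for different values. The first
    coordinate never enters, since the test functions see a matrix only through its eigenvalues. *)

Section RealNorm.
Variable R : realType.
Local Notation C := R[i].

(** Norms over [R[i]] take values in [R[i]]; [nm] is the same number in [R], where the order is
    total and [lra] and [nra] apply. *)
Definition nm (V : normedZmodType C) (x : V) : R := Re `|x|.

Section Normed.
Variable V : normedZmodType C.
Implicit Types (x y : V).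

Lemma nmE x : `|x| = (nm x)%:C.
Proof. by rewrite /nm RRe_real ?normr_real. Qed.

Lemma nm_ge0 x : 0 <= nm x.
Proof. by rewrite -ler0c -nmE. Qed.

Lemma nmD x y : nm (x + y) <= nm x + nm y.
Proof. by rewrite -lecR rmorphD /= -!nmE ler_normD. Qed.

Lemma nmN x : nm (- x) = nm x.
Proof. by rewrite /nm normrN. Qed.

Lemma nmB x y : nm (x - y) <= nm x + nm y.
Proof. by rewrite -(nmN y) nmD. Qed.

Lemma nm0 : nm (0 : V) = 0.
Proof. by rewrite /nm normr0. Qed.

Lemma nm_eq0 x : nm x = 0 -> x = 0.
Proof. by move=> x0; apply/normr0_eq0; rewrite nmE x0. Qed.
End Normed.

Lemma nmZ (V : normedModType C) (c : C) (x : V) : nm (c *: x) = nm c * nm x.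
Proof. by apply: complexI; rewrite rmorphM /= -!nmE normrZ. Qed.

Lemma nmM (a b : C) : nm (a * b) = nm a * nm b.
Proof. by apply: complexI; rewrite rmorphM /= -!nmE normrM. Qed.

Lemma nmV (a : C) : nm a^-1 = (nm a)^-1.
Proof. by apply: complexI; rewrite fmorphV /= -!nmE normfV. Qed.

Lemma nm1 : nm (1 : C) = 1.
Proof. by rewrite /nm normr1. Qed.

Lemma nmr (a : R) : nm (a%:C : C) = `|a|.
Proof. by rewrite /nm normc_def /= expr0n addr0 sqrtr_sqr. Qed.

Lemma nm_i : nm ('i : C) = 1.
Proof. by rewrite /nm normc_def /= expr0n add0r expr1n sqrtr1. Qed.

Lemma nm_sqr (a : C) : nm a ^+ 2 = Re a ^+ 2 + Im a ^+ 2.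
Proof. by apply: complexI; rewrite add_Re2_Im2 rmorphXn /= -nmE. Qed.

Lemma nm_Re (a : C) : `|Re a| <= nm a.
Proof. by rewrite -lecR -nmE normc_ge_Re. Qed.

Lemma Re_add (a b : C) : Re (a + b) = Re a + Re b. Proof. by case: a; case: b. Qed.
Lemma Re_opp (a : C) : Re (- a) = - Re a. Proof. by case: a. Qed.
Lemma Re_mul (a b : C) : Re (a * b) = Re a * Re b - Im a * Im b.
Proof. by case: a; case: b. Qed.
Lemma Re_conj_mul (a b : C) : Re (a^*%C * b) = Re a * Re b + Im a * Im b.
Proof. by case: a => a1 a2; case: b => b1 b2 /=; ring. Qed.
Lemma nmJ (a : C) : nm (a^*%C) = nm a.
Proof. by rewrite /nm normcJ. Qed.

End RealNorm.

(** * Goursat's theorem *)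

Section Goursat.
Variable R : realType.
Local Notation C := R[i].
Implicit Types (f : R -> C) (g : R -> R -> C).
Implicit Types t v w h x y : R.

(* The mean of [f] over the points [j / 2 ^ n], [j < 2 ^ n]. *)
Fixpoint dyadic_mean n f : C :=
  if n is m.+1 then
    (dyadic_mean m (fun t => f (t / 2)) +
     dyadic_mean m (fun t => f ((1 + t) / 2))) * (2^-1)%:C
  else f 0.

Lemma dyadic_mean_cst n (c : C) : dyadic_mean n (fun=> c) = c.
Proof.
elim: n => //= n ->.
have -> : c + c = c * 2%:C by rewrite [2%:C]rmorphD /=; ring.
by rewrite -mulrA -rmorphM /= divff ?mulr1.
Qed.

Lemma dyadic_meanB n f f1 :
  dyadic_mean n (fun t => f t - f1 t) = dyadic_mean n f - dyadic_mean n f1.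
Proof. by elim: n f f1 => //= n IH f f1; rewrite !IH; ring. Qed.

Lemma dyadic_mean_le n f (M : R) :
  (forall t : R, 0 <= t <= 1 -> nm (f t) <= M) -> nm (dyadic_mean n f) <= M.
Proof.
elim: n f => [|n IH] f fM /=; first by apply: fM; lra.
rewrite nmM nmr ger0_norm ?invr_ge0// ler_pdivrMr//.
rewrite (le_trans (nmD _ _))// (_ : M * 2 = M + M) ?lerD//; last by ring.
  by apply: IH => t t01; apply: fM; lra.
by apply: IH => t t01; apply: fM; lra.
Qed.

Lemma dyadic_mean_Re_ge0 n f :
  (forall t : R, 0 <= t <= 1 -> 0 <= Re (f t)) -> 0 <= Re (dyadic_mean n f).
Proof.
elim: n f => [|n IH] f f0 /=; first by apply: f0; lra.
rewrite Re_mul /= mulr0 subr0 mulr_ge0 ?invr_ge0// Re_add addr_ge0//.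
  by apply: IH => t t01; apply: f0; lra.
by apply: IH => t t01; apply: f0; lra.
Qed.

(** Replaces the positivity of the integral of a nonnegative function that is positive somewhere:
    the lower bound is the same for all levels beyond [m]. The interval where [f] is large starts at
    [0], so that it is always in the first half of a subdivision. *)
Lemma dyadic_mean_Re_ge n m f (e : R) : 0 <= e ->
  (forall t : R, 0 <= t <= 1 -> 0 <= Re (f t)) ->
  (forall t : R, 0 <= t <= 2^-1 ^+ m -> e <= Re (f t)) ->
  e * 2^-1 ^+ m <= Re (dyadic_mean (n + m) f).
Proof.
move=> e0; elim: m n f => [|m IH] n f f0 fe.
  rewrite addn0 expr0 mulr1.
  have fe' : forall t : R, 0 <= t <= 1 -> 0 <= Re (f t - e%:C).
    by move=> t t01; rewrite Re_add Re_opp /= subr_ge0 fe// expr0.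
  have := dyadic_mean_Re_ge0 n fe'.
  by rewrite dyadic_meanB dyadic_mean_cst Re_add Re_opp /= subr_ge0.
rewrite addnS /= Re_mul /= mulr0 subr0 exprS mulrCA [leLHS]mulrC ler_pM2r ?invr_gt0//.
rewrite Re_add -[leLHS]addr0 lerD//.
  apply: IH => t t01; first by apply: f0; lra.
  by apply: fe; rewrite exprS; lra.
by apply: dyadic_mean_Re_ge0 => t t01; apply: f0; lra.
Qed.

(* A Riemann sum for the integral of [g] along the boundary of a rectangle. *)
Definition boundary_sum n g (x y w h : R) : C :=
  w%:C * dyadic_mean n (fun t => g (x + t * w) y - g (x + t * w) (y + h)) +
  'i * (h%:C * dyadic_mean n (fun t => g (x + w) (y + t * h) - g x (y + t * h))).

(** The point of dyadic means: halving the rectangle lowers the level by one, so the quarters use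
    the sample points of the whole, and their inner edges cancel exactly rather than in the
    limit. *)
Lemma boundary_sum_split n g x y (w h : R) :
  boundary_sum n.+1 g x y w h =
    boundary_sum n g x y (w / 2) (h / 2) +
    boundary_sum n g (x + w / 2) y (w / 2) (h / 2) +
    (boundary_sum n g x (y + h / 2) (w / 2) (h / 2) +
     boundary_sum n g (x + w / 2) (y + h / 2) (w / 2) (h / 2)).
Proof.
rewrite /boundary_sum /= !dyadic_meanB.
have e1 (z v t : R) : z + t / 2 * v = z + t * (v / 2) by ring.
have e2 (z v t : R) : z + (1 + t) / 2 * v = z + v / 2 + t * (v / 2) by ring.
have e3 (z v : R) : z + v / 2 + v / 2 = z + v by lra.
have r1 (F : R -> C) z v : (fun t => F (z + t / 2 * v)) = (fun t => F (z + t * (v / 2))).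
  by apply/funext => t; rewrite e1.
have r2 (F : R -> C) z v :
   (fun t => F (z + (1 + t) / 2 * v)) = (fun t => F (z + v / 2 + t * (v / 2))).
  by apply/funext => t; rewrite e2.
rewrite !(r1 (g^~ _)) !(r2 (g^~ _)) !(r1 (g _)) !(r2 (g _)) !e3 !rmorphM /=.
ring.
Qed.

(** Complex differentiability at x + i y, with derivative [a], in the real coordinates in which
    rectangles are subdivided. *)
Definition cauchy_riemann g x y := exists a : C, forall e : R, 0 < e ->
  exists2 d : R, 0 < d & forall x' y', `|x' - x| <= d -> `|y' - y| <= d ->
    nm (g x' y' - g x y - a * ((x' - x) +i* (y' - y))) <=
      e * (`|x' - x| + `|y' - y|).

(** On opposite edges an affine map differs by a constant, so its Riemann sums are exact at every
    level and no quadrature error enters the bisection. *)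
Lemma boundary_sum_affine n (c a : C) x0 y0 x y (w h : R) :
  boundary_sum n (fun x' y' => c + a * ((x' - x0) +i* (y' - y0))) x y w h = 0.
Proof.
rewrite /boundary_sum.
under [X in dyadic_mean n X]funext => t.
  rewrite (_ : _ - _ = - (a * ('i * h%:C))); last first.
    rewrite opprD addrACA subrr add0r -mulrBr -mulrN; congr (_ * _).
    by apply/eqP; rewrite eq_complex /=; apply/andP; split; apply/eqP; ring.
  over.
under [X in 'i * (_ * dyadic_mean n X)]funext => t.
  rewrite (_ : _ - _ = a * w%:C); last first.
    rewrite opprD addrACA subrr add0r -mulrBr; congr (_ * _).
    by apply/eqP; rewrite eq_complex /=; apply/andP; split; apply/eqP; ring.
  over.
by rewrite !dyadic_mean_cst; ring.
Qed.

Lemma boundary_sumB n g g1 x y (w h : R) :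
  boundary_sum n (fun x y => g x y - g1 x y) x y w h =
  boundary_sum n g x y w h - boundary_sum n g1 x y w h.
Proof. by rewrite /boundary_sum !dyadic_meanB; ring. Qed.

Lemma boundary_sum_le n g x y (w h M : R) : 0 <= w -> 0 <= h ->
  (forall x' y', x <= x' <= x + w -> y <= y' <= y + h -> nm (g x' y') <= M) ->
  nm (boundary_sum n g x y w h) <= 2 * (w + h) * M.
Proof.
move=> w0 h0 gM.
have tw t v : 0 <= v -> 0 <= t <= 1 -> 0 <= t * v <= v.
  by move=> v0 /andP[t0 t1]; rewrite mulr_ge0//= ler_piMl.
rewrite (le_trans (nmD _ _))// !nmM nm_i !nmr mul1r !ger0_norm//.
rewrite (_ : _ * M = w * (2 * M) + h * (2 * M)); last by ring.
rewrite lerD// ler_wpM2l//; apply: dyadic_mean_le => t t01.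
  rewrite (le_trans (nmB _ _))// (_ : 2 * M = M + M); last by ring.
  by rewrite lerD// gM//; have := tw t w w0 t01; lra.
rewrite (le_trans (nmB _ _))// (_ : 2 * M = M + M); last by ring.
by rewrite lerD// gM//; have := tw t h h0 t01; lra.
Qed.

(** [P k x y] stands for a property of the rectangle with lower left corner (x, y) and sides w / 2 ^
    k, h / 2 ^ k; the two booleans select one of its quarters. *)
Lemma bisection (P : nat -> R -> R -> Prop) (w h : R) x y : 0 <= w -> 0 <= h ->
  P 0%N x y ->
  (forall k x y, P k x y -> exists a b : bool,
     P k.+1 (x + a%:R * (w / 2 ^+ k.+1)) (y + b%:R * (h / 2 ^+ k.+1))) ->
  exists x0 y0, [/\ x <= x0 <= x + w, y <= y0 <= y + h &
    forall k, exists x' y', [/\ P k x' y',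
      x <= x' <= x0 /\ x0 <= x' + w / 2 ^+ k <= x + w &
      y <= y' <= y0 /\ y0 <= y' + h / 2 ^+ k <= y + h]].
Proof.
move=> w0 h0 P0 PS.
(* The state carries the generation along with the corner. Where [P] fails the successor is the
   state itself, which makes the relation total for [choice]. *)
have PS' (s : nat * (R * R)) : exists s' : nat * (R * R), P s.1 s.2.1 s.2.2 ->
   [/\ s'.1 = s.1.+1, P s'.1 s'.2.1 s'.2.2,
   exists a : bool, s'.2.1 = s.2.1 + a%:R * (w / 2 ^+ s.1.+1) &
   exists b : bool, s'.2.2 = s.2.2 + b%:R * (h / 2 ^+ s.1.+1)].
  have [Ps|nPs] := pselect (P s.1 s.2.1 s.2.2); last by exists s.
  have [a [b Pab]] := PS _ _ _ Ps.
  by eexists (_, (_, _)) => _; split; [reflexivity|exact: Pab|exists a|exists b].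
have [F HF] := choice PS'.
pose s k := iter k F (0%N, (x, y)).
have sP k : (s k).1 = k /\ P k (s k).2.1 (s k).2.2.
  elim: k => [|k [IH1 IH2]]; first by [].
  have [|s1 s2 _ _] := HF (s k); first by rewrite IH1.
  by rewrite /s /= s1 IH1; split=> //; move: s2; rewrite s1 IH1.
have sx k : exists a : bool, (s k.+1).2.1 = (s k).2.1 + a%:R * (w / 2 ^+ k.+1).
  by have [sk Pk] := sP k; have [|_ _ + _] := HF (s k); rewrite sk.
have sy k : exists a : bool, (s k.+1).2.2 = (s k).2.2 + a%:R * (h / 2 ^+ k.+1).
  by have [sk Pk] := sP k; have [|_ _ _ +] := HF (s k); rewrite sk.
have nest (u : nat -> R) v : 0 <= v ->
    (forall k, exists a : bool, u k.+1 = u k + a%:R * (v / 2 ^+ k.+1)) ->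
    exists u0, forall k, u 0%N <= u k <= u0 /\ u0 <= u k + v / 2 ^+ k <= u 0%N + v.
  move=> v0 us.
  have vk k : 0 <= v / 2 ^+ k by rewrite divr_ge0// exprn_ge0.
  have vS k : v / 2 ^+ k = v / 2 ^+ k.+1 + v / 2 ^+ k.+1.
    by rewrite exprS invfM; field; rewrite expf_neq0.
  have u1 k : u k <= u k.+1.
    by have [[] ->] := us k; rewrite /= ?mulr1n ?mulr0n ?mul1r ?mul0r ?addr0// lerDl.
  have u2 k : u k.+1 + v / 2 ^+ k.+1 <= u k + v / 2 ^+ k.
    by have := vS k; have := vk k.+1; have [[] ->] := us k; rewrite /= ?mulr1n ?mulr0n ?mul1r ?mul0r; lra.
  have m1 k l : u k <= u (k + l)%N.
    by elim: l => [|l IH]; rewrite ?addn0// addnS (le_trans IH).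
  have m2 k l : u (k + l)%N + v / 2 ^+ (k + l) <= u k + v / 2 ^+ k.
    by elim: l => [|l IH]; rewrite ?addn0// addnS (le_trans _ IH).
  have ub k l : u l <= u k + v / 2 ^+ k.
    rewrite (@le_trans _ _ (u (k + l)%N)) //; first by rewrite addnC m1.
    by rewrite (le_trans _ (m2 k l))// lerDl.
  exists (sup (range u)) => k; split; apply/andP; split.
  - exact: (m1 0%N k).
  - by apply: ub_le_sup; [exists (u 0%N + v / 2 ^+ 0) => _ [l _ <-]|exists k].
  - by apply: ge_sup; [exists (u 0%N), 0%N|move=> _ [l _ <-]].
  - by have := m2 0%N k; rewrite add0n expr0 divr1.
have [x0 x0P] := nest _ _ w0 sx; have [y0 y0P] := nest _ _ h0 sy.
exists x0, y0; split; [have := x0P 0%N|have := y0P 0%N|]; rewrite ?expr0 ?divr1/=.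
- by lra.
- by lra.
by move=> k; exists (s k).2.1, (s k).2.2; have [_ Pk] := sP k.
Qed.

Theorem goursat g x y (w h : R) : 0 <= w -> 0 <= h ->
  (forall x' y', x <= x' <= x + w -> y <= y' <= y + h -> cauchy_riemann g x' y') ->
  forall e : R, 0 < e -> exists N, forall n, (N <= n)%N ->
    nm (boundary_sum n g x y w h) <= e.
Proof.
move=> w0 h0 gd e e0; apply: contrapT => Ne.
(* Failure for arbitrarily large [n], not for a single one, is what subdivision preserves: splitting
   costs one level, and eventual bounds on all four quarters would add up to an eventual bound on
   the whole. *)
pose P k x' y' := forall m, exists2 n, (m <= n)%N &
  e / 4 ^+ k < nm (boundary_sum n g x' y' (w / 2 ^+ k) (h / 2 ^+ k)).
have P0 : P 0%N x y.
  move=> m; apply: contrapT => H; apply: Ne; exists m => n mn.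
  rewrite leNgt; apply/negP => He; apply: H; exists n => //.
  by rewrite !expr0 !divr1.
have PS k x' y' : P k x' y' -> exists a b : bool,
    P k.+1 (x' + a%:R * (w / 2 ^+ k.+1)) (y' + b%:R * (h / 2 ^+ k.+1)).
  move=> Pk; apply: contrapT => H.
  have H' (a b : bool) : exists m, forall n, (m <= n)%N ->
     nm (boundary_sum n g (x' + a%:R * (w / 2 ^+ k.+1)) (y' + b%:R * (h / 2 ^+ k.+1))
       (w / 2 ^+ k.+1) (h / 2 ^+ k.+1)) <= e / 4 ^+ k.+1.
    apply: contrapT => Hm; apply: H; exists a, b => m; apply: contrapT => Hn.
    apply: Hm; exists m => n mn; rewrite leNgt; apply/negP => He.
    by apply: Hn; exists n.
  have [m1 M1] := H' false false; have [m2 M2] := H' true false.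
  have [m3 M3] := H' false true; have [m4 M4] := H' true true.
  have [n] := Pk (maxn (maxn m1 m2) (maxn m3 m4)).+1.
  case: n => // n; rewrite ltnS !geq_max => /andP[/andP[l1 l2] /andP[l3 l4]].
  rewrite boundary_sum_split; apply/negP; rewrite -leNgt.
  have := M1 n l1; have := M2 n l2; have := M3 n l3; have := M4 n l4.
  rewrite ?mul1r ?mul0r ?addr0.
  have hv (v : R) : v / 2 ^+ k.+1 = v / 2 ^+ k / 2 by rewrite exprSr invfM mulrA.
  rewrite !hv; have -> : e / 4 ^+ k = 4 * (e / 4 ^+ k.+1).
    by rewrite exprS invfM mulrCA [4 * _]mulrA divff ?mul1r.
  move=> b4 b3 b2 b1; have := lerD (lerD b1 b2) (lerD b3 b4).
  move=> b; rewrite (le_trans (nmD _ _))// (le_trans (lerD (nmD _ _) (nmD _ _)))//.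
  by rewrite (le_trans b)//; lra.
have [x0 [y0 [xx0 yy0 nested]]] := bisection w0 h0 P0 PS.
have [a ga] := gd _ _ xx0 yy0.
have K0 : 0 < 2 * (w + h) ^+ 2 + 1 by rewrite ltr_wpDl// mulr_ge0// sqr_ge0.
have [d d0 gad] := ga (e / (2 * (w + h) ^+ 2 + 1)) (divr_gt0 e0 K0).
have [k kd] : exists k, (w + h) / 2 ^+ k <= d.
  pose k := (Num.Def.trunc ((w + h) / d)).+1.
  have kP : (w + h) / d < k%:R by exact: truncnS_gt.
  exists k; rewrite ler_pdivrMr ?exprn_gt0// mulrC -ler_pdivrMr//.
  rewrite (le_trans (ltW kP))// -natrX ler_nat ltnW//; exact: ltn_expl.
have [x' [y' [Pk xx' yy']]] := nested k.
have [n _] := Pk 0%N; apply/negP; rewrite -leNgt.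
have wk : 0 <= w / 2 ^+ k by rewrite divr_ge0// exprn_ge0.
have hk : 0 <= h / 2 ^+ k by rewrite divr_ge0// exprn_ge0.
rewrite mulrDl in kd.
rewrite -[boundary_sum _ _ _ _ _ _]subr0.
rewrite -(boundary_sum_affine n (g x0 y0) a x0 y0 x' y' (w / 2 ^+ k) (h / 2 ^+ k)).
rewrite -boundary_sumB.
have err : forall x1 y1, x' <= x1 <= x' + w / 2 ^+ k -> y' <= y1 <= y' + h / 2 ^+ k ->
    nm (g x1 y1 - (g x0 y0 + a * ((x1 - x0) +i* (y1 - y0)))) <=
    e / (2 * (w + h) ^+ 2 + 1) * ((w + h) / 2 ^+ k).
  move=> x1 y1 Hx1 Hy1.
  have dx : `|x1 - x0| <= w / 2 ^+ k by rewrite ler_norml; lra.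
  have dy : `|y1 - y0| <= h / 2 ^+ k by rewrite ler_norml; lra.
  rewrite opprD addrA (le_trans (gad _ _ _ _))//; [lra|lra|].
  by rewrite ler_wpM2l ?divr_ge0 ?(ltW K0) ?(ltW e0)// mulrDl lerD.
rewrite (le_trans (boundary_sum_le n wk hk err))//.
have -> : 4 ^+ k = (2 ^+ k) ^+ 2 :> R by rewrite exprAC; congr (_ ^+ _); ring.
set q := 2 ^+ k; have q0 : 0 < q by rewrite exprn_gt0.
have -> : 2 * (w / q + h / q) * (e / (2 * (w + h) ^+ 2 + 1) * ((w + h) / q)) =
   e / q ^+ 2 * (2 * (w + h) ^+ 2 / (2 * (w + h) ^+ 2 + 1)).
  by field; rewrite !gt_eqF.
rewrite ler_piMr ?divr_ge0 ?(ltW e0) ?sqr_ge0// ler_pdivrMr// mul1r.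
by rewrite lerDl.
Qed.
End Goursat.

(** * Complex differentiation *)

Section Derivative.
Variable R : realType.
Local Notation C := R[i].
Implicit Types (D : set C) (f g : C -> C) (z w d : C).

(* Complex differentiability along [D], typically the plane or the real axis. *)
Definition cderiv D f z d := forall e : R, 0 < e ->
  exists2 r : R, 0 < r & forall w, D w -> nm (w - z) <= r ->
    nm (f w - f z - d * (w - z)) <= e * nm (w - z).

Definition ccont D f z := forall e : R, 0 < e ->
  exists2 r : R, 0 < r & forall w, D w -> nm (w - z) <= r -> nm (f w - f z) <= e.

Lemma cderiv_lip D f z d : cderiv D f z d ->
  exists2 r : R, 0 < r & forall w, D w -> nm (w - z) <= r ->
    nm (f w - f z) <= (nm d + 1) * nm (w - z).
Proof.
move=> /(_ 1 ltr01)[r r0 fr]; exists r => // w Dw wr.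
rewrite -[_ - f z](subrK (d * (w - z))) (le_trans (nmD _ _))//.
by rewrite nmM mulrDl addrC lerD// fr.
Qed.

Lemma cderiv_cont D f z d : cderiv D f z d -> ccont D f z.
Proof.
move=> /cderiv_lip[r r0 fr] e e0.
have d0 : 0 < nm d + 1 by rewrite ltr_wpDl// nm_ge0.
exists (Num.min r (e / (nm d + 1))); first by rewrite lt_min r0 divr_gt0.
move=> w Dw; rewrite le_min => /andP[wr we].
by rewrite (le_trans (fr w Dw wr))// mulrC -ler_pdivlMr.
Qed.

Lemma cderiv_eq D f z d d' : cderiv D f z d -> d = d' -> cderiv D f z d'.
Proof. by move=> ? <-. Qed.

Lemma cderiv_ext D f g z d : (exists2 r : R, 0 < r &
    forall w, nm (w - z) <= r -> f w = g w) ->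
  cderiv D f z d -> cderiv D g z d.
Proof.
move=> [r r0 fg] fd e e0; have [r' r'0 fr] := fd e e0.
exists (Num.min r r'); first by rewrite lt_min r0.
move=> w Dw; rewrite le_min => /andP[wr wr'].
by rewrite -!fg ?fr// subrr nm0 ltW.
Qed.

Lemma cderiv_cst D (c : C) z : cderiv D (fun=> c) z 0.
Proof.
by move=> e e0; exists 1 => // w _ _; rewrite subrr mul0r subr0 nm0 mulr_ge0 ?nm_ge0 ?ltW.
Qed.

Lemma cderiv_id D z : cderiv D id z 1.
Proof.
by move=> e e0; exists 1 => // w _ _; rewrite mul1r subrr nm0 mulr_ge0 ?nm_ge0 ?ltW.
Qed.

Lemma cderivD D f g z d d' : cderiv D f z d -> cderiv D g z d' ->
  cderiv D (fun w => f w + g w) z (d + d').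
Proof.
move=> fd gd e e0; have e2 : 0 < e / 2 by rewrite divr_gt0.
have [r r0 fr] := fd _ e2; have [s s0 gs] := gd _ e2.
exists (Num.min r s); first by rewrite lt_min r0.
move=> w Dw; rewrite le_min => /andP[wr ws].
have := lerD (fr w Dw wr) (gs w Dw ws); rewrite -mulrDl -splitr; apply: le_trans.
by rewrite (le_trans _ (nmD _ _))// le_eqVlt; apply/orP; left; apply/eqP; congr nm; ring.
Qed.

Lemma cderivM D f g z d d' : cderiv D f z d -> cderiv D g z d' ->
  cderiv D (fun w => f w * g w) z (d * g z + f z * d').
Proof.
move=> fd gd e e0.
have [r1 r10 fl] := cderiv_lip fd.
pose K := nm (g z) + nm (f z) + nm d + 2.
have K0 : 0 < K by have := nm_ge0 (g z); have := nm_ge0 (f z); have := nm_ge0 d; rewrite /K; lra.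
have eK : 0 < e / K by rewrite divr_gt0.
have [r2 r20 fr] := fd _ eK; have [r3 r30 gr] := gd _ eK.
have [r4 r40 gc] := cderiv_cont gd eK.
exists (Num.min (Num.min r1 r2) (Num.min r3 r4)); first by rewrite !lt_min r10 r20 r30.
move=> w Dw; rewrite !le_min => /andP[/andP[w1 w2] /andP[w3 w4]].
rewrite (_ : _ - _ = (f w - f z) * (g w - g z) +
   ((f w - f z - d * (w - z)) * g z + f z * (g w - g z - d' * (w - z)))); last by ring.
have h1 : nm ((f w - f z) * (g w - g z)) <= (nm d + 1) * nm (w - z) * (e / K).
  by rewrite nmM ler_pM ?nm_ge0 ?fl ?gc.
have h2 : nm ((f w - f z - d * (w - z)) * g z) <= e / K * nm (w - z) * nm (g z).
  by rewrite nmM ler_wpM2r ?nm_ge0 ?fr.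
have h3 : nm (f z * (g w - g z - d' * (w - z))) <= nm (f z) * (e / K * nm (w - z)).
  by rewrite nmM ler_wpM2l ?nm_ge0 ?gr.
rewrite (le_trans (nmD _ _))// (le_trans (lerD h1 (le_trans (nmD _ _) (lerD h2 h3))))//.
have -> : (nm d + 1) * nm (w - z) * (e / K) +
  (e / K * nm (w - z) * nm (g z) + nm (f z) * (e / K * nm (w - z))) =
  (K - 1) * (e / K * nm (w - z)) by rewrite /K; ring.
rewrite [leRHS](_ : _ = K * (e / K * nm (w - z))); last by field; rewrite gt_eqF.
by apply: ler_wpM2r; rewrite ?gerBl// mulr_ge0 ?nm_ge0 ?(ltW eK).
Qed.

Lemma cderivN D f z d : cderiv D f z d -> cderiv D (fun w => - f w) z (- d).
Proof.
move=> fd e /(fd e)[r r0 fr]; exists r => // w Dw /(fr w Dw); apply: le_trans.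
by rewrite -nmN le_eqVlt; apply/orP; left; apply/eqP; congr nm; ring.
Qed.

Lemma cderivB D f g z d d' : cderiv D f z d -> cderiv D g z d' ->
  cderiv D (fun w => f w - g w) z (d - d').
Proof. by move=> fd /cderivN; apply: cderivD. Qed.

Lemma cderiv_comp D (g f : C -> C) z d d' :
  cderiv D f z d -> cderiv setT g (f z) d' -> cderiv D (g \o f) z (d' * d).
Proof.
move=> fd gd e e0.
have [r1 r10 fl] := cderiv_lip fd.
pose K := nm d' + nm d + 2.
have K0 : 0 < K by have := nm_ge0 d'; have := nm_ge0 d; rewrite /K; lra.
have eK : 0 < e / K by rewrite divr_gt0.
have [r2 r20 fr] := fd _ eK; have [r3 r30 gr] := gd _ eK.
have [r4 r40 fc] := cderiv_cont fd r30.
exists (Num.min (Num.min r1 r2) r4); first by rewrite !lt_min r10 r20.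
move=> w Dw; rewrite !le_min => /andP[/andP[w1 w2] w4] /=.
rewrite (_ : _ - _ = (g (f w) - g (f z) - d' * (f w - f z)) +
   d' * (f w - f z - d * (w - z))); last by ring.
have h1 : nm (g (f w) - g (f z) - d' * (f w - f z)) <= e / K * ((nm d + 1) * nm (w - z)).
  by rewrite (le_trans (gr _ _ _)) ?fc// ler_wpM2l ?(ltW eK)// fl.
have h2 : nm (d' * (f w - f z - d * (w - z))) <= nm d' * (e / K * nm (w - z)).
  by rewrite nmM ler_wpM2l ?nm_ge0 ?fr.
rewrite (le_trans (nmD _ _))// (le_trans (lerD h1 h2))//.
rewrite [leLHS](_ : _ = (K - 1) * (e / K * nm (w - z))); last by rewrite /K; ring.
rewrite [leRHS](_ : _ = K * (e / K * nm (w - z))); last by field; rewrite gt_eqF.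
by apply: ler_wpM2r; rewrite ?gerBl// mulr_ge0 ?nm_ge0 ?(ltW eK).
Qed.

Lemma nm_gt0 (V : normedZmodType C) (x : V) : (0 < nm x) = (x != 0).
Proof.
rewrite lt_def nm_ge0 andbT; congr (~~ _).
by apply/eqP/eqP => [/nm_eq0|->]; rewrite ?nm0.
Qed.

Lemma cderiv_inv D z : z != 0 -> cderiv D (fun w => w^-1) z (- z^-1 ^+ 2).
Proof.
move=> z0 e e0; have nz0 : 0 < nm z by rewrite nm_gt0.
have e' : 0 < e * nm z ^+ 3 / 2 by rewrite divr_gt0// mulr_gt0// exprn_gt0.
exists (Num.min (nm z / 2) (e * nm z ^+ 3 / 2)); first by rewrite lt_min divr_gt0.
move=> w _; rewrite le_min => /andP[wz we].
have nw : nm z / 2 <= nm w.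
  by have := nmB w (w - z); rewrite opprB addrC subrK; lra.
have w0 : w != 0 by rewrite -nm_gt0; lra.
rewrite (_ : _ - _ = (w - z) ^+ 2 / (w * z ^+ 2)); last by field; rewrite z0.
rewrite nmM nmV !nmM -mulrA mulrC ler_wpM2r ?nm_ge0//.
rewrite ler_pdivrMr ?mulr_gt0 ?(lt_le_trans _ nw) ?divr_gt0//.
rewrite (le_trans we)//.
have -> : e * nm z ^+ 3 / 2 = e * (nm z / 2 * (nm z * nm z)) by field.
by rewrite ler_pM2l// ler_pM2r ?mulr_gt0.
Qed.

Lemma cderivV D f z d : f z != 0 -> cderiv D f z d ->
  cderiv D (fun w => (f w)^-1) z (- (f z)^-1 ^+ 2 * d).
Proof. by move=> fz0 fd; exact: (cderiv_comp fd (cderiv_inv setT fz0)). Qed.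

End Derivative.

(** * Mean values and the maximum principle *)

Section MeanValue.
Variable R : realType.
Local Notation C := R[i].
Implicit Types (f : C -> C) (z w d : C) (r e t : R).

Lemma derive_expansion (f : R -> R) (x d : R) : is_derive x 1 f d ->
  forall e, 0 < e -> exists2 r, 0 < r &
    forall t, `|t| <= r -> `|f (x + t) - f x - d * t| <= e * `|t|.
Proof.
move=> [fx fd] e e0.
have : (fun h => h^-1 *: (f (h *: 1 + x) - f x)) @ 0^' --> d by rewrite -fd; exact: fx.
move=> /cvgrPdist_le/(_ e e0)/nbhs_ballP[r /= r0 rP].
exists (r / 2); first by rewrite divr_gt0.
move=> t tr; have [->|t0] := eqVneq t 0; first by rewrite addr0 subrr mulr0 subr0 normr0 mulr0.
have := rP t; rewrite /= -ball_normE /= sub0r normrN => /(_ _ t0).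
have tr' : `|t| < r by rewrite (le_lt_trans tr)// gtr_pMr// invf_lt1 ?ltr1n.
move=> /(_ tr'); rewrite -(@ler_pM2r _ `|t|) ?normr_gt0// -normrM; apply: le_trans.
rewrite -normrN le_eqVlt; apply/orP; left; apply/eqP; congr (`|_|).
rewrite /GRing.scale /= mulr1 [t + x]addrC; by field.
Qed.

Definition cis t : C := cos t +i* sin t.

Lemma cisD t t' : cis (t + t') = cis t * cis t'.
Proof. by rewrite /cis cosD sinD; apply/eqP; rewrite eq_complex /= eqxx /= addrC. Qed.

Lemma nm_cis t : nm (cis t) = 1.
Proof. by rewrite /nm normc_def /= cos2Dsin2 sqrtr1. Qed.

Lemma nm_le_ReIm z : nm z <= `|Re z| + `|Im z|.
Proof.
rewrite -(@ler_pXn2r _ 2)// ?nnegrE ?nm_ge0 ?addr_ge0// nm_sqr sqrrD.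
by rewrite !real_normK ?num_real//; have := mulr_ge0 (normr_ge0 (Re z)) (normr_ge0 (Im z)); lra.
Qed.

Lemma polar_expansion e : 0 < e -> exists2 r, 0 < r & forall u v : R,
  `|u| <= r -> `|v| <= r ->
  nm ((expR u)%:C * cis v - 1 - (u +i* v)) <= e * (`|u| + `|v|).
Proof.
(* The estimates below collect 2 c |u| + 5 c |v|; the bound c <= 1 gives |1 + u| <= 2. *)
move=> e0; have [c [c0 c1 ce]] : exists c : R, [/\ 0 < c, c <= 1 & 7 * c <= e].
  exists (Num.min 1 (e / 7)); split; first by rewrite lt_min ltr01 divr_gt0.
    by rewrite ge_min lexx.
  by rewrite mulrC -ler_pdivlMr// ge_min lexx orbT.
have [r1 r10 E] := derive_expansion (is_derive_expR 0) c0.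
have [r2 r20 K] := derive_expansion (is_derive_cos 0) c0.
have [r3 r30 S] := derive_expansion (is_derive_sin 0) c0.
exists (Num.min c (Num.min r1 (Num.min r2 r3))); first by rewrite !lt_min c0 r10 r20.
move=> u v; rewrite !le_min => /and4P[uc u1 _ _] /and4P[vc _ v2 v3].
have := E u u1; have := K v v2; have := S v v3.
rewrite !add0r expR0 cos0 sin0 !(oppr0, mul0r, addr0, mul1r) => Hs Hc He.
rewrite (le_trans (nm_le_ReIm _))// /= !mul0r !addr0 ?subr0 ?oppr0.
have := cos_max v; set s := sin v in Hs *; set k := cos v in Hc *.
set x := expR u in He *; move=> k1.
have -> : x * k - 1 - u = (x - 1 - u) * k + (1 + u) * (k - 1) by ring.
have -> : x * s - v = (x - 1 - u) * s + (u * s + (s - v)) by ring.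
have sv : `|s| <= 2 * `|v|.
  rewrite -[s](subrK v) (le_trans (ler_normD _ _))//; by have := ler_wpM2r (normr_ge0 v) c1; rewrite mul1r; lra.
have s1 : `|s| <= 1 by rewrite sin_max.
rewrite (le_trans (lerD (ler_normD _ _) (ler_normD _ _)))// !normrM.
have b1 : `|x - 1 - u| * `|k| <= c * `|u| by rewrite -[leRHS]mulr1 ler_pM.
have b2 : `|1 + u| * `|k - 1| <= 2 * (c * `|v|).
  rewrite ler_pM// (le_trans (ler_normD _ _))// normr1; lra.
have b3 : `|x - 1 - u| * `|s| <= c * `|u| by rewrite -[leRHS]mulr1 ler_pM.
have b4 : `|u * s + (s - v)| <= 2 * (c * `|v|) + c * `|v|.
  rewrite (le_trans (ler_normD _ _))// lerD// normrM mulrCA.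
  by rewrite ler_pM.
have : (7 * c) * (`|u| + `|v|) <= e * (`|u| + `|v|) by rewrite ler_wpM2r// addr_ge0.
have := mulr_ge0 (ltW c0) (normr_ge0 u); have := mulr_ge0 (ltW c0) (normr_ge0 v).
by lra.
Qed.

(** The chain rule for f after exp, with derivative d z because exp is its own derivative. Circles
    around [0] become vertical segments, so that [goursat] on rectangles covers annuli. *)
Lemma polar_cauchy_riemann f (x y : R) d :
  cderiv setT f ((expR x)%:C * cis y) d ->
  cauchy_riemann (fun x y => f ((expR x)%:C * cis y)) x y.
Proof.
set z := _ * _ => fd; exists (d * z) => e e0.
pose K := nm z * 2 + nm d * nm z + 1.
have K0 : 0 < K by have := nm_ge0 z; have := mulr_ge0 (nm_ge0 d) (nm_ge0 z); rewrite /K; lra.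
have eK : 0 < e / K by rewrite divr_gt0.
have [r1 r10 fr] := fd _ eK.
have [r2 r20 P] := polar_expansion eK.
have [r3 r30 P1] := polar_expansion ltr01.
have rz : 0 < r1 / (nm z * 2 + 1) / 2.
  by rewrite divr_gt0// divr_gt0// ltr_wpDl// mulr_ge0 ?nm_ge0.
exists (Num.min (Num.min r2 r3) (r1 / (nm z * 2 + 1) / 2)); first by rewrite !lt_min r20 r30.
move=> x' y'; rewrite !le_min => /andP[/andP[x2 x3] x1] /andP[/andP[y2 y3] y1].
have -> : (expR x')%:C * cis y' = z * ((expR (x' - x))%:C * cis (y' - y)).
  have -> : expR x' = expR x * expR (x' - x) by rewrite -expRD subrKC.
  have -> : cis y' = cis y * cis (y' - y) by rewrite -cisD subrKC.
  by rewrite /z rmorphM /= mulrACA.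
set p := _ * cis _.
have p1 : nm (p - 1) <= 2 * (`|x' - x| + `|y' - y|).
  rewrite -[p - 1](subrK ((x' - x) +i* (y' - y))) (le_trans (nmD _ _))//.
  have := P1 _ _ x3 y3; have := nm_le_ReIm ((x' - x) +i* (y' - y)) => /= h1 h2.
  by rewrite (le_trans (lerD h2 h1))//; lra.
set q := _ +i* _; set s := `|x' - x| + `|y' - y| in p1 *.
have s0 : 0 <= s by rewrite addr_ge0.
have zp : nm (z * p - z) <= nm z * 2 * s.
  by rewrite -{2}[z]mulr1 -mulrBr nmM -mulrA ler_wpM2l ?nm_ge0.
have zr : nm (z * p - z) <= r1.
  rewrite (le_trans zp)// (@le_trans _ _ ((nm z * 2 + 1) * s))//.
    by rewrite ler_wpM2r// lerDl.
  rewrite mulrC -ler_pdivlMr; last by rewrite ltr_wpDl// mulr_ge0 ?nm_ge0.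
  by rewrite /s; lra.
rewrite (_ : _ - _ = (f (z * p) - f z - d * (z * p - z)) + d * z * (p - 1 - q)); last by ring.
rewrite (le_trans (nmD _ _))//.
have h1 : nm (f (z * p) - f z - d * (z * p - z)) <= e / K * (nm z * 2 * s).
  by rewrite (le_trans (fr _ _ _))// ler_wpM2l ?(ltW eK).
have h2 : nm (d * z * (p - 1 - q)) <= nm d * nm z * (e / K * s).
  by rewrite !nmM ler_wpM2l ?mulr_ge0 ?nm_ge0 ?P.
rewrite (le_trans (lerD h1 h2))//.
rewrite [leLHS](_ : _ = (K - 1) * (e / K * s)); last by rewrite /K; ring.
rewrite [leRHS](_ : _ = K * (e / K * s)); last by field; rewrite gt_eqF.
by apply: ler_wpM2r; rewrite ?gerBl// mulr_ge0 ?(ltW eK).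
Qed.
End MeanValue.

Section MaximumPrinciple.
Variable R : realType.
Local Notation C := R[i].
Implicit Types (f q : C -> C) (z w d : C) (r e t : R).

Lemma cis0 : cis 0 = 1 :> C.
Proof. by rewrite /cis cos0 sin0. Qed.

Lemma cis2pi : cis (pi *+ 2) = 1 :> C.
Proof. by rewrite /cis cos2pi sin2pi. Qed.

Lemma nm_real_cis r t : 0 <= r -> nm (r%:C * cis t) = r.
Proof. by move=> r0; rewrite nmM nm_cis mulr1 nmr ger0_norm. Qed.

(** On the rectangle [-w, 0] x [0, 2 pi] of logarithmic coordinates the horizontal edges cancel by
    periodicity, and the vertical ones give the means over the circles of radii r and r exp (-w).
    The inner mean is close to f 0 by continuity. Asking only for continuity at [0] is what admits
    difference quotients later. *)
Lemma mean_circle f r : 0 < r < 1 -> ccont setT f 0 ->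
  (forall z, 0 < nm z < 1 -> exists d, cderiv setT f z d) ->
  forall e, 0 < e -> exists N, forall n, (N <= n)%N ->
    nm (dyadic_mean n (fun t => f (r%:C * cis (t * (pi *+ 2)))) - f 0) <= e.
Proof.
move=> /andP[r0 r1] f0 fd e e0.
have e2 : 0 < e / 2 by rewrite divr_gt0.
have [s s0 fs] := f0 _ e2.
pose p2 : R := pi *+ 2; have p20 : 0 < p2 by rewrite mulrn_wgt0// pi_gt0.
(* The inner circle is shrunk into the disc on which [f] is within e / 2 of f 0. *)
have [w w0 ws] : exists2 w : R, 0 <= w & r * expR (- w) <= s.
  exists (Num.max 0 (ln (r / s))); first by rewrite le_max lexx.
  rewrite expRN -ler_pdivlMr ?invr_gt0 ?expR_gt0// invrK mulrC -ler_pdivrMr//.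
  rewrite -[leLHS](@lnK R) ?posrE ?divr_gt0// ler_expR le_max lexx orbT//.
pose g (x y : R) : C := f ((r%:C * (expR x)%:C) * cis y).
have g_cr x y : x <= 0 -> cauchy_riemann g x y.
  move=> x0.
  have gE : g = fun x y => f ((expR (ln r + x))%:C * cis y).
    by apply/funext => x'; apply/funext => y'; rewrite /g expRD lnK ?posrE// rmorphM.
  rewrite gE; set x1 := ln r + x.
  have [d fdd] : exists d, cderiv setT f ((expR x1)%:C * cis y) d.
    apply: fd; rewrite nm_real_cis ?expR_ge0// expR_gt0/=.
    by rewrite expRD lnK ?posrE// (le_lt_trans _ r1)// ler_piMr ?(ltW r0)// -expR0 ler_expR.
  have [a ga] := polar_cauchy_riemann fdd.
  exists a => e' e'0; have [d' d'0 gd] := ga _ e'0.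
  exists d' => // x' y' xx yy.
  have xxE : ln r + x' - x1 = x' - x by rewrite /x1; ring.
  by rewrite -xxE; apply: gd; rewrite ?xxE.
have [|N NP] := @goursat R g (- w) 0 w p2 w0 (ltW p20) _ _ (mulr_gt0 e2 p20).
  by move=> x' y' xx _; apply: g_cr; lra.
exists N => n /NP; rewrite /boundary_sum addNr.
have hz x : g x (0 + p2) = g x 0.
  by rewrite /g add0r cis2pi cis0.
under [X in dyadic_mean n X]funext => t do rewrite hz subrr.
rewrite dyadic_mean_cst mulr0 add0r !nmM nm_i mul1r nmr gtr0_norm// mulrC ler_pM2r//.
rewrite dyadic_meanB => h1.
set m0 := dyadic_mean n (fun t => g 0 _) in h1.
set m1 := dyadic_mean n (fun t => g (- w) _) in h1.
have -> : dyadic_mean n (fun t => f (r%:C * cis (t * (pi *+ 2)))) = m0.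
  by congr dyadic_mean; apply/funext => t; rewrite /g expR0 mulr1 add0r.
have h2 : nm (m1 - f 0) <= e / 2.
  rewrite -(dyadic_mean_cst n (f 0)) -dyadic_meanB; apply: dyadic_mean_le => t _.
  by apply: fs; rewrite // subr0 -rmorphM nm_real_cis// mulr_ge0 ?expR_ge0 ?ltW.
rewrite -[m0 - _](subrKA m1) (le_trans (nmD _ _))// [e]splitr lerD//.
Qed.

Lemma cis_expansion : exists2 r, 0 < r &
  forall v : R, `|v| <= r -> nm (cis v - 1 : C) <= 2 * `|v|.
Proof.
have [r r0 P] := @polar_expansion R 1 ltr01; exists r => // v vr.
have := P 0 v; rewrite normr0 (ltW r0) expR0 mul1r => /(_ isT vr).
rewrite mul1r add0r => h.
rewrite -[cis v - 1](subrK (0 +i* v)) (le_trans (nmD _ _))//.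
have := nm_le_ReIm (0 +i* v); rewrite /= normr0 add0r => h'; lra.
Qed.

(** A strict inequality at one point persists on an arc and pushes the mean of Re f strictly below
    Re (f 0), against [mean_circle]. *)
Lemma Re_circle_max f r : 0 < r < 1 -> ccont setT f 0 ->
  (forall z, 0 < nm z < 1 -> exists d, cderiv setT f z d) ->
  (forall z, nm z = r -> Re (f z) <= Re (f 0)) ->
  forall z, nm z = r -> Re (f z) = Re (f 0).
Proof.
move=> /andP[r0 r1] f0 fd fle z0 z0r.
apply/eqP; rewrite eq_le fle//= leNgt; apply/negP => flt.
(* [dyadic_mean_Re_ge] looks at an interval starting at parameter [0], so the circle is rotated to
   start at [z0]. *)
pose u := z0 * (r^-1)%:C.
have nu : nm u = 1.
  by rewrite nmM nmr z0r gtr0_norm ?invr_gt0// divff// gt_eqF.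
have u0 : u != 0 by rewrite -nm_gt0 nu ltr01.
pose fu z := f (u * z).
have fu0 : ccont setT fu 0.
  move=> e /f0[s s0 fs]; exists s => // w _ ws.
  by rewrite /fu mulr0; apply: fs; rewrite // subr0 nmM nu mul1r; rewrite subr0 in ws.
have fud z : 0 < nm z < 1 -> exists d, cderiv setT fu z d.
  move=> z1; have [|d fdd] := fd (u * z); first by rewrite nmM nu mul1r.
  have ud : cderiv setT (fun w => u * w) z (0 * z + u * 1).
    exact: cderivM (cderiv_cst _ _ _) (cderiv_id _ _).
  by eexists; exact: (cderiv_comp ud fdd).
have r01 : 0 < r < 1 by rewrite r0.
pose F t : C := f 0 - fu (r%:C * cis (t * (pi *+ 2))).
have fuE t : nm (u * (r%:C * cis t)) = r by rewrite nmM nu mul1r nm_real_cis ?ltW.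
have F0 t : 0 <= Re (F t) by rewrite Re_add Re_opp subr_ge0 fle.
pose eta := Re (f 0) - Re (f z0).
have eta0 : 0 < eta by rewrite subr_gt0.
have [d fz0] : exists d, cderiv setT f z0 d by apply: fd; rewrite z0r r0.
have eta2 : 0 < eta / 2 by rewrite divr_gt0.
have [s s0 fs] := cderiv_cont fz0 eta2.
have [v v0 vP] := cis_expansion.
have p20 : 0 < pi *+ 2 :> R by rewrite mulrn_wgt0// pi_gt0.
pose c := Num.min v (s / 2) / (pi *+ 2).
have c0 : 0 < c by rewrite divr_gt0// lt_min v0 divr_gt0.
have [m mc] : exists m, 2^-1 ^+ m <= c.
  pose m := (Num.Def.trunc c^-1).+1.
  exists m; rewrite exprVn invf_ple ?posrE ?exprn_gt0//.
  rewrite (@le_trans _ _ m%:R) ?(ltW (truncnS_gt _))//.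
  by rewrite -natrX ler_nat ltnW// ltn_expl.
have Fm t : 0 <= t <= 2^-1 ^+ m -> eta / 2 <= Re (F t).
  move=> /andP[t0 tm]; have tc : t * (pi *+ 2) <= Num.min v (s / 2).
    by rewrite -ler_pdivlMr// (le_trans tm).
  move: tc; rewrite le_min => /andP[tv ts].
  have z0E : u * r%:C = z0.
    by rewrite /u -mulrA -rmorphM /= mulVf ?mulr1// gt_eqF.
  have tn : `|t * (pi *+ 2)| = t * (pi *+ 2) by rewrite ger0_norm// mulr_ge0// ltW.
  have := vP (t * (pi *+ 2)); rewrite tn => /(_ tv) h.
  have : nm (f (z0 * cis (t * (pi *+ 2))) - f z0) <= eta / 2.
    apply: fs => //; rewrite -[X in _ - X]mulr1 -mulrBr nmM z0r.
    rewrite (@le_trans _ _ (1 * nm (cis (t * (pi *+ 2)) - 1)))//.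
      by rewrite ler_wpM2r ?nm_ge0 ?ltW.
    by rewrite mul1r (le_trans h)//; lra.
  rewrite /F /fu mulrA z0E => h'; have := le_trans (nm_Re _) h'.
  by rewrite !Re_add !Re_opp ler_norml /eta => /andP[_]; rewrite /eta; lra.
have q0 : 0 < eta / 2 * 2^-1 ^+ m by rewrite mulr_gt0// exprn_gt0.
have [|N NP] := mean_circle r01 fu0 fud (e := eta / 2 * 2^-1 ^+ m / 2); first by rewrite divr_gt0.
have := NP (N + m)%N (leq_addr _ _).
have := dyadic_mean_Re_ge N (ltW eta2) (fun t _ => F0 t) Fm.
rewrite dyadic_meanB dyadic_mean_cst Re_add Re_opp.
have fu00 : fu 0 = f 0 by rewrite /fu mulr0.
rewrite fu00; set M := dyadic_mean _ _ => h1 h2.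
have := le_trans (nm_Re _) h2; rewrite Re_add Re_opp ler_norml => /andP[h3 h4].
by move: h1 h3 h4 q0; set x := eta / 2 * _; lra.
Qed.

Lemma nmB_sqr z w : nm (z - w) ^+ 2 = nm z ^+ 2 + nm w ^+ 2 - 2 * Re (w^*%C * z).
Proof. by rewrite !nm_sqr; case: z => a b; case: w => c d /=; ring. Qed.

Lemma disc_max (h : C -> R) r : 0 <= r ->
  (forall z, nm z <= r -> forall e, 0 < e -> exists2 s : R, 0 < s &
     forall w, nm (w - z) <= s -> `|h w - h z| <= e) ->
  exists2 z, nm z <= r & forall w, nm w <= r -> h w <= h z.
Proof.
move=> r0 hc.
pose A : set (R * R) := `[(- r), r] `*` `[(- r), r].
pose B : set (R * R) := [set p | p.1 ^+ 2 + p.2 ^+ 2 <= r ^+ 2].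
pose g (p : R * R) := h (p.1 +i* p.2).
have nB (p : R * R) : B p <-> nm (p.1 +i* p.2) <= r.
  by rewrite -(@ler_pXn2r _ 2) ?nnegrE ?nm_ge0// nm_sqr.
have AB : compact (A `&` B).
  apply: compact_closedI; first by apply: compact_setX; exact: segment_compact.
  have cc : continuous (fun p : R * R => p.1 ^+ 2 + p.2 ^+ 2 : R).
    move=> p; apply: cvgD.
      apply: (@continuous_comp _ _ _ fst (fun x : R => x ^+ 2)); first exact: cvg_fst.
      exact: exprn_continuous.
    apply: (@continuous_comp _ _ _ snd (fun x : R => x ^+ 2)); first exact: cvg_snd.
    exact: exprn_continuous.
  by move/continuous_closedP: cc => /(_ _ (@closed_le R (r ^+ 2))).
have AB0 : (A `&` B) !=set0.
  exists (0, 0); split; first by split => /=; rewrite in_itv /= oppr_le0 r0.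
  by rewrite /B /= expr0n addr0 sqr_ge0.
have gc : {within A `&` B, continuous g}.
  apply: continuous_in_subspaceT => p /set_mem[_ /nB pB].
  apply/cvgrPdist_le => e e0; have [s s0 hs] := hc _ pB _ e0.
  have s2 : 0 < s / 2 by rewrite divr_gt0.
  have ps : nbhs (p : R * R) (ball (p : R * R) (s / 2)) by exact: nbhsx_ballx.
  move: ps; apply: filterS => w [/= + +].
  rewrite distrC /ball /= => w1 w2; apply: hs.
  rewrite (le_trans (nm_le_ReIm _))// /= [s]splitr lerD// distrC ltW//.
have [p /set_mem[pA /nB pB] pM] := compact_EVT_max AB0 AB gc.
exists (p.1 +i* p.2) => // -[a b] w1; apply: (pM (a, b)).
have Bab : B (a, b) by apply/nB.
apply/mem_set; split => //; have := nm_Re (a +i* b).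
move: Bab; rewrite /B /= => Bab ha; split => /=; rewrite in_itv /= -ler_norml.
  by rewrite -(@ler_pXn2r _ 2) ?nnegrE// real_normK ?num_real//; have := sqr_ge0 b; lra.
by rewrite -(@ler_pXn2r _ 2) ?nnegrE// real_normK ?num_real//; have := sqr_ge0 a; lra.
Qed.

End MaximumPrinciple.

(** * Schwarz's lemma *)

Section Schwarz.
Variable R : realType.
Local Notation C := R[i].
Implicit Types (f q : C -> C) (z w d : C) (r e t : R).

Lemma Re_scale (c : R) z : Re (c%:C * z) = c * Re z.
Proof. by rewrite Re_mul /= mul0r subr0. Qed.

(** The perturbation e |z|^2 makes |q|^2 strictly subharmonic, so its maximum over the closed disc
    cannot lie inside. This replaces the propagation of an interior maximum along a connected
    set. *)
Lemma maximum_principle q r (M : R) : 0 < r < 1 -> 0 <= M -> ccont setT q 0 ->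
  (forall z, 0 < nm z < 1 -> exists d, cderiv setT q z d) ->
  (forall z, nm z = r -> nm (q z) <= M) ->
  forall z, nm z <= r -> nm (q z) <= M.
Proof.
move=> /andP[r0 r1] M0 q0 qd qM z0 z0r.
have qc z : nm z <= r -> ccont setT q z.
  move=> zr; have [->//|nz] := eqVneq z 0.
  have [|d qz] := qd z; first by rewrite nm_gt0 nz/= (le_lt_trans zr).
  exact: cderiv_cont qz.
rewrite -(@ler_pXn2r _ 2)// ?nnegrE ?nm_ge0//; apply/ler_addgt0Pr => e e0.
pose h z := nm (q z) ^+ 2 + e * nm z ^+ 2.
have lip (V : normedZmodType C) (a b : V) : `|nm a - nm b| <= nm (a - b).
  rewrite ler_norml; have := nmD (a - b) b; rewrite subrK.
  by have := nmB a (a - b); rewrite opprB addrC subrK; lra.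
have hc z : nm z <= r -> forall e, 0 < e -> exists2 s : R, 0 < s &
     forall w, nm (w - z) <= s -> `|h w - h z| <= e.
  move=> zr e' e'0.
  pose K := 2 * nm (q z) + 1 + e * (2 * nm z + 1).
  have K0 : 0 < K.
    have := mulr_ge0 (ltW e0) (nm_ge0 z); have := nm_ge0 (q z); rewrite /K; lra.
  have c0 : 0 < Num.min 1 (e' / K) by rewrite lt_min ltr01 divr_gt0.
  have [s s0 qs] := qc _ zr _ c0.
  exists (Num.min s (Num.min 1 (e' / K))); first by rewrite lt_min s0.
  move=> w; rewrite !le_min => /and3P[ws w1 we].
  have := qs w I ws; rewrite le_min => /andP[q1 qe].
  have sq (a b x : R) : 0 <= a -> 0 <= b -> x <= 1 -> `|a - b| <= x ->
      `|a ^+ 2 - b ^+ 2| <= x * (2 * b + 1).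
    move=> a0 b0 x1 abx; rewrite subr_sqr normrM ler_pM// ger0_norm ?addr_ge0//.
    by move: abx; rewrite ler_norml; lra.
  have x0 : 0 <= e' / K by rewrite divr_ge0 ?ltW.
  have h1 : `|nm (q w) ^+ 2 - nm (q z) ^+ 2| <= e' / K * (2 * nm (q z) + 1).
    rewrite (@le_trans _ _ (nm (q w - q z) * (2 * nm (q z) + 1)))//.
      by apply: sq; rewrite ?nm_ge0 ?lip.
    by rewrite ler_wpM2r// addr_ge0 ?mulr_ge0 ?nm_ge0.
  have h2 : `|nm w ^+ 2 - nm z ^+ 2| <= e' / K * (2 * nm z + 1).
    rewrite (@le_trans _ _ (nm (w - z) * (2 * nm z + 1)))//.
      by apply: sq; rewrite ?nm_ge0 ?lip.
    by rewrite ler_wpM2r// addr_ge0 ?mulr_ge0 ?nm_ge0.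
  rewrite /h (_ : _ - _ = (nm (q w) ^+ 2 - nm (q z) ^+ 2) +
     e * (nm w ^+ 2 - nm z ^+ 2)); last by ring.
  rewrite (le_trans (ler_normD _ _))// normrM (gtr0_norm e0).
  rewrite (le_trans (lerD h1 (ler_wpM2l (ltW e0) h2)))//.
  rewrite [leLHS](_ : _ = e')//.
  by rewrite /K; field; rewrite gt_eqF.
have [Z Zr Zmax] := disc_max (ltW r0) hc.
have ZE : nm Z = r.
  apply/eqP; rewrite eq_le Zr /= leNgt; apply/negP => Zlt.
  (* The open disc of radius s about Z stays in the unit disc and meets [0], where [q] is only
     assumed continuous, at most as its centre; half of it stays within radius r. *)
  have [s [s0 s1 sZ]] : exists s : R, [/\ 0 < s, nm Z + s <= 1 &
       nm Z + s / 2 <= r /\ (Z = 0 \/ s <= nm Z)].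
    have [->|nZ] := eqVneq Z 0.
      exists r; rewrite nm0 add0r; split => //; first exact: ltW.
      by split; [lra|left].
    have Zgt : 0 < nm Z by rewrite nm_gt0.
    exists (Num.min (nm Z) (r - nm Z)); split; first by rewrite lt_min Zgt subr_gt0.
      have : Num.min (nm Z) (r - nm Z) <= r - nm Z by rewrite ge_min lexx orbT.
      by lra.
    split; last by right; rewrite ge_min lexx.
    have : Num.min (nm Z) (r - nm Z) <= r - nm Z by rewrite ge_min lexx orbT.
    by lra.
  (* [F] polarizes h around Z, with F 0 = h Z. By [nmB_sqr], at Y = Z + s w one has h Y = 2 Re (F w)
     - h Z + |q Y - q Z|^2 + e |Y - Z|^2, so Re (F 0) <= Re (F w) with |w| = 1 / 2 gives h Y > h
     Z. *)
  pose F w := (q Z)^*%C * q (Z + s%:C * w) + e%:C * Z^*%C * (Z + s%:C * w).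
  have sw w : nm (s%:C * w) = s * nm w by rewrite nmM nmr gtr0_norm.
  have Ad w : cderiv setT (fun w => Z + s%:C * w) w (0 + (0 * w + s%:C * 1)).
    by apply: cderivD; [exact: cderiv_cst|exact: cderivM (cderiv_cst _ _ _) (cderiv_id _ _)].
  have Fd w d : cderiv setT q (Z + s%:C * w) d -> exists d, cderiv setT F w d.
    move=> qw; eexists; apply: cderivD.
      exact: cderivM (cderiv_cst _ _ _) (cderiv_comp (Ad w) qw).
    exact: cderivM (cderiv_cst _ _ _) (Ad w).
  have Fc : ccont setT F 0.
    have [Z0|nZ] := eqVneq Z 0.
      move=> e' e'0; have K0 : 0 < nm (q Z) + 1 by rewrite ltr_wpDl ?nm_ge0.
      have [x x0 qx] := q0 _ (divr_gt0 e'0 K0).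
      exists (x / s); first by rewrite divr_gt0.
      move=> w _; rewrite subr0 ler_pdivlMr// mulrC -sw => wx.
      have := qx (s%:C * w) I; rewrite subr0 => /(_ wx).
      have -> : F w - F 0 = (q Z)^*%C * (q (s%:C * w) - q 0).
        by rewrite /F Z0 conjc0 !(mulr0, add0r, mul0r, addr0) mulrBr.
      rewrite nmM nmJ => h'; rewrite (le_trans (ler_wpM2l (nm_ge0 _) h'))//.
      by rewrite mulrCA ler_piMr ?(ltW e'0)// ler_pdivrMr// mul1r lerDl.
    have [|d qZ] := qd Z; first by rewrite nm_gt0 nZ (lt_trans Zlt).
    by have [|d' /cderiv_cont] := @Fd 0 d; first by rewrite mulr0 addr0.
  have Fdd w : 0 < nm w < 1 -> exists d, cderiv setT F w d.
    move=> /andP[w0 w1].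
    have sw1 : s * nm w < s by rewrite gtr_pMr.
    have [|d qw] := qd (Z + s%:C * w); last exact: Fd qw.
    apply/andP; split; last by rewrite (le_lt_trans (nmD _ _))// sw; lra.
    rewrite nm_gt0; apply/negP => /eqP Zs.
    have := sw w; have -> : s%:C * w = - Z by apply/eqP; rewrite -addr_eq0 addrC Zs.
    rewrite nmN; case: sZ => _ [->|sZ]; last by lra.
    by rewrite nm0 => /eqP; rewrite eq_sym mulf_eq0 !gt_eqF.
  have [w w2 Fw] : exists2 w, nm w = 2^-1 & Re (F 0) <= Re (F w).
    apply: contrapT => H.
    have lt w : nm w = 2^-1 -> Re (F w) < Re (F 0).
      by move=> w2; rewrite ltNge; apply/negP => ?; apply: H; exists w.
    have half : 0 < (2^-1 : R) < 1 by rewrite invr_gt0 ltr0n invf_lt1 ?ltr1n.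
    have n2 : nm ((2^-1)%:C : C) = 2^-1 by rewrite nmr ger0_norm// invr_ge0.
    have := Re_circle_max half Fc Fdd (fun w wE => ltW (lt w wE)) n2.
    by move=> FE; have := lt _ n2; rewrite FE ltxx.
  set Y := Z + s%:C * w.
  have Yr : nm Y <= r.
    by rewrite (le_trans (nmD _ _))// sw w2; case: sZ; lra.
  have := Zmax _ Yr; rewrite leNgt => /negP; apply.
  have dq := nmB_sqr (q Y) (q Z); have dZ := nmB_sqr Y Z.
  have YZ : nm (Y - Z) = s / 2 by rewrite /Y addrAC subrr add0r sw w2.
  have FY : Re (F w) = Re ((q Z)^*%C * q Y) + e * Re (Z^*%C * Y).
    by rewrite /F -/Y Re_add -mulrA Re_scale.
  have F0 : Re (F 0) = nm (q Z) ^+ 2 + e * nm Z ^+ 2.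
    by rewrite /F mulr0 addr0 Re_add -mulrA Re_scale !Re_conj_mul !nm_sqr -!expr2.
  rewrite FY F0 in Fw; rewrite YZ in dZ; rewrite /h.
  have := sqr_ge0 (nm (q Y - q Z)); have := mulr_gt0 e0 (exprn_gt0 2 (divr_gt0 s0 (ltr0n R 2))).
  rewrite dZ; nra.
have := Zmax _ z0r; rewrite /h ZE => h1.
have := qM _ ZE; rewrite -(@ler_pXn2r _ 2)// ?nnegrE ?nm_ge0// => h2.
have h3 : e * r ^+ 2 <= e by rewrite ler_piMr ?(ltW e0)// exprn_ile1 ?(ltW r0) ?(ltW r1).
have := mulr_ge0 (ltW e0) (sqr_ge0 (nm z0)); lra.
Qed.

Section SelfMap.
Variables (f : C -> C) (d : C).
Hypotheses (fd : forall z, nm z < 1 -> exists d, cderiv setT f z d)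
  (f1 : forall z, nm z < 1 -> nm (f z) <= 1)
  (f0 : f 0 = 0) (f0d : cderiv setT f 0 d).

(** Its continuity at [0] is the differentiability of [f] there; with differentiability elsewhere,
    this is the regularity that the mean value over circles asks for. *)
Let q z := if z == 0 then d else f z / z.

Let qd z : 0 < nm z < 1 -> exists d, cderiv setT q z d.
Proof.
move=> /andP[z0 z1]; have [d' fz] := fd z1; have nz : z != 0 by rewrite -nm_gt0.
eexists; apply: cderiv_ext (cderivM fz (cderiv_inv setT nz)).
exists (nm z / 2) => [|w wz]; first by rewrite divr_gt0.
rewrite /q ifF//; apply/eqP => w0.
by move: wz; rewrite w0 sub0r nmN; lra.
Qed.

Let q0 : ccont setT q 0.
Proof.
move=> e e0; have [r r0 fr] := f0d e0; exists r => // w _ wr.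
rewrite /q eqxx; case: (eqVneq w 0) => [_|w0]; first by rewrite subrr nm0 ltW.
have := fr w I wr; rewrite f0 !subr0 => h.
have -> : f w / w - d = (f w - d * w) / w by field.
by rewrite nmM nmV ler_pdivrMr ?nm_gt0.
Qed.

Let q1 z : nm z < 1 -> nm (q z) <= 1.
Proof.
move=> z1; rewrite leNgt; apply/negP => qgt.
(* The radius is at least |z|, so the maximum principle reaches z, and exceeds 1 / |q z|, against
   the resulting bound |q z| <= 1 / r. *)
pose r := Num.max (1 / 2) (Num.max (nm z) ((1 + (nm (q z))^-1) / 2)).
have qi : (nm (q z))^-1 < 1 by rewrite invf_lt1// (lt_trans _ qgt).
have r01 : 0 < r < 1 by rewrite lt_max !gt_max; apply/andP; split; [|apply/and3P; split]; lra.
have [rgt rlt] := andP r01.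
have : nm (q z) <= r^-1.
  apply: (maximum_principle r01 _ q0 qd); first by rewrite invr_ge0 ltW.
    move=> w wr; rewrite /q ifF; last by apply/eqP => w0; rewrite -wr w0 nm0 ltxx in rgt.
    by rewrite nmM nmV wr ler_piMl ?invr_ge0 ?(ltW rgt)// f1// wr.
  by rewrite !le_max lexx !orbT.
apply/negP; rewrite -ltNge invf_plt ?posrE ?(lt_trans _ qgt)//.
by rewrite (lt_le_trans _ (_ : (1 + (nm (q z))^-1) / 2 <= r))// ?le_max ?lexx ?orbT//; lra.
Qed.

Lemma schwarz z : nm z < 1 -> nm (f z) <= nm z.
Proof.
move=> z1; have [->|z0] := eqVneq z 0; first by rewrite f0 nm0.
have := q1 z1; rewrite /q (negPf z0) nmM nmV ler_pdivrMr ?nm_gt0//.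
by rewrite mul1r.
Qed.

(** The function d^* q equals 1 at the centre and has modulus at most 1, so its real part is 1 on
    each circle; then |q z - d|^2 = |q z|^2 + 1 - 2 Re (d^* q z) <= 0. *)
Lemma schwarz_rigidity : nm d = 1 -> forall z, nm z < 1 -> f z = d * z.
Proof.
move=> d1 z z1; have [->|z0] := eqVneq z 0; first by rewrite f0 mulr0.
have z01 : 0 < nm z < 1 by rewrite nm_gt0 z0.
pose g w := d^*%C * q w.
have dd : d^*%C * d = 1.
  by rewrite mulrC -sqr_normc nmE d1 expr1n.
have gd w : 0 < nm w < 1 -> exists d, cderiv setT g w d.
  by move=> /qd[d' qw]; eexists; exact: cderivM (cderiv_cst _ _ _) qw.
have gc : ccont setT g 0.
  move=> e /q0[r r0 qr]; exists r => // w _ wr.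
  by rewrite /g -mulrBr nmM nmJ d1 mul1r qr.
have g0 : g 0 = 1 by rewrite /g /q eqxx dd.
have gle w : nm w = nm z -> Re (g w) <= Re (g 0).
  move=> wz; rewrite g0 /= (le_trans (ler_norm _))// (le_trans (nm_Re _))//.
  by rewrite /g nmM nmJ d1 mul1r q1 ?wz.
have := Re_circle_max z01 gc gd gle (erefl (nm z)); rewrite g0 /= => gz.
have : nm (q z - d) ^+ 2 <= 0.
  rewrite nmB_sqr d1 -/(g z) gz; have := q1 z1.
  by rewrite -(@ler_pXn2r _ 2)// ?nnegrE ?nm_ge0//; lra.
rewrite -[_ <= 0]andbT -(sqr_ge0 (nm (q z - d))) -eq_le sqrf_eq0 => /eqP/nm_eq0/subr0_eq.
by rewrite /q (negPf z0) => <-; field.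
Qed.
End SelfMap.
End Schwarz.

(** * Operators between Hilbert spaces *)

Section Operators.
Variable R : realType.
Local Notation C := R[i].
Implicit Types H K L : hilbertType R.

Lemma operator_ext H K (A B : operator H K) : (forall u, A u = B u) -> A = B.
Proof. by move=> AB; apply/val_inj/funext. Qed.

Lemma operator_addE H K (A B : operator H K) u : (A + B) u = A u + B u.
Proof. by []. Qed.

Lemma operator_oppE H K (A : operator H K) u : (- A) u = - A u.
Proof. by []. Qed.

Lemma operator_scaleE H K (c : C) (A : operator H K) u : (c *: A) u = c *: A u.
Proof. by []. Qed.

Lemma operator_compE H K L (A : operator K L) (B : operator H K) u :
  operator_comp A B u = A (B u).
Proof. by []. Qed.

Lemma operatorD H K (A : operator H K) u v : A (u + v) = A u + A v.
Proof. exact: linearD. Qed.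

Lemma operatorN H K (A : operator H K) u : A (- u) = - A u.
Proof. exact: linearN. Qed.

Lemma operatorZ H K (A : operator H K) (c : C) u : A (c *: u) = c *: A u.
Proof. exact: linearZ. Qed.

Definition operatorE := (operator_addE, operator_oppE, operator_scaleE, operator_compE,
  operatorD, operatorN, operatorZ).

Lemma hdotDl K (u v w : K) : hdot (u + v) w = hdot u w + hdot v w.
Proof. exact: linearDl. Qed.

Lemma hdotNl K (u w : K) : hdot (- u) w = - hdot u w.
Proof. exact: linearNl. Qed.

Lemma hdotZl K (c : C) (u w : K) : hdot (c *: u) w = c * hdot u w.
Proof. exact: linearZl. Qed.

Definition hdotEl := (hdotDl, hdotNl, hdotZl).

(** Also a calculation device: pairing with an arbitrary vector turns linear identities between
    vectors into identities in [R[i]], which [ring] and [field] decide. *)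
Lemma hdot_inj K (v w : K) : (forall z, hdot v z = hdot w z) -> v = w.
Proof.
move=> vw; apply/subr0_eq/eqP; rewrite -(dnorm_eq0 hdot) linearBl/=.
by rewrite vw subrr.
Qed.

Lemma hdotC K (v w : K) : hdot v w = (hdot w v)^*%C.
Proof. by rewrite hermC expr0 mul1r. Qed.

Lemma nm_operator H K (A : operator H K) u : nm (A u) <= nm A * nm u.
Proof.
rewrite -lecR rmorphM /= -!nmE; exact: operator_norm_ub.
Qed.

Lemma nm_operator_le H K (A : operator H K) (M : R) : 0 <= M ->
  (forall u, nm (A u) <= M * nm u) -> nm A <= M.
Proof.
move=> M0 AM; rewrite -lecR -nmE; apply: operator_norm_le; first by rewrite ler0c.
by move=> u; rewrite !nmE -rmorphM lecR.
Qed.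

Lemma nm_operator_comp H K L (A : operator K L) (B : operator H K) :
  nm (operator_comp A B) <= nm A * nm B.
Proof.
apply: nm_operator_le => [|u]; first by rewrite mulr_ge0 ?nm_ge0.
rewrite operator_compE (le_trans (nm_operator _ _))// -mulrA ler_wpM2l ?nm_ge0//.
exact: nm_operator.
Qed.

Lemma nm_hdot K (v : K) : hdot v v = (nm v ^+ 2)%:C.
Proof. by rewrite hdotE nmE rmorphXn. Qed.

Lemma nm_adjoint H K (A : operator H K) : nm (adjoint A) <= nm A.
Proof.
apply: nm_operator_le => [|u]; first exact: nm_ge0.
have [->|u0] := eqVneq (adjoint A u) 0; first by rewrite nm0 mulr_ge0 ?nm_ge0.
have p : 0 < nm (adjoint A u) by rewrite nm_gt0.
rewrite -(ler_pM2l p) -expr2.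
have -> : nm (adjoint A u) ^+ 2 = Re (hdot (A (adjoint A u)) u).
  by rewrite adjointP nm_hdot.
rewrite (le_trans (ler_norm _))// (le_trans (hdot_Re_le _ _))//.
rewrite -!/(nm _) mulrA ler_wpM2r ?nm_ge0// mulrC.
exact: nm_operator.
Qed.

Lemma adjointP_sym H K (A : operator H K) x y : hdot (adjoint A y) x = hdot y (A x).
Proof. by rewrite hdotC -adjointP -hdotC. Qed.

Lemma adjoint_unique H K (A : operator H K) (B : operator K H) :
  (forall x y, hdot (A x) y = hdot x (B y)) -> adjoint A = B.
Proof.
move=> AB; apply: operator_ext => y; apply: hdot_inj => x.
by rewrite adjointP_sym hdotC AB -hdotC.
Qed.

Lemma adjointK H K (A : operator H K) : adjoint (adjoint A) = A.
Proof. by apply: adjoint_unique => x y; rewrite adjointP_sym. Qed.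

Lemma adjointD H K (A B : operator H K) : adjoint (A + B) = adjoint A + adjoint B.
Proof.
apply: adjoint_unique => x y.
by rewrite !operatorE linearDl linearDr /= !adjointP.
Qed.

Lemma adjointZ H K (c : C) (A : operator H K) : adjoint (c *: A) = c^*%C *: adjoint A.
Proof.
apply: adjoint_unique => x y.
rewrite !operatorE linearZl linearZr /= adjointP; congr (_ * _).
exact: esym (conjcK c).
Qed.

Lemma adjoint_comp H K L (A : operator K L) (B : operator H K) :
  adjoint (operator_comp A B) = operator_comp (adjoint B) (adjoint A).
Proof. by apply: adjoint_unique => x y; rewrite !operatorE !adjointP. Qed.

(** The completeness that Neumann series require. The limit is taken pointwise in [K]; the explicit
    rate then makes it linear, bounded and a limit in operator norm. *)
Lemma geometric_cvg H K (T : nat -> operator H K) (M r : R) : 0 <= M -> 0 <= r < 1 ->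
  (forall n, nm (T n.+1 - T n) <= M * r ^+ n) ->
  exists A, forall n, nm (A - T n) <= M / (1 - r) * r ^+ n.
Proof.
move=> M0 /andP[r0 r1] Tn.
have c0 : 0 < 1 - r by rewrite subr_gt0.
have Tm n m : nm (T (n + m)%N - T n) <= M / (1 - r) * r ^+ n * (1 - r ^+ m).
  elim: m => [|m IH]; first by rewrite addn0 !subrr nm0 mulr0.
  rewrite addnS -[_ - T n](subrKA (T (n + m)%N)) (le_trans (nmD _ _))//.
  rewrite (le_trans (lerD (Tn _) IH))// exprD exprS.
  by rewrite le_eqVlt; apply/orP; left; apply/eqP; field; rewrite gt_eqF.
have B0 : 0 <= M / (1 - r) by rewrite divr_ge0// ltW.
have Tm' n m : (n <= m)%N -> nm (T m - T n) <= M / (1 - r) * r ^+ n.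
  move=> le_nm; rewrite -(subnKC le_nm) (le_trans (Tm _ _))//.
  by apply: ler_piMr; rewrite ?gerBl ?exprn_ge0// mulr_ge0// exprn_ge0.
have Tu u n m : (n <= m)%N -> nm (T m u - T n u) <= M / (1 - r) * r ^+ n * nm u.
  move=> le_nm; have := nm_operator (T m - T n) u; rewrite !operatorE => /le_trans; apply.
  by rewrite ler_wpM2r ?nm_ge0 ?Tm'.
have small (e c : R) : 0 < e -> exists n, c * r ^+ n < e.
  move=> e0.
  have h : (fun n => c * r ^+ n) @ \oo --> c * 0.
    by apply: cvgMr; apply: cvg_expr; rewrite ger0_norm.
  rewrite mulr0 in h; move/cvgrPdist_lt: h => /(_ e e0)[n _ /(_ n (leqnn n))].
  by rewrite /= sub0r normrN => /(le_lt_trans (ler_norm _)) ?; exists n.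
have lim u : exists v, forall e : R, 0 < e -> exists N, forall n, (N <= n)%N -> nm (v - T n u) < e.
  have Fc : cvg ((fun n => T n u) @ \oo).
    apply/cauchy_cvgP/cauchy_exP => e e0.
    have er : e = (Re e)%:C by rewrite RRe_real// gtr0_real.
    have e0' : 0 < Re e by rewrite -ltcR -er.
    have [N Nle] := small (Re e) (M / (1 - r) * nm u) e0'.
    exists (T N u); exists N => // n /= Nn.
    rewrite -ball_normE /= er nmE ltcR -nmN opprB (le_lt_trans (Tu u _ _ Nn))//.
    by rewrite mulrAC.
  exists (lim ((fun n => T n u) @ \oo)) => e e0.
  have e0' : 0 < e%:C by rewrite ltcR.
  move/cvgrPdist_lt: Fc => /(_ _ e0')[N _ NP]; exists N => n /NP /=.
  by rewrite nmE ltcR.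
have [A AP] := choice lim.
have Au u n : nm (A u - T n u) <= M / (1 - r) * r ^+ n * nm u.
  apply/ler_addgt0Pr => e e0; have [N NP] := AP u e e0.
  rewrite -[_ - T n u](subrKA (T (maxn n N) u)) (le_trans (nmD _ _))// addrC lerD//.
    by rewrite Tu// leq_maxl.
  by rewrite ltW// NP// leq_maxr.
have Al : linear A.
  move=> c u v; apply/subr0_eq/nm_eq0/eqP; rewrite eq_le nm_ge0 andbT.
  apply/ler_addgt0Pr => e e0; rewrite add0r.
  pose B := M / (1 - r) * (nm (c *: u + v) + nm c * nm u + nm v).
  have [n nP] := small e B e0; apply: le_trans (ltW nP).
  have -> : A (c *: u + v) - (c *: A u + A v) =
     (A (c *: u + v) - T n (c *: u + v)) - c *: (A u - T n u) - (A v - T n v).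
    rewrite (linearP (T n)); apply: hdot_inj => z.
    rewrite !(linearDl, linearNl, linearZl) /=. by ring.
  rewrite (le_trans (nmB _ _))// (le_trans (lerD (nmB _ _) (lexx _)))//.
  rewrite nmZ (le_trans (lerD (lerD (Au _ n) (ler_wpM2l (nm_ge0 _) (Au _ n))) (Au _ n)))//.
  by rewrite /B le_eqVlt; apply/orP; left; apply/eqP; ring.
have Ab : exists M : R, forall x, `|A x| <= M%:C * `|x|.
  exists (M / (1 - r) + nm (T 0%N)) => u.
  rewrite !nmE -rmorphM lecR mulrDl -[A u](subrK (T 0%N u)) (le_trans (nmD _ _))// lerD//.
    by have := Au u 0%N; rewrite expr0 mulr1.
  exact: nm_operator.
have Aop : A \in @bounded_operator R H K by apply/asboolP.
exists (Operator Aop) => n; apply: nm_operator_le => [|u]; last exact: Au.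
by rewrite mulr_ge0 ?exprn_ge0.
Qed.

End Operators.

(** * Derivatives as explicit estimates *)

Section FrechetDerivative.
Variable R : realType.
Local Notation C := R[i].
Implicit Types U V W : normedModType C.

Definition vderiv V (g : C -> V) (z : C) (v : V) := forall e : R, 0 < e ->
  exists2 r : R, 0 < r & forall w, nm (w - z) <= r ->
    nm (g w - g z - (w - z) *: v) <= e * nm (w - z).

(** The differential is a bare function carrying its linearity and a bound, so that explicit
    candidates and compositions can be used directly. *)
Definition fderiv V W (f : V -> W) (x : V) (L : V -> W) :=
  [/\ forall c h k, L (c *: h + k) = c *: L h + L k,
      exists2 M : R, 0 <= M & forall h, nm (L h) <= M * nm h &
      forall e : R, 0 < e -> exists2 r : R, 0 < r & forall h, nm h <= r ->
        nm (f (x + h) - f x - L h) <= e * nm h].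

End FrechetDerivative.

(** * The Jordan structure of a J*-algebra *)

Section JordanStructure.
Variable R : realType.
Local Notation C := R[i].
Variables H K : hilbertType R.
Implicit Types (a b x y z : operator H K) (s t : operator K H).

Definition op3 a s b := operator_comp a (operator_comp s b).

Lemma op3E a s b u : op3 a s b u = a (s (b u)). Proof. by []. Qed.

Lemma nm_op3 a s b : nm (op3 a s b) <= nm a * nm s * nm b.
Proof.
rewrite (le_trans (nm_operator_comp _ _))// -mulrA ler_wpM2l ?nm_ge0//.
exact: nm_operator_comp.
Qed.

Lemma adjointN a : adjoint (- a) = - adjoint a.
Proof. by rewrite -scaleN1r adjointZ rmorphN rmorph1 scaleN1r. Qed.

Variable J : jstar_algebra H K.

Let cube x := op3 x (adjoint x) x.

Let cube_in x : x \in J -> cube x \in J.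
Proof. exact: jstar_triple. Qed.

(** Polarization of the cube: cube (x + y) + cube (x - y) keeps 2 cube x and twice the terms
    quadratic in y. *)
Let mixed_in x y : x \in J -> y \in J ->
  op3 y (adjoint y) x + op3 y (adjoint x) y + op3 x (adjoint y) y \in J.
Proof.
move=> xJ yJ.
have -> : op3 y (adjoint y) x + op3 y (adjoint x) y + op3 x (adjoint y) y =
    (2^-1 : C) *: (cube (x + y) + cube (x - y)) - cube x.
  rewrite /cube adjointD [adjoint (x - y)]adjointD adjointN.
  apply: operator_ext => u; apply: hdot_inj => v.
  rewrite !(operatorE, op3E).
  by rewrite !hdotEl; field.
apply: rpredB; last exact: cube_in.
by apply: rpredZ; apply: rpredD; apply: cube_in; [exact: rpredD|exact: rpredB].
Qed.

(** Replacing y by i y in the mixed sum fixes y y* x and x y* y but changes the sign of y x* y; half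
    the difference isolates the latter. *)
Lemma op3_adjoint_in x y : x \in J -> y \in J -> op3 y (adjoint x) y \in J.
Proof.
move=> xJ yJ; have iyJ : ('i : C) *: y \in J by rewrite rpredZ.
suff -> : op3 y (adjoint x) y = (2^-1 : C) *:
    ((op3 y (adjoint y) x + op3 y (adjoint x) y + op3 x (adjoint y) y) -
     (op3 ('i *: y) (adjoint ('i *: y)) x + op3 ('i *: y) (adjoint x) ('i *: y) +
      op3 x (adjoint ('i *: y)) ('i *: y))).
  by rewrite rpredZ ?rpredB ?mixed_in.
have ii : ('i : C)^*%C = - 'i by apply/eqP; rewrite eq_complex /= oppr0 !eqxx.
have i2 : ('i : C) * 'i = -1 by rewrite -expr2 sqr_i.
rewrite adjointZ ii; apply: operator_ext => u; apply: hdot_inj => v.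
rewrite !(operatorE, op3E) !hdotEl.
set A := hdot _ v; set B := hdot _ v; set D := hdot _ v.
have i3 (c : C) : ('i : C) * ('i * c) = - c by rewrite mulrA i2 mulN1r.
by rewrite ?(mulNr, mulrN, i3, opprK); field.
Qed.

Lemma op3_sym_in x y z : x \in J -> y \in J -> z \in J ->
  op3 x (adjoint y) z + op3 z (adjoint y) x \in J.
Proof.
move=> xJ yJ zJ.
have -> : op3 x (adjoint y) z + op3 z (adjoint y) x =
  op3 (x + z) (adjoint y) (x + z) - op3 x (adjoint y) x - op3 z (adjoint y) z.
  apply: operator_ext => u; apply: hdot_inj => v.
  rewrite !(operatorE, op3E) !hdotEl; ring.
by rewrite !rpredB ?op3_adjoint_in ?rpredD.
Qed.

(** This is (1 + a s) x (1 + s a), the Bergman operator of Jordan theory up to the sign of a,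
    expanded into terms whose membership in [J] can be read off. *)
Definition bergman s a x := x + (op3 a s x + op3 x s a) + op3 a s (op3 x s a).

Lemma bergmanE s a x u :
  bergman s a x u = x (u + s (a u)) + a (s (x (u + s (a u)))).
Proof.
rewrite /bergman !(operatorE, op3E).
by apply: hdot_inj => v; rewrite !hdotEl; ring.
Qed.

(** The last term is quadratic twice over: a e* x e* a = a y* a with y = e x* e. *)
Lemma bergman_in e a x : e \in J -> a \in J -> x \in J -> bergman (adjoint e) a x \in J.
Proof.
move=> eJ aJ xJ; apply: rpredD.
  by apply: rpredD => //; exact: op3_sym_in.
suff -> : op3 a (adjoint e) (op3 x (adjoint e) a) =
    op3 a (adjoint (op3 e (adjoint x) e)) a.
  by apply: op3_adjoint_in => //; apply: op3_adjoint_in.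
by rewrite /op3 !adjoint_comp adjointK; apply: operator_ext.
Qed.

Lemma bergman_linear s a (c : C) x y :
  bergman s a (c *: x + y) = c *: bergman s a x + bergman s a y.
Proof.
apply: operator_ext => u; rewrite !(operatorE, bergmanE).
apply: hdot_inj => v; rewrite !hdotEl; ring.
Qed.

Lemma nm_bergman s a x : nm s <= 1 -> nm (bergman s a x) <= (1 + nm a) ^+ 2 * nm x.
Proof.
move=> s1; have a0 := nm_ge0 a; have x0 := nm_ge0 x.
apply: nm_operator_le => [|u]; first by rewrite mulr_ge0 ?sqr_ge0.
have su v : nm (s v) <= nm v.
  by rewrite (le_trans (nm_operator _ _))// ler_piMl ?nm_ge0.
rewrite bergmanE; set w := u + _.
have wu : nm w <= (1 + nm a) * nm u.
  rewrite (le_trans (nmD _ _))// mulrDl mul1r lerD// (le_trans (su _))//.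
  exact: nm_operator.
have h1 : nm (x w) <= nm x * ((1 + nm a) * nm u).
  by rewrite (le_trans (nm_operator _ _))// ler_wpM2l.
have h2 : nm (a (s (x w))) <= nm a * (nm x * ((1 + nm a) * nm u)).
  rewrite (le_trans (nm_operator _ _))// ler_wpM2l// (le_trans (su _))//.
rewrite (le_trans (nmD _ _))// (le_trans (lerD h1 h2))//.
by rewrite le_eqVlt; apply/orP; left; apply/eqP; ring.
Qed.

(** The Neumann series of x (1 - e* x)^-1, with terms x (e* x)^n. The inverse itself acts on [H],
    outside [J]; only after multiplication by x do the terms become Jordan powers, and closedness of
    [J] keeps the sum inside. *)
Lemma quasi_inverse_exists e x : e \in J -> x \in J -> nm (adjoint e) * nm x < 1 ->
  exists q, [/\ q \in J, q = x + op3 x (adjoint e) q & q = x + op3 q (adjoint e) x].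
Proof.
move=> eJ xJ; set s := adjoint e; set r := _ * _ => r1.
have r0 : 0 <= r by rewrite mulr_ge0 ?nm_ge0.
pose fix t n := if n is m.+1 then op3 x s (t m) else x.
have tC n : op3 x s (t n) = op3 (t n) s x.
  by elim: n => [|n IH] //=; rewrite {1}IH; apply: operator_ext.
have tJ n : t n \in J.
  elim: n => [|n IH] //=.
  (* Since x s t_n = t_n s x, the product is half of a symmetric triple product, to which
     [op3_sym_in] applies. *)
  have -> : op3 x s (t n) = (2^-1 : C) *: (op3 x s (t n) + op3 (t n) s x).
    rewrite -tC; apply: operator_ext => u; apply: hdot_inj => v.
    by rewrite !operatorE !hdotEl; field.
  by rewrite rpredZ ?op3_sym_in.
have tn n : nm (t n) <= nm x * r ^+ n.
  elim: n => [|n IH] /=; first by rewrite expr0 mulr1.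
  by rewrite (le_trans (nm_op3 _ _ _))// [nm x * nm s]mulrC -/r exprS mulrCA ler_wpM2l.
pose fix T n := if n is m.+1 then T m + t m.+1 else x.
have TJ n : T n \in J by elim: n => [|n IH] //=; rewrite rpredD ?(tJ n.+1).
have TS n : T n.+1 = T n + t n.+1 by [].
have tS n : t n.+1 = op3 x s (t n) by [].
have T1 n : T n.+1 = x + op3 x s (T n).
  elim: n => [//|n IH]; rewrite TS {1}IH tS -addrA; congr (_ + _); rewrite TS.
  by apply: operator_ext => u; rewrite !(op3E, operatorE).
have T2 n : T n.+1 = x + op3 (T n) s x.
  elim: n => [//|n IH]; rewrite TS {1}IH tS tC -addrA; congr (_ + _); rewrite TS.
  by apply: operator_ext => u; rewrite !(op3E, operatorE).
have [||q qT] := @geometric_cvg R H K T (nm x * r) r (mulr_ge0 (nm_ge0 _) r0).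
- by rewrite r0.
- move=> n; have -> : T n.+1 - T n = t n.+1 by rewrite /= addrC addKr.
  by rewrite (le_trans (tn _))// exprS mulrA.
have small e' : 0 < e' -> exists N, forall n, (N <= n)%N -> nm (q - T n) < e'.
  move=> e0.
  have h : (fun n => nm x * r / (1 - r) * r ^+ n) @ \oo --> nm x * r / (1 - r) * 0.
    by apply: cvgMr; apply: cvg_expr; rewrite ger0_norm.
  rewrite mulr0 in h; move/cvgrPdist_lt: h => /(_ e' e0)[N _ NP].
  exists N => n /NP; rewrite /= sub0r normrN => h.
  by rewrite (le_lt_trans (qT n))// (le_lt_trans (ler_norm _)).
(* The recursion of the partial sums passes to the limit because F is Lipschitz. *)
have qE (F : operator H K -> operator H K) : (forall n, T n.+1 = x + F (T n)) ->
    (forall a b, nm (F a - F b) <= r * nm (a - b)) -> q = x + F q.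
  move=> TF FL; apply/subr0_eq/nm_eq0/eqP; rewrite eq_le nm_ge0 andbT.
  apply/ler_addgt0Pr => e' e0; rewrite add0r.
  have e2 : 0 < e' / 2 by rewrite divr_gt0.
  have [N NP] := small _ e2.
  have -> : q - (x + F q) = (q - T N.+1) - (F q - F (T N)).
    by rewrite TF; apply: operator_ext => u; apply: hdot_inj => v; rewrite !operatorE !hdotEl; ring.
  rewrite (le_trans (nmB _ _))// [e']splitr lerD// ?ltW ?NP// (le_lt_trans (FL _ _))//.
  by rewrite (le_lt_trans _ (NP N (leqnn N)))// ler_piMl ?nm_ge0 ?ltW.
exists q; split.
- have Jc := @jstar_closed _ _ _ J.
  apply: Jc => B /nbhs_ballP[e' /= e0 eB].
  have er : e' = (Re e')%:C by rewrite RRe_real// gtr0_real.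
  have e0' : 0 < Re e' by rewrite -ltcR -er.
  have [N NP] := small _ e0'; exists (T N); split; first exact: TJ.
  by apply: eB; rewrite -ball_normE /= er nmE ltcR NP.
- apply: (qE (op3 x s)) => // a b; rewrite (_ : _ - _ = op3 x s (a - b)).
    by rewrite (le_trans (nm_op3 _ _ _))// [nm x * _]mulrC.
  by apply: operator_ext => u; rewrite !(operatorE, op3E).
- apply: (qE (fun a => op3 a s x)) => // a b; rewrite (_ : _ - _ = op3 (a - b) s x).
    by rewrite (le_trans (nm_op3 _ _ _))// -mulrA mulrC.
  by apply: operator_ext.
Qed.

End JordanStructure.

(** * Symmetries of the unit ball *)

Section Symmetry.
Variable R : realType.
Local Notation C := R[i].
Variables H K : hilbertType R.
Variable J : jstar_algebra H K.
Implicit Types (a x y q h : operator H K).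

(** That is, q = x (1 - s x)^-1 = (1 - x s)^-1 x, expressed without inverse operators. *)
Definition quasi_inverse (s : operator K H) x q := q = x + op3 x s q /\ q = x + op3 q s x.

Lemma quasi_inversel s x q u : quasi_inverse s x q -> q u = x u + x (s (q u)).
Proof. by move=> [qE _]; rewrite {1}qE. Qed.

Lemma quasi_inverser s x q u : quasi_inverse s x q -> q u = x u + q (s (x u)).
Proof. by move=> [_ qE]; rewrite {1}qE. Qed.

Section Midpoint.
Variables b g : operator H K.
Hypothesis bg : quasi_inverse (adjoint (- b)) b g.
Let bs := adjoint b.
Let gs := adjoint g.

Let bl u : b u = g u + b (bs (g u)).
Proof.
by rewrite {1}(quasi_inversel u bg) adjointN !operatorE subrK.
Qed.

Let br u : b u = g u + g (bs (b u)).
Proof.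
by rewrite {1}(quasi_inverser u bg) adjointN !operatorE subrK.
Qed.

Let bsl u : bs u = gs u + gs (b (bs u)).
Proof.
have E : b = g + op3 b bs g by apply: operator_ext.
have := congr1 (fun A : operator H K => adjoint A u) E.
by rewrite /= adjointD /op3 !adjoint_comp /bs adjointK.
Qed.

Let bsr u : bs u = gs u + bs (b (gs u)).
Proof.
have E : b = g + op3 g bs b by apply: operator_ext.
have := congr1 (fun A : operator H K => adjoint A u) E.
by rewrite /= adjointD /op3 !adjoint_comp /bs adjointK.
Qed.

(** Here g = b (1 + b* b)^-1 is half of the centre e of the symmetry, and the identity expresses
    that b (1 + b* b)^-1 b* is self-adjoint. *)
Lemma midpoint_commr u : g (bs u) = b (gs u).
Proof. by rewrite bsr operatorD -br. Qed.

Lemma midpoint_comml u : gs (b u) = bs (g u).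
Proof. by rewrite [in RHS]bsl -operatorD -bl. Qed.

Lemma midpoint_cubic u : g u = b u - b (gs (b u)).
Proof. by rewrite -midpoint_commr {1}br addrK. Qed.

End Midpoint.

Section Transvection.
Variables b e : operator H K.
Let bs := adjoint b.
Let es := adjoint e.
Hypotheses (eb : forall u, e (bs u) = b (es u)) (be : forall u, es (b u) = bs (e u))
  (ebe : forall u, e u = b u + b u - b (es (b u))) (b1 : nm b < 1).

Let c u := u - es (b u).
Let c' v := v - b (es v).

Let dotD (L : hilbertType R) (u v w : L) : hdot u (v + w) = hdot u v + hdot u w.
Proof. exact: linearDr. Qed.

Let dotN (L : hilbertType R) (u v : L) : hdot u (- v) = - hdot u v.
Proof. exact: linearNr. Qed.

Let rsym v w : hdot (es (b v)) w = hdot v (es (b w)).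
Proof. by rewrite adjointP_sym adjointP -/bs -be. Qed.

Let psym v w : hdot (b (es v)) w = hdot v (b (es w)).
Proof. by rewrite adjointP adjointP_sym -/bs eb. Qed.

(** With c self-adjoint this is e* e = 1 - c^2, from e* e = 2 e* b - (e* b)^2: the rational square
    root. The next two facts are e e* = 1 - c'^2 and c' e = e c. *)
Let norm_e u : hdot (e u) (e u) = hdot u u - hdot (c u) (c u).
Proof.
rewrite adjointP -/es ebe /c !(operatorD, operatorN) !(hdotEl, dotD, dotN) !rsym.
ring.
Qed.

Let norm_es v : hdot (es v) (es v) = hdot v v - hdot (c' v) (c' v).
Proof.
rewrite adjointP_sym ebe /c' !(hdotEl, dotD, dotN) !psym.
ring.
Qed.

Let cross u (y : K) : hdot (e u) (c' y) = hdot (c u) (es y).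
Proof.
rewrite -adjointP /c' /c !(dotD, dotN) !(operatorD, operatorN) !hdotEl -psym.
by rewrite be eb.
Qed.

(** The indefinite form behind a linear fractional map. With y = x v and S the image of x it reads
    |u|^2 - |S u|^2 = |v|^2 - |x v|^2, so contractivity passes from x to S. *)
Lemma transvection_dot u v (y : K) : c u = v - es y ->
  hdot (e u - c' y) (e u - c' y) = hdot u u - hdot v v + hdot y y.
Proof.
move=> cu; have h1 := norm_e u; have h2 := cross u y.
have h3 : hdot (c' y) (c' y) = hdot y y - hdot (es y) (es y) by rewrite norm_es; ring.
have h4 : hdot (c' y) (e u) = hdot (es y) (c u) by rewrite hdotC h2 -hdotC.
move: h1 h2 h3 h4; move: (c' y) (e u) => p w h1 h2 h3 h4.
rewrite !(hdotEl, dotD, dotN) h1 h2 h3 h4 cu !(hdotEl, dotD, dotN); ring.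
Qed.

Lemma nm_midpoint : nm e <= 1.
Proof.
apply: nm_operator_le => // u; rewrite mul1r -(@ler_pXn2r _ 2)// ?nnegrE ?nm_ge0//.
rewrite -lecR -!nm_hdot norm_e !nm_hdot -rmorphB lecR /=.
by rewrite gerBl sqr_ge0.
Qed.

Let nm_es v : nm (es v) <= nm v.
Proof.
rewrite (le_trans (nm_operator _ _))// ler_piMl ?nm_ge0//.
exact: le_trans (nm_adjoint _) nm_midpoint.
Qed.

Let symm q := e - bergman es (- b) q.

Let symmE q u : symm q u = e u - c' (q (c u)).
Proof.
rewrite /symm operator_addE operator_oppE bergmanE.
by have -> : u + es ((- b) u) = c u by rewrite !operatorE.
Qed.

Lemma symmetry_contraction x q : quasi_inverse es x q -> nm x < 1 -> nm (symm q) < 1.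
Proof.
move=> xq x1.
(* A gap uniform in u is needed for a strict bound on the norm. The first factor bounds |v|^2 - |x
   v|^2 from below by a multiple of |v|^2; the second comes from (1 - |b|) |u| <= |c u| <= 2 |v|. *)
pose k := (1 - nm x ^+ 2) * ((1 - nm b) / 2) ^+ 2.
have x0 := nm_ge0 x; have b0 := nm_ge0 b.
have xx : nm x ^+ 2 < 1 by rewrite expr_lt1.
have k0 : 0 < k by rewrite mulr_gt0 ?subr_gt0// exprn_gt0// divr_gt0// subr_gt0.
have k1 : k < 1.
  rewrite /k (@le_lt_trans _ _ (((1 - nm b) / 2) ^+ 2))//.
    by apply: ler_piMl; rewrite ?gerBl sqr_ge0.
  by rewrite expr_lt1 ?divr_ge0 ?subr_ge0 ?(ltW b1)//; lra.
have kn : 0 <= 1 - k by rewrite subr_ge0 ltW.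
rewrite (@le_lt_trans _ _ (Num.sqrt (1 - k)))//; last first.
  by rewrite -{2}sqrtr1 ltr_sqrt// gtrBl.
apply: nm_operator_le => [|u]; first exact: sqrtr_ge0.
rewrite -(@ler_pXn2r _ 2)// ?nnegrE ?nm_ge0 ?mulr_ge0 ?sqrtr_ge0 ?nm_ge0//.
rewrite exprMn sqr_sqrtr// symmE.
pose v := c u + es (q (c u)).
have xv : x v = q (c u) by rewrite operatorD -(quasi_inversel _ xq).
have cv : c u = v - es (x v) by rewrite xv addrK.
have := transvection_dot cv; rewrite -xv !nm_hdot -rmorphB -rmorphD => /complexI ->.
have xvn : nm (x v) ^+ 2 <= nm x ^+ 2 * nm v ^+ 2.
  by rewrite -exprMn ler_pXn2r ?nnegrE ?mulr_ge0 ?nm_ge0// nm_operator.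
have un : (1 - nm b) * nm u <= 2 * nm v.
  have h1 : nm u <= nm (c u) + nm b * nm u.
    rewrite -{1}[u](subrK (es (b u))) (le_trans (nmD _ _))// lerD//.
    by rewrite (le_trans (nm_es _))// nm_operator.
  have h2 : nm (c u) <= nm v + nm v.
    rewrite cv (le_trans (nmB _ _))// lerD// (le_trans (nm_es _))//.
    by rewrite (le_trans (nm_operator _ _))// ler_piMl ?nm_ge0// ltW.
  lra.
have un2 : ((1 - nm b) / 2) ^+ 2 * nm u ^+ 2 <= nm v ^+ 2.
  have un' : (1 - nm b) / 2 * nm u <= nm v by lra.
  rewrite -exprMn ler_pXn2r ?nnegrE ?nm_ge0//.
  by rewrite mulr_ge0 ?nm_ge0// divr_ge0// subr_ge0 ltW.
have h : k * nm u ^+ 2 <= (1 - nm x ^+ 2) * nm v ^+ 2.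
  by rewrite /k -mulrA ler_wpM2l ?subr_ge0 ?(ltW xx).
rewrite mulrBl mul1r; move: h xvn; rewrite mulrBl mul1r.
by set A := k * _; set B := nm x ^+ 2 * _; lra.
Qed.

Lemma symmetry_fixpoint q : quasi_inverse es b q -> symm q = b.
Proof.
move=> bq; apply: operator_ext => u; rewrite symmE.
have -> : q (c u) = b u.
  by rewrite /c operatorD operatorN (quasi_inverser u bq) addrK.
rewrite /c' ebe opprB; apply: hdot_inj => v; rewrite !hdotEl; ring.
Qed.

(** At x = b the factor 1 + e* q is the inverse of c = 1 - e* b, and 1 + q e* that of c', so the two
    Bergman operators undo each other; the minus sign of the symmetry remains. *)
Lemma symmetry_derivative_fixpoint q h : quasi_inverse es b q ->
  bergman es (- b) (bergman es q h) = h.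
Proof.
move=> bq; apply: operator_ext => u; rewrite bergmanE.
have -> : u + es ((- b) u) = c u by rewrite !operatorE.
rewrite bergmanE.
have -> : q (c u) = b u.
  by rewrite /c operatorD operatorN (quasi_inverser u bq) addrK.
rewrite /c subrK; set w := es (h u).
rewrite !operatorE -/w {1}(quasi_inversel w bq).
by apply: hdot_inj => v; rewrite !hdotEl; ring.
Qed.

(** A resolvent identity: the difference is exactly (1 + q e* ) h (1 + e* q'). Replacing q' by q in
    the last factor leaves the differential; the remainder contains both h and q' - q and is of
    second order. *)
Lemma quasi_inverse_diff x h q q' : quasi_inverse es x q -> quasi_inverse es (x + h) q' ->
  q' - q = bergman es q h + (op3 h es (q' - q) + op3 q es (op3 h es (q' - q))).
Proof.
move=> xq xq'; apply: operator_ext => u.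
have E1 w : q w = x w + q (es (x w)) by exact: quasi_inverser.
have E2 w : q' w = x w + h w + (x (es (q' w)) + h (es (q' w))).
  exact: quasi_inversel xq'.
have [a aE] : exists a : H, a = u + es (q' u) by exists (u + es (q' u)).
have Ea : q' u = x a + h a by rewrite E2 aE !operatorE; apply: hdot_inj => v; rewrite !hdotEl; ring.
have E3 : q (es (h a)) = x a - q u.
  have -> : h a = q' u - x a by rewrite Ea addrC addKr.
  have := E1 a; rewrite {1}aE operatorD => E.
  have -> : q (es (q' u - x a)) = q (es (q' u)) - q (es (x a)) by rewrite !operatorE.
  have -> : q (es (q' u)) = x a + q (es (x a)) - q u by rewrite -E addrC addKr.
  by apply: hdot_inj => v; rewrite !hdotEl; ring.
transitivity (h a + q (es (h a))).
  by rewrite E3 !operatorE Ea; apply: hdot_inj => v; rewrite !hdotEl; ring.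
have -> : a = u + es (q u) + es (q' u - q u).
  by rewrite aE operatorD operatorN -addrA subrKC.
rewrite !(operatorE, op3E, bergmanE).
by apply: hdot_inj => v; rewrite !hdotEl; ring.
Qed.

Lemma symmetry_derivative x q : quasi_inverse es x q -> nm x < 1 ->
  exists2 M : R, 0 <= M & forall h q', quasi_inverse es (x + h) q' ->
    nm h <= (1 - nm x) / 2 ->
    nm (symm q' - symm q + bergman es (- b) (bergman es q h)) <= M * nm h ^+ 2.
Proof.
move=> xq x1; have x0 := nm_ge0 x.
have es1 : nm es <= 1 by exact: le_trans (nm_adjoint _) nm_midpoint.
(* From |q'| <= |x + h| (1 + |q'|) and |x + h| <= (1 + |x|) / 2 follows |q'| <= [Q], uniformly in h.
   Then [N] bounds 1 + q e*, N (1 + Q) |h| bounds q' - q, and 4 bounds (1 + |b|)^2. *)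
pose Q := 2 / (1 - nm x).
have Q0 : 0 <= Q by rewrite divr_ge0// subr_ge0 ltW.
pose N := 1 + nm q.
have N0 : 0 <= N by rewrite addr_ge0 ?nm_ge0.
exists (4 * (N * (N * (1 + Q)))); first by rewrite !mulr_ge0// addr_ge0.
move=> h q' xq' hx; have h0 := nm_ge0 h.
have q'Q : nm q' <= Q.
  have xh : nm (x + h) <= (1 + nm x) / 2 by rewrite (le_trans (nmD _ _))//; lra.
  have : nm q' <= (1 + nm x) / 2 + (1 + nm x) / 2 * nm q'.
    have [q'1 _] := xq'; rewrite {1}q'1 (le_trans (nmD _ _))// lerD//.
    rewrite (le_trans (nm_op3 _ _ _))// ler_wpM2r ?nm_ge0//.
    by rewrite (le_trans _ xh)// ler_piMr ?nm_ge0.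
  rewrite /Q ler_pdivlMr ?subr_gt0//; lra.
have opq (a : operator H K) : nm (a + op3 q es a) <= N * nm a.
  rewrite (le_trans (nmD _ _))// mulrDl mul1r lerD// (le_trans (nm_op3 _ _ _))//.
  by rewrite ler_wpM2r ?nm_ge0// ler_piMr ?nm_ge0.
have hes (a : operator H K) : nm (op3 h es a) <= nm h * nm a.
  by rewrite (le_trans (nm_op3 _ _ _))// ler_wpM2r ?nm_ge0// ler_piMr ?nm_ge0.
have dq : nm (q' - q) <= N * (1 + Q) * nm h.
  have -> : q' - q = (h + op3 h es q') + op3 q es (h + op3 h es q').
    rewrite (quasi_inverse_diff xq xq') /bergman; apply: operator_ext => u.
    rewrite !(operatorE, op3E); apply: hdot_inj => v; rewrite !hdotEl; ring.
  rewrite (le_trans (opq _))// -mulrA ler_wpM2l// (le_trans (nmD _ _))// mulrDl mul1r lerD//.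
  by rewrite (le_trans (hes _))// mulrC ler_wpM2r.
have -> : symm q' - symm q + bergman es (- b) (bergman es q h) =
   - bergman es (- b) (q' - q - bergman es q h).
  rewrite /symm; have L := @bergman_linear R H K es (- b).
  have LB y z : bergman es (- b) (y - z) = bergman es (- b) y - bergman es (- b) z.
    by have := L (-1) z y; rewrite !scaleN1r addrC => ->; rewrite addrC.
  rewrite !LB; apply: operator_ext => u; apply: hdot_inj => v; rewrite !operatorE !hdotEl; ring.
rewrite nmN (le_trans (nm_bergman _ _ es1))// nmN.
have b4 : (1 + nm b) ^+ 2 <= 4.
  have -> : 4 = 2 ^+ 2 :> R by ring.
  by rewrite ler_pXn2r ?nnegrE ?addr_ge0 ?nm_ge0//; rewrite -[2]/(1 + 1) lerD2l ltW.
have -> : q' - q - bergman es q h = op3 h es (q' - q) + op3 q es (op3 h es (q' - q)).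
  by rewrite {1}(quasi_inverse_diff xq xq') addrC addKr.
rewrite -(mulrA 4); apply: ler_pM; rewrite ?nm_ge0 ?sqr_ge0//.
rewrite (le_trans (opq _))// -(mulrA N) ler_wpM2l// (le_trans (hes _))//.
rewrite [leRHS](_ : _ = nm h * (N * (1 + Q) * nm h)); last by ring.
by rewrite ler_wpM2l.
Qed.

End Transvection.

Theorem ball_symmetry (b : jstar_elt J) : nm b < 1 ->
  exists S : jstar_elt J -> jstar_elt J,
  [/\ forall x : jstar_elt J, nm x < 1 -> nm (S x) < 1, S b = b,
      forall x : jstar_elt J, nm x < 1 -> exists L, fderiv S x L &
      exists2 L, fderiv S b L & forall h : jstar_elt J, L h = - h].
Proof.
case: b => b bJ; rewrite -[nm _]/(nm b) => b1.
have bb : nm (adjoint (- b)) * nm b < 1.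
  rewrite (le_lt_trans _ b1)// ler_piMl ?nm_ge0//.
  by rewrite (le_trans (nm_adjoint _))// nmN ltW.
have NbJ : - b \in J by rewrite rpredN.
have [g [gJ g1 g2]] := quasi_inverse_exists NbJ bJ bb.
have bg : quasi_inverse (adjoint (- b)) b g by [].
pose e := g + g.
have eJ : e \in J by rewrite rpredD.
have eb u : e (adjoint b u) = b (adjoint e u).
  by rewrite adjointD !operatorE (midpoint_commr bg).
have be u : adjoint e (b u) = adjoint b (e u).
  by rewrite adjointD !operatorE (midpoint_comml bg).
have ebe u : e u = b u + b u - b (adjoint e (b u)).
  rewrite adjointD !operatorE (midpoint_cubic bg).
  by apply: hdot_inj => v; rewrite !hdotEl; ring.
have e1 := nm_midpoint be ebe.
(* [q], and then [S], are arbitrary off the open ball; increments are kept small enough that no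
   derivative inside it meets those values. *)
have qE (x : jstar_elt J) : exists q : operator H K,
    nm x < 1 -> q \in J /\ quasi_inverse (adjoint e) x q.
  case: x => x xJ; rewrite -[nm _]/(nm x) /=.
  have [x1|] := boolP (nm x < 1); last by exists 0.
  have [|q [qJ q1 q2]] := quasi_inverse_exists eJ xJ; last by exists q.
  rewrite (le_lt_trans _ x1)// ler_piMl ?nm_ge0//.
  exact: le_trans (nm_adjoint _) e1.
have [q qP] := choice qE.
have SE (x : jstar_elt J) : exists y : jstar_elt J, nm x < 1 ->
    jstar_val y = e - bergman (adjoint e) (- b) (q x).
  have [x1|] := boolP (nm x < 1); last by exists 0.
  have [qJ _] := qP _ x1.
  have SJ : e - bergman (adjoint e) (- b) (q x) \in J by rewrite rpredB ?bergman_in.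
  by exists (JStarElt SJ).
have [S SP] := choice SE.
pose B : jstar_elt J := JStarElt bJ.
have LE (x : jstar_elt J) : nm x < 1 -> exists2 L, fderiv S x L &
   forall h : jstar_elt J, jstar_val (L h) = - bergman (adjoint e) (- b) (bergman (adjoint e) (q x) (jstar_val h)).
  move=> x1; have [qJ xq] := qP _ x1.
  have LJ (h : jstar_elt J) : exists y : jstar_elt J,
      jstar_val y = - bergman (adjoint e) (- b) (bergman (adjoint e) (q x) (jstar_val h)).
    have hJ := valP h.
    have yJ : - bergman (adjoint e) (- b) (bergman (adjoint e) (q x) (jstar_val h)) \in J.
      by rewrite rpredN !bergman_in.
    by exists (JStarElt yJ).
  have [L LP] := choice LJ; exists L => //; split.
  - move=> c h k; apply/val_inj.
    transitivity (c *: jstar_val (L h) + jstar_val (L k)); last by [].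
    transitivity (jstar_val (L (c *: h + k))); first by [].
    rewrite !LP; have -> : jstar_val (c *: h + k) = c *: jstar_val h + jstar_val k by [].
    by rewrite !bergman_linear scalerN opprD.
  - exists ((1 + nm b) ^+ 2 * (1 + nm (q x)) ^+ 2); first by rewrite mulr_ge0 ?sqr_ge0.
    move=> h; rewrite -[nm (L h)]/(nm (jstar_val (L h))) LP nmN.
    have es1 : nm (adjoint e) <= 1 by exact: le_trans (nm_adjoint _) e1.
    rewrite (le_trans (nm_bergman _ _ es1))// nmN -mulrA ler_wpM2l ?sqr_ge0//.
    exact: nm_bergman.
  - move=> d d0; have [M M0 MP] := symmetry_derivative be ebe b1 xq x1.
    have M1 : 0 < M + 1 by rewrite ltr_wpDl.
    exists (Num.min ((1 - nm x) / 2) (d / (M + 1))).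
      by rewrite lt_min !divr_gt0// subr_gt0.
    move=> h; rewrite le_min => /andP[h1 h2].
    have xh1 : nm (x + h) < 1 by rewrite (le_lt_trans (nmD _ _))//; lra.
    have [q'J xq'] := qP _ xh1.
    rewrite -[nm (_ - L h)]/(nm (jstar_val (S (x + h)) - jstar_val (S x) - jstar_val (L h))).
    rewrite !SP// LP opprK (le_trans (MP _ _ xq' h1))//.
    rewrite expr2 mulrA ler_wpM2r ?nm_ge0//.
    rewrite (@le_trans _ _ ((M + 1) * nm h))//; first by rewrite ler_wpM2r ?nm_ge0// lerDl.
    by rewrite mulrC -ler_pdivlMr.
have B1 : nm B < 1 by [].
exists S; split.
- move=> x x1; have [_ xq] := qP _ x1.
  rewrite -[nm (S x)]/(nm (jstar_val (S x))) SP//.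
  exact: (symmetry_contraction eb be ebe b1 xq).
- have [_ Bq] := qP _ B1; apply/val_inj; rewrite /= SP//.
  exact: (symmetry_fixpoint ebe Bq).
- by move=> x /LE[L ? _]; exists L.
- have [L LB LP] := LE _ B1; exists L => // h; apply/val_inj; rewrite /= LP.
  have [_ Bq] := qP _ B1.
  by rewrite (symmetry_derivative_fixpoint _ Bq).
Qed.

End Symmetry.

(** * The pentablock *)

Section PentablockGeometry.
Variable R : realType.
Local Notation C := R[i].
Local Notation V := ('rV[C]_3).
Implicit Types (z : 'M[C]_2) (v : 'cV[C]_2) (a s p l w x y : C).

Let sq v : R := nm (v 0 0) ^+ 2 + nm (v 1 0) ^+ 2.

Let sq_ge0 v : 0 <= sq v.
Proof. by rewrite addr_ge0 ?sqr_ge0. Qed.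

Let euclidean_normE v : euclidean_norm v = (Num.sqrt (sq v))%:C.
Proof.
rewrite /euclidean_norm big_ord_recl big_ord1.
have -> : lift ord0 ord0 = 1 :> 'I_2 by apply/val_inj.
rewrite !nmE -!rmorphXn -rmorphD /= -/(sq v).
rewrite -{1}(sqr_sqrtr (sq_ge0 v)) rmorphXn sqrCK//.
by rewrite ler0c sqrtr_ge0.
Qed.

Let unit_sq v : (euclidean_norm v <= 1) = (sq v <= 1).
Proof. by rewrite euclidean_normE lecR -{1}sqrtr1 ler_sqrt. Qed.

Let mulmx2E z v i : (z *m v) i 0 = z i 0 * v 0 0 + z i 1 * v 1 0.
Proof.
rewrite mxE big_ord_recl big_ord1.
by have -> : lift ord0 ord0 = 1 :> 'I_2 by apply/val_inj.
Qed.

Lemma det_mx2 z : \det z = z 0 0 * z 1 1 - z 0 1 * z 1 0.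
Proof.
rewrite (expand_det_row _ 0) big_ord_recl big_ord1 /cofactor !det_mx11 !mxE /=.
have -> : lift ord0 ord0 = 1 :> 'I_2 by apply/val_inj.
have -> : lift 1 0 = 0 :> 'I_2 by apply/val_inj.
by rewrite -[ord0]/(0 : 'I_2) /bump /= expr0 expr1; ring.
Qed.

Lemma trace_mx2 z : \tr z = z 0 0 + z 1 1.
Proof.
rewrite /mxtrace big_ord_recl big_ord1.
by have -> : lift ord0 ord0 = 1 :> 'I_2 by apply/val_inj.
Qed.

Definition penta a s p : V := \row_(j < 3) [:: a; s; p]`_j.

Lemma pentablock_diag l l' : nm l < 1 -> nm l' < 1 -> pentablock R (penta 0 (l + l') (l * l')).
Proof.
move=> l1 l'1; pose d : 'rV[C]_2 := \row_(j < 2) (if j == 0 then l else l').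
exists (diag_mx d); last first.
  rewrite /pentablock_map trace_mx2 det_mx2 !mxE /= /penta.
  by congr (\row_j _`_j); rewrite !mulr1n !mulr0n mul0r subr0.
pose M := Num.max (nm l) (nm l').
have M1 : M < 1 by rewrite gt_max l1.
have M0 : 0 <= M by rewrite le_max nm_ge0.
rewrite /matrix_unit_ball /= /matrix_opnorm /opnorm ltcR (le_lt_trans _ M1)//.
apply: ge_sup.
  exists (Re (euclidean_norm (diag_mx d *m 0))), 0 => //=.
  by rewrite unit_sq /sq !mxE nm0 expr0n addr0 ler01.
move=> _ [v /= v1 <-]; rewrite euclidean_normE /=.
rewrite unit_sq in v1.
have : sq (diag_mx d *m v) <= M ^+ 2.
  rewrite /sq !mulmx2E !mxE /= !mulr1n !mulr0n !mul0r addr0 add0r !nmM !exprMn.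
  have h1 : nm l ^+ 2 <= M ^+ 2 by rewrite ler_pXn2r ?nnegrE ?nm_ge0// le_max lexx.
  have h2 : nm l' ^+ 2 <= M ^+ 2 by rewrite ler_pXn2r ?nnegrE ?nm_ge0// le_max lexx orbT.
  rewrite (@le_trans _ _ (M ^+ 2 * sq v))//; last by rewrite ler_piMr ?sqr_ge0.
  by rewrite /sq mulrDr lerD// ler_wpM2r// sqr_ge0.
by move=> h; rewrite -(ger0_norm M0) -sqrtr_sqr ler_sqrt// sqr_ge0.
Qed.

Let eigen_lt1 z l : matrix_unit_ball z -> \det (z - l%:M) = 0 -> nm l < 1.
Proof.
move=> z1 /eqP dz.
(* [det0P] yields a left null vector, hence the transposes. *)
have [u u0 uz] : exists2 u : 'rV[C]_2, u != 0 & u *m (z - l%:M)^T = 0.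
  by apply/det0P; rewrite det_tr.
pose v := u^T; have v0 : v != 0 by rewrite -(trmx0 C 1 2) (inj_eq trmx_inj).
have zv : z *m v = l *: v.
  apply/eqP; rewrite -subr_eq0 -mul_scalar_mx -mulmxBl.
  by rewrite -[_ *m _]trmxK trmx_mul /v trmxK uz trmx0.
have sv0 : 0 < sq v.
  rewrite lt_def sq_ge0 andbT; apply: contra v0.
  rewrite paddr_eq0 ?sqr_ge0// !sqrf_eq0 => /andP[/eqP/nm_eq0 v00 /eqP/nm_eq0 v10].
  apply/eqP/matrixP => i j; rewrite [j]ord1 [RHS]mxE.
  case: i => -[|[|//]] Hi; first by have -> : Ordinal Hi = 0 by apply/val_inj.
  by have -> : Ordinal Hi = 1 by apply/val_inj.
pose c : R := (Num.sqrt (sq v))^-1.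
have c0 : 0 < c by rewrite invr_gt0 sqrtr_gt0.
pose v' := c%:C *: v.
have sqZ (k : C) (t : 'cV[C]_2) : sq (k *: t) = nm k ^+ 2 * sq t.
  by rewrite /sq !mxE !nmM !exprMn mulrDr.
have sv' : sq v' = 1.
  rewrite /v' sqZ nmr (gtr0_norm c0) /c exprVn sqr_sqrtr ?sq_ge0//.
  by rewrite mulVf// gt_eqF.
have zv' : z *m v' = l *: v'.
  by rewrite /v' -scalemxAr zv !scalerA mulrC.
have : nm l <= sup [set Re (euclidean_norm (z *m x)) | x in [set x | euclidean_norm x <= 1]].
  apply: ub_le_sup; last first.
    exists v'; first by rewrite /= unit_sq sv'.
    by rewrite zv' euclidean_normE /= sqZ sv' mulr1 sqrtr_sqr ger0_norm ?nm_ge0.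
  (* The row sums bound the set of values, without which its [sup] would not be an upper bound. *)
  pose B i := nm (z i 0) + nm (z i 1).
  exists (Num.sqrt (B 0 ^+ 2 + B 1 ^+ 2)) => _ [x /= x1 <-].
  rewrite unit_sq in x1; rewrite euclidean_normE /= ler_sqrt ?addr_ge0 ?sqr_ge0//.
  have x01 : nm (x 0 0) <= 1.
    rewrite -(@ler_pXn2r _ 2)// ?nnegrE ?nm_ge0// expr1n.
    by move: x1; rewrite /sq; have := sqr_ge0 (nm (x 1 0)); lra.
  have x11 : nm (x 1 0) <= 1.
    rewrite -(@ler_pXn2r _ 2)// ?nnegrE ?nm_ge0// expr1n.
    by move: x1; rewrite /sq; have := sqr_ge0 (nm (x 0 0)); lra.
  have Bi i : nm ((z *m x) i 0) ^+ 2 <= B i ^+ 2.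
    rewrite ler_pXn2r ?nnegrE ?addr_ge0 ?nm_ge0// mulmx2E (le_trans (nmD _ _))//.
    by rewrite !nmM lerD// ler_piMr ?nm_ge0.
  by rewrite /sq lerD.
move/le_lt_trans; apply.
by move: z1; rewrite /matrix_unit_ball /= /matrix_opnorm /opnorm ltcR.
Qed.

(* Splitting the numerator as [x (1 - y) + y (1 - x)], the denominator as
   [(1 - x) + (1 - y)]. *)
Let magic_lt x y : nm x < 1 -> nm y < 1 -> nm (2 * x * y - x - y) < nm (2 - x - y).
Proof.
move=> x1 y1.
have nx2 : nm x ^+ 2 < 1 by rewrite expr_lt1 ?nm_ge0.
have ny2 : nm y ^+ 2 < 1 by rewrite expr_lt1 ?nm_ge0.
have e : nm (2 - x - y) ^+ 2 - nm (2 * x * y - x - y) ^+ 2 =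
   2 * ((1 - nm x ^+ 2) * nm (1 - y) ^+ 2 + (1 - nm y ^+ 2) * nm (1 - x) ^+ 2).
  rewrite !nm_sqr; case: x {x1 nx2} => a b; case: y {y1 ny2} => c d /=; ring.
have : 0 < nm (2 - x - y) ^+ 2 - nm (2 * x * y - x - y) ^+ 2.
  rewrite e mulr_gt0//; apply: ltr_wpDr.
    by rewrite mulr_ge0 ?sqr_ge0 ?subr_ge0 ?(ltW ny2).
  rewrite mulr_gt0 ?subr_gt0// exprn_gt0// nm_gt0 subr_eq0.
  by apply/eqP => y1'; rewrite -y1' nm1 ltxx in y1.
by rewrite subr_gt0 ltr_pXn2r ?nnegrE ?nm_ge0.
Qed.

(** Trace and determinant are the symmetric functions of two eigenvalues in the disc, so the claim
    concerns the symmetrized bidisc. Without the quotient, the strict inequality also shows that the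
    denominator does not vanish. *)
Lemma pentablock_magic (q : V) w : pentablock R q -> nm w = 1 ->
  nm (2 * w * q 0 2 - q 0 1) < nm (2 - w * q 0 1).
Proof.
move=> [z z1 <-] w1; rewrite /pentablock_map !mxE /=.
set s := \tr z; set p := \det z.
pose d := sqrtC (s ^+ 2 - 4 * p); have d2 : d ^+ 2 = s ^+ 2 - 4 * p by rewrite sqrtCK.
have [l [l' [sE pE]]] : exists l l', s = l + l' /\ p = l * l'.
  by exists ((s + d) / 2), ((s - d) / 2); split; [field|field: d2].
have root (t : C) : t ^+ 2 - s * t + p = 0 -> nm t < 1.
  move=> t0; apply: (eigen_lt1 z1); rewrite det_mx2 !mxE /= !mulr1n !mulr0n !subr0.
  by rewrite -t0 /s /p trace_mx2 det_mx2; ring.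
have l1 : nm l < 1 by apply: root; rewrite sE pE; ring.
have l'1 : nm l' < 1 by apply: root; rewrite sE pE; ring.
have := @magic_lt (w * l) (w * l'); rewrite !nmM w1 !mul1r => /(_ l1 l'1).
rewrite (_ : 2 * (w * l) * (w * l') - w * l - w * l' = w * (2 * w * p - s)); last first.
  by rewrite sE pE; ring.
by rewrite nmM w1 mul1r (_ : 2 - w * l - w * l' = 2 - w * s)//; rewrite sE; ring.
Qed.

End PentablockGeometry.

(** * Derivatives along curves *)

Section CurveCalculus.
Variable R : realType.
Local Notation C := R[i].
Implicit Types U V W : normedModType C.

Lemma fderivZ V W (f : V -> W) x L c v : fderiv f x L -> L (c *: v) = c *: L v.
Proof.
move=> [Ll [M _ ML] _].
have L0 : L 0 = 0 by apply/nm_eq0/eqP; rewrite eq_le nm_ge0 (le_trans (ML 0))// nm0 mulr0.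
by rewrite -[c *: v]addr0 Ll L0 addr0.
Qed.

Lemma vderiv_comp V W (g : C -> V) (f : V -> W) z v L :
  vderiv g z v -> fderiv f (g z) L -> vderiv (f \o g) z (L v).
Proof.
move=> gd [Ll [M M0 ML] fd] e e0.
pose K := M + nm v + 2; have v0 := nm_ge0 v.
have K0 : 0 < K by rewrite /K; lra.
have eK : 0 < e / K by rewrite divr_gt0.
have [r1 r10 g1] := gd _ ltr01; have [r2 r20 g2] := gd _ eK; have [r3 r30 f3] := fd _ eK.
have r4 : 0 < r3 / (nm v + 1) by rewrite divr_gt0// ltr_wpDl.
exists (Num.min (Num.min r1 r2) (r3 / (nm v + 1))); first by rewrite !lt_min r10 r20.
move=> w; rewrite !le_min => /andP[/andP[w1 w2] w3] /=.
pose h := g w - g z.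
have hl : nm h <= (nm v + 1) * nm (w - z).
  rewrite -[h](subrK ((w - z) *: v)) (le_trans (nmD _ _))// addrC mulrDl lerD//.
    by rewrite nmZ mulrC.
  exact: g1.
have h3 : nm h <= r3.
  by rewrite (le_trans hl)// mulrC -ler_pdivlMr// ltr_wpDl.
have -> : f (g w) - f (g z) - (w - z) *: L v =
    (f (g z + h) - f (g z) - L h) + L (- (w - z) *: v + h).
  by rewrite Ll subrKC scaleNr [- _ + L h]addrC subrKA.
have h1 : nm (f (g z + h) - f (g z) - L h) <= e / K * ((nm v + 1) * nm (w - z)).
  by rewrite (le_trans (f3 _ h3))// ler_wpM2l// ltW.
have h2 : nm (L (- (w - z) *: v + h)) <= M * (e / K * nm (w - z)).
  rewrite (le_trans (ML _))// ler_wpM2l// (le_trans _ (g2 _ w2))//.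
  by rewrite scaleNr addrC.
rewrite (le_trans (nmD _ _))// (le_trans (lerD h1 h2))//.
rewrite [leLHS](_ : _ = (K - 1) * (e / K * nm (w - z))); last by rewrite /K; ring.
rewrite [leRHS](_ : _ = K * (e / K * nm (w - z))); last by field; rewrite gt_eqF.
by apply: ler_wpM2r; rewrite ?gerBl// mulr_ge0 ?nm_ge0 ?(ltW eK).
Qed.

Lemma fderiv_comp U V W (f : U -> V) (g : V -> W) x L L' :
  fderiv f x L -> fderiv g (f x) L' -> fderiv (g \o f) x (L' \o L).
Proof.
move=> [Ll [M M0 ML] fd] [Ll' [M' M'0 ML'] gd]; split.
- by move=> c h k /=; rewrite Ll Ll'.
- exists (M' * M); first exact: mulr_ge0.
  by move=> h /=; rewrite (le_trans (ML' _))// -mulrA ler_wpM2l.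
move=> e e0; pose K := M + M' + 2.
have K0 : 0 < K by rewrite /K; lra.
have eK : 0 < e / K by rewrite divr_gt0.
have [r1 r10 f1] := fd _ ltr01; have [r2 r20 f2] := fd _ eK; have [r3 r30 g3] := gd _ eK.
have M1 : 0 < M + 1 by rewrite ltr_wpDl.
exists (Num.min (Num.min r1 r2) (r3 / (M + 1))); first by rewrite !lt_min r10 r20 divr_gt0.
move=> h; rewrite !le_min => /andP[/andP[w1 w2] w3] /=.
have [k kE] : exists k, k = f (x + h) - f x by exists (f (x + h) - f x).
have kl : nm k <= (M + 1) * nm h.
  rewrite -[k](subrK (L h)) (le_trans (nmD _ _))// addrC mulrDl lerD// kE.
  exact: f1.
have k3 : nm k <= r3 by rewrite (le_trans kl)// mulrC -ler_pdivlMr.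
have L'B a b : L' (a - b) = L' a - L' b.
  by have := Ll' (-1) b a; rewrite !scaleN1r ![- _ + _]addrC.
have -> : g (f (x + h)) - g (f x) - L' (L h) =
    (g (f x + k) - g (f x) - L' k) + L' (k - L h).
  by rewrite L'B subrKA kE subrKC.
have h1 : nm (g (f x + k) - g (f x) - L' k) <= e / K * ((M + 1) * nm h).
  by rewrite (le_trans (g3 _ k3))// ler_wpM2l// ltW.
have h2 : nm (L' (k - L h)) <= M' * (e / K * nm h).
  by rewrite (le_trans (ML' _))// ler_wpM2l// kE f2.
rewrite (le_trans (nmD _ _))// (le_trans (lerD h1 h2))//.
rewrite [leLHS](_ : _ = (K - 1) * (e / K * nm h)); last by rewrite /K; ring.
rewrite [leRHS](_ : _ = K * (e / K * nm h)); last by field; rewrite gt_eqF.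
by apply: ler_wpM2r; rewrite ?gerBl// mulr_ge0 ?nm_ge0 ?(ltW eK).
Qed.

Lemma vderiv_unique V (f g : C -> V) z v v' : (exists2 r : R, 0 < r &
    forall w, nm (w - z) <= r -> f w = g w) ->
  vderiv f z v -> vderiv g z v' -> v = v'.
Proof.
move=> [r r0 fg] fd gd; apply/subr0_eq/nm_eq0/eqP; rewrite eq_le nm_ge0 andbT.
apply/ler_addgt0Pr => e e0; rewrite add0r.
have e2 : 0 < e / 2 by rewrite divr_gt0.
have [r1 r10 f1] := fd _ e2; have [r2 r20 g2] := gd _ e2.
pose t := Num.min r (Num.min r1 r2); have t0 : 0 < t by rewrite !lt_min r0 r10.
have tn : nm (z + t%:C - z) = t by rewrite addrAC subrr add0r nmr gtr0_norm.
pose w := z + t%:C.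
have wr : nm (w - z) <= r by rewrite tn ge_min lexx.
have w1 : nm (w - z) <= r1 by rewrite tn !ge_min lexx orbT.
have w2 : nm (w - z) <= r2 by rewrite tn !ge_min lexx !orbT.
rewrite -(ler_pM2r t0) [leRHS](_ : _ = e / 2 * t + e / 2 * t); last by field.
rewrite -{1}tn -/w mulrC -nmZ.
have -> : (w - z) *: (v - v') = (g w - g z - (w - z) *: v') - (f w - f z - (w - z) *: v).
  by rewrite !fg ?subrr ?nm0 ?(ltW r0)// scalerBr opprB [RHS]addrC subrKA.
rewrite (le_trans (nmB _ _))//; apply: lerD; rewrite -tn; [exact: g2|exact: f1].
Qed.

Lemma differentiable_fderiv V W (f : V -> W) x : differentiable f x -> exists L, fderiv f x L.
Proof.
move=> fx; exists ('d f x); split.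
- by move=> c h k; rewrite linearP.
- have dc : continuous ('d f x) by exact: diff_continuous.
  have [r r0 dr] : exists2 r : R, 0 < r & forall h, nm h < r -> nm ('d f x h) <= 1.
    have d0 : 'd f x 0 = 0 by exact: linear0.
    have := dc 0; rewrite /continuous_at d0 => /cvgrPdist_le/(_ 1 ltr01)/nbhs_ballP[r /= r0 rP].
    have er : r = (Re r)%:C by rewrite RRe_real// gtr0_real.
    exists (Re r); first by rewrite -ltcR -er.
    move=> h hr; have := rP h; rewrite -ball_normE /= sub0r normrN er !nmE ltcR => /(_ hr).
    by rewrite sub0r nmN lecR.
  exists (2 / r); first by rewrite divr_ge0// ltW.
  move=> h; have [->|h0] := eqVneq h 0; first by rewrite linear0 !nm0 mulr0.
  have nh : 0 < nm h by rewrite nm_gt0.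
  have k0 : 0 < r / (2 * nm h) by rewrite divr_gt0// mulr_gt0.
  have := dr ((r / (2 * nm h))%:C *: h); rewrite linearZ /= !nmZ nmr gtr0_norm//.
  have -> : r / (2 * nm h) * nm h = r / 2 by field; rewrite gt_eqF.
  have rr : r / 2 < r by lra.
  move=> /(_ rr); rewrite mulrC -ler_pdivlMr// => /le_trans; apply.
  by rewrite div1r invf_div le_eqVlt; apply/orP; left; apply/eqP; field; rewrite gt_eqF.
- move=> e e0.
  have := diff_locally fx; move=> /eqaddoP/(_ e%:C); rewrite ltcR => /(_ e0).
  move=> /nbhs_ballP[r /= r0 rP].
  have er : r = (Re r)%:C by rewrite RRe_real// gtr0_real.
  have er0 : 0 < Re r by rewrite -ltcR -er.
  exists (Re r / 2); first by rewrite divr_gt0.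
  move=> h hr; have := rP h; rewrite -ball_normE /= sub0r normrN er nmE ltcR.
  have h1 : nm h < Re r by rewrite (le_lt_trans hr)//; lra.
  move=> /(_ h1); rewrite !nmE -rmorphM lecR /=.
  have -> : (f \o +%R^~ x - (cst (f x) + 'd f x)) h = f (x + h) - f x - 'd f x h => //.
  by rewrite -addrA -opprD [x + h]addrC.
Qed.

Lemma nm_coord n (x : 'rV[C]_n.+1) j : nm (x 0 j) <= nm x.
Proof.
rewrite -lecR -!nmE -[leRHS]/(mx_norm x) mx_normE -[leLHS]nngE num_le.
exact: (le_bigmax _ (fun i => `|x i.1 i.2|%:nng) (0, j)).
Qed.

Lemma vderiv_coord n (g : C -> 'rV[C]_n.+1) z v j : vderiv g z v ->
  cderiv setT (fun t => g t 0 j) z (v 0 j).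
Proof.
move=> gd e /gd[r r0 gr]; exists r => // w _ /gr; apply: le_trans.
by rewrite (le_trans _ (nm_coord _ j))// !mxE mulrC.
Qed.

Lemma vderiv_penta (f g : C -> C) z d d' : cderiv setT f z d -> cderiv setT g z d' ->
  vderiv (fun t => penta 0 (f t) (g t)) z (penta 0 d d').
Proof.
move=> fd gd e e0.
pose es : 'rV[C]_3 := penta 0 1 0; pose ep : 'rV[C]_3 := penta 0 0 1.
pose K := nm es + nm ep + 1.
have K0 : 0 < K by rewrite ltr_wpDl// addr_ge0 ?nm_ge0.
have eK : 0 < e / K by rewrite divr_gt0.
have [r r0 fr] := fd _ eK; have [s s0 gs] := gd _ eK.
exists (Num.min r s); first by rewrite lt_min r0.
move=> w; rewrite le_min => /andP[wr ws].
have -> : penta 0 (f w) (g w) - penta 0 (f z) (g z) - (w - z) *: penta 0 d d' =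
    (f w - f z - d * (w - z)) *: es + (g w - g z - d' * (w - z)) *: ep.
  apply/rowP => j; rewrite !mxE; case: j => -[|[|[|//]]] /= _; ring.
rewrite (le_trans (nmD _ _))// !nmZ.
rewrite (le_trans (lerD (ler_wpM2r (nm_ge0 _) (fr w I wr)) (ler_wpM2r (nm_ge0 _) (gs w I ws))))//.
rewrite -mulrDr (_ : nm es + nm ep = K - 1); last by rewrite /K; ring.
rewrite [leRHS](_ : _ = e / K * nm (w - z) * K); last by field; rewrite gt_eqF.
by apply: ler_wpM2l; rewrite ?gerBl// mulr_ge0 ?nm_ge0 ?(ltW eK).
Qed.

Lemma cderivS (D D' : set C) (f : C -> C) z d : D `<=` D' -> cderiv D' f z d -> cderiv D f z d.
Proof. by move=> DD' fd e /fd[r r0 fr]; exists r => // w /DD'; exact: fr. Qed.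

(** Conjugates of holomorphic functions are differentiable along the real axis, where the product
    rule for [cderiv] then handles squared moduli. *)
Definition real_axis : set C := [set z | Im z = 0].

Lemma cderiv_conj (f : C -> C) z d : real_axis z -> cderiv real_axis f z d ->
  cderiv real_axis (fun w => (f w)^*%C) z d^*%C.
Proof.
move=> z0 fd e /fd[r r0 fr]; exists r => // w w0 /(fr w w0); apply: le_trans.
rewrite le_eqVlt; apply/orP; left; apply/eqP; rewrite -[RHS]nmJ; congr nm.
have hE : (w - z)^*%C = w - z.
  move: w0 z0; case: w => a b; case: z {fr fd} => a' b'; rewrite /real_axis /= => -> ->.
  by apply/eqP; rewrite eq_complex /= subrr oppr0 !eqxx.
by rewrite [in RHS]rmorphB [in RHS]rmorphB rmorphM /= hE.
Qed.

Lemma Re_cderiv_eq0 (f : C -> C) d r : 0 < r -> cderiv real_axis f 0 d -> f 0 = 0 ->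
  (forall t : R, `|t| <= r -> 0 <= Re (f t%:C)) -> Re d = 0.
Proof.
move=> r0 fd f0 fpos; apply/eqP; apply: contrapT => /negP dn0.
have dn : 0 < `|Re d| by rewrite normr_gt0.
have d2 : 0 < `|Re d| / 2 by rewrite divr_gt0.
have [s s0 fs] := fd _ d2.
pose t := Num.min r s; have t0 : 0 < t by rewrite lt_min r0.
(* A step to the side on which the linear term d x has negative real part. *)
pose x := - Num.sg (Re d) * t.
have sg1 : `|Num.sg (Re d)| = 1 by rewrite normr_sg dn0.
have xn : `|x| = t by rewrite normrM normrN sg1 mul1r gtr0_norm.
have xr : `|x| <= r by rewrite xn ge_min lexx.
have xs : nm (x%:C - 0 : C) <= s by rewrite subr0 nmr xn ge_min lexx orbT.
have := fpos x xr; have := fs x%:C (erefl _) xs.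
rewrite f0 !subr0 nmr xn => h.
have := le_trans (nm_Re _) h; rewrite Re_add Re_opp [d * _]mulrC Re_scale.
have -> : x * Re d = - (`|Re d| * t) by rewrite /x [`|Re d|]normrEsg; ring.
have := mulr_gt0 dn t0; rewrite opprK ler_norml => p /andP[_ h1] h2.
move: h1 h2 p; rewrite (_ : `|Re d| / 2 * t = `|Re d| * t / 2); last by ring.
by set A := _ * t; lra.
Qed.

End CurveCalculus.

(** * The Schwarz-Pick inequality and its first-order form *)

Section Pick.
Variable R : realType.
Local Notation C := R[i].

(** Schwarz's lemma after the Moebius map taking f 0 to [0]. Squares and a cleared denominator make
    both sides polynomial in f, f 0 and their conjugates, ready for differentiation in a
    parameter. *)
Lemma pick (f : C -> C) : (forall z, nm z < 1 -> exists d, cderiv setT f z d) ->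
  (forall z, nm z < 1 -> nm (f z) < 1) -> forall z, nm z < 1 ->
  nm (f z - f 0) ^+ 2 <= nm z ^+ 2 * nm (1 - (f 0)^*%C * f z) ^+ 2.
Proof.
move=> fd f1; have z01 : nm (0 : C) < 1 by rewrite nm0.
pose b := f 0; have b1 : nm b < 1 by exact: f1.
pose den a : C := 1 - b^*%C * a.
have den0 a : nm a < 1 -> den a != 0.
  move=> a1; rewrite subr_eq0; apply/eqP => ba.
  have : nm (b^*%C * a) < 1 by rewrite nmM nmJ mulr_ilt1 ?nm_ge0.
  by rewrite -ba nm1 ltxx.
have dle a : nm a < 1 -> nm (a - b) <= nm (den a).
  move=> a1; rewrite -(@ler_pXn2r _ 2)// ?nnegrE ?nm_ge0// -subr_ge0.
  have -> : nm (den a) ^+ 2 - nm (a - b) ^+ 2 = (1 - nm a ^+ 2) * (1 - nm b ^+ 2).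
    by rewrite !nm_sqr /den; case: (a) => a1' a2; case: (b) => b1' b2 /=; ring.
  by rewrite mulr_ge0// subr_ge0 expr_le1 ?nm_ge0// ltW.
pose g z := (f z - b) / den (f z).
have gd z : nm z < 1 -> exists d, cderiv setT g z d.
  move=> z1; have [d fz] := fd z z1; eexists.
  apply: cderivM; first by apply: cderivB fz (cderiv_cst _ _ _).
  apply: cderivV; first by rewrite den0 ?f1.
  by apply: cderivB (cderiv_cst _ _ _) (cderivM (cderiv_cst _ _ _) fz).
have [d gd0] := gd _ z01.
have g1 z : nm z < 1 -> nm (g z) <= 1.
  move=> z1; rewrite nmM nmV ler_pdivrMr ?nm_gt0 ?den0 ?f1// mul1r.
  by rewrite dle ?f1.
have g0 : g 0 = 0 by rewrite /g subrr mul0r.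
move=> z z1; have := schwarz gd g1 g0 gd0 z1.
rewrite nmM nmV ler_pdivrMr ?nm_gt0 ?den0 ?f1// => h.
by rewrite -exprMn ler_pXn2r ?nnegrE ?mulr_ge0 ?nm_ge0.
Qed.

(* The equality of [pick] at [t = 0] is stationary along the real axis. *)
Lemma pick_first_order (f g : C -> C) (d d' eta : C) (rho r : R) : 0 < r ->
  cderiv setT f 0 d -> cderiv setT g 0 d' -> f 0 = 0 -> g 0 = eta -> nm eta = rho ->
  (forall t : R, `|t| <= r -> nm (g t%:C - f t%:C) ^+ 2 <=
     rho ^+ 2 * nm (1 - (f t%:C)^*%C * g t%:C) ^+ 2) ->
  Re (eta^*%C * (d' - d)) + rho ^+ 2 * Re (d^*%C * eta) = 0.
Proof.
move=> r0 fd gd f0 g0 nrho le.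
have z0 : real_axis (0 : C) by [].
have fd1 := cderivS (@subsetT _ (@real_axis R)) fd.
have gd1 := cderivS (@subsetT _ (@real_axis R)) gd.
have fj := cderiv_conj z0 fd1; have gj := cderiv_conj z0 gd1.
pose k : C := (rho ^+ 2)%:C.
(* Re (h t) is the right side minus the left side of the inequality: nonnegative near [0] on the
   real axis and zero at t = 0, hence stationary there. *)
pose h t := k * ((1 - (f t)^*%C * g t) * (1 - f t * (g t)^*%C)) -
  (g t - f t) * ((g t)^*%C - (f t)^*%C).
have hd : cderiv (@real_axis R) h 0
   (k * (- (d^*%C * eta) - d * eta^*%C) - ((d' - d) * eta^*%C + eta * (d'^*%C - d^*%C))).
  have c1 := @cderiv_cst R (@real_axis R) 1 0.
  have ck := @cderiv_cst R (@real_axis R) k 0.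
  have H := cderivB (cderivM ck (cderivM (cderivB c1 (cderivM fj gd1)) (cderivB c1 (cderivM fd1 gj))))
    (cderivM (cderivB gd1 fd1) (cderivB gj fj)).
  by apply: (cderiv_eq H); rewrite f0 g0 conjc0; ring.
have hE t : Re (h t) = rho ^+ 2 * nm (1 - (f t)^*%C * g t) ^+ 2 - nm (g t - f t) ^+ 2.
  rewrite /h Re_add Re_opp Re_scale !nm_sqr.
  by case: (f t) => a b; case: (g t) => a' b' /=; ring.
have h0 : h 0 = 0.
  rewrite /h f0 g0 conjc0 !mul0r !subr0 !mulr1 -sqr_normc nmE nrho /k rmorphXn /=.
  by rewrite subrr.
have hp t : `|t| <= r -> 0 <= Re (h t%:C) by move=> tr; rewrite hE subr_ge0 le.
have := Re_cderiv_eq0 r0 hd h0 hp.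
rewrite (_ : Re _ = - 2 * (Re (eta^*%C * (d' - d)) + rho ^+ 2 * Re (d^*%C * eta))).
  by move/eqP; rewrite mulf_eq0 oppr_eq0 pnatr_eq0 /= => /eqP.
rewrite Re_add Re_opp Re_scale.
case: (d) => a b; case: (d') => a' b'; case: (eta) => x y /=; ring.
Qed.
End Pick.

(** * Reflections of the pentablock *)

Section Reflection.
Variable R : realType.
Local Notation C := R[i].
Local Notation V := ('rV[C]_3).
Local Notation P := (pentablock R).

Lemma penta_scale (c a s p : C) : c *: penta a s p = penta (c * a) (c * s) (c * p).
Proof. by apply/rowP => j; rewrite !mxE; case: j => -[|[|[|//]]]. Qed.

(* For [t] real and [a] unimodular, [moebius_s a z t] and [moebius_p a z t] are
   the sum and product of the images of [+/- sqrt (- z)] under the Moebius map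
   [x |-> (x + t a) / (1 + (t a)^* x)]. *)
Definition moebius_s (a z t : C) := 2 * (t * a + t * a^*%C * z) / (1 + (t * a^*%C) ^+ 2 * z).
Definition moebius_p (a z t : C) := ((t * a) ^+ 2 + z) / (1 + (t * a^*%C) ^+ 2 * z).

Lemma pentablock_moebius (a z : C) (t : R) : nm a = 1 -> `|t| < 1 -> nm z < 1 ->
  P (penta 0 (moebius_s a z t%:C) (moebius_p a z t%:C)).
Proof.
move=> a1 t1 z1.
pose b := t%:C * a; have b1 : nm b < 1 by rewrite nmM nmr a1 mulr1.
have bE : t%:C * a^*%C = b^*%C by rewrite rmorphM /= /b; congr (_ * _); rewrite /= oppr0.
have [l l2] : exists l : C, l ^+ 2 = - z by exists (sqrtC (- z)); rewrite sqrtCK.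
have l1 : nm l < 1.
  by rewrite -(@ltr_pXn2r _ 2)// ?nnegrE ?nm_ge0// expr1n expr2 -nmM -expr2 l2 nmN.
have zE : z = - l ^+ 2 by rewrite l2 opprK.
have dn (x : C) : nm x < 1 -> 1 + b^*%C * x != 0.
  move=> x1; rewrite addrC addr_eq0; apply/eqP => E.
  have : nm (b^*%C * x) < 1 by rewrite nmM nmJ mulr_ilt1 ?nm_ge0.
  by rewrite E nmN nm1 ltxx.
have lt (x : C) : nm x < 1 -> nm ((x + b) / (1 + b^*%C * x)) < 1.
  move=> x1; rewrite nmM nmV ltr_pdivrMr ?nm_gt0 ?dn// mul1r.
  rewrite -(@ltr_pXn2r _ 2)// ?nnegrE ?nm_ge0// -subr_gt0.
  have -> : nm (1 + b^*%C * x) ^+ 2 - nm (x + b) ^+ 2 = (1 - nm x ^+ 2) * (1 - nm b ^+ 2).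
    by rewrite !nm_sqr; case: (x) => x' y'; case: (b) => u v /=; ring.
  by rewrite mulr_gt0// subr_gt0 expr_lt1 ?nm_ge0.
have d1 := dn l l1; have d2 := dn (- l) (_ : nm (- l) < 1); rewrite nmN in d2.
have {}d2 := d2 l1; rewrite mulrN in d2.
have dd : (1 + b^*%C * l) * (1 - b^*%C * l) != 0 by rewrite mulf_neq0.
have := @pentablock_diag R _ _ (lt l l1) (lt (- l) _); rewrite nmN => /(_ l1).
congr (P (penta 0 _ _)); rewrite /moebius_s /moebius_p bE -/b zE.
  have e : 1 + b^*%C ^+ 2 * - l ^+ 2 = (1 + b^*%C * l) * (1 - b^*%C * l) by ring.
  by rewrite e mulrN; field; rewrite d1 d2.
have e : 1 + b^*%C ^+ 2 * - l ^+ 2 = (1 + b^*%C * l) * (1 - b^*%C * l) by ring.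
by rewrite e mulrN; field; rewrite d1 d2.
Qed.

(** The Agler-Young functions of the symmetrized bidisc, read on the last two coordinates. *)
Definition magic (w : C) (x : V) : C := (2 * w * x 0 2 - x 0 1) / (2 - w * x 0 1).

Lemma magic_den (x : V) w : P x -> nm w = 1 -> 2 - w * x 0 1 != 0.
Proof.
by move=> Px w1; rewrite -nm_gt0 (le_lt_trans _ (pentablock_magic Px w1))// nm_ge0.
Qed.

Lemma magic_lt1 (x : V) w : P x -> nm w = 1 -> nm (magic w x) < 1.
Proof.
move=> Px w1; rewrite nmM nmV ltr_pdivrMr ?nm_gt0 ?magic_den// mul1r.
exact: pentablock_magic.
Qed.

Variable Psi : V -> V.
Hypotheses (PsiP : forall x, P x -> P (Psi x))
  (Psid : forall x, P x -> exists L, fderiv Psi x L).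

Lemma magic_curve (f g : C -> C) (z d d' w : C) L :
  let x := penta 0 (f z) (g z) in let v := L (penta 0 d d') in
  P x -> nm w = 1 -> fderiv Psi x L -> cderiv setT f z d -> cderiv setT g z d' ->
  cderiv setT (fun t => magic w (Psi (penta 0 (f t) (g t)))) z
    ((2 * w * v 0 2 - v 0 1) / (2 - w * Psi x 0 1) +
     (2 * w * Psi x 0 2 - Psi x 0 1) * (w * v 0 1) / (2 - w * Psi x 0 1) ^+ 2).
Proof.
move=> x v Px w1 xL fd gd.
have dn := magic_den (PsiP Px) w1.
have vd := vderiv_comp (vderiv_penta fd gd) xL.
have s1 := vderiv_coord 1 vd; have p2 := vderiv_coord 2 vd.
have c2 := @cderiv_cst R setT 2 z; have cw := @cderiv_cst R setT w z.
have c2w := @cderiv_cst R setT (2 * w) z.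
have Hd := cderivB c2 (cderivM cw s1).
have Hv := cderivV (f := fun t => 2 - w * (Psi \o (fun t => penta 0 (f t) (g t))) t 0 1) dn Hd.
have H := cderivM (cderivB (cderivM c2w p2) s1) Hv.
apply: (cderiv_eq H); rewrite /= -/x -/v.
by field; rewrite dn.
Qed.

Hypothesis Psi0 : Psi 0 = 0.
Variable L0 : V -> V.
Hypotheses (L0d : fderiv Psi 0 L0) (L0s : L0 (penta 0 1 0) = - penta 0 1 0)
  (L0p : L0 (penta 0 0 1) = - penta 0 0 1).

Let penta0 : penta 0 0 0 = 0 :> V.
Proof. by apply/rowP => j; rewrite !mxE; case: j => -[|[|[|//]]]. Qed.

Let moebius0 (a z : C) : (moebius_s a z 0 = 0) * (moebius_p a z 0 = z).
Proof.
by rewrite /moebius_s /moebius_p !(mul0r, mulr0, addr0, add0r, expr0n, divr1).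
Qed.

Let flat (z : C) : nm z < 1 -> P (penta 0 0 z).
Proof.
move=> z1; have := @pentablock_moebius 1 z 0 (nm1 R) _ z1.
by rewrite normr0 rmorph0 !moebius0; apply; exact: ltr01.
Qed.

Let half : C := 2^-1.

Let nm_half : nm half = 2^-1.
Proof. by rewrite /half nmV -[2 in LHS]/(2%:R) -(rmorph_nat (@real_complex_def R (Phant R))) nmr ger0_norm. Qed.

Let half1 : nm half < 1.
Proof. by rewrite nm_half invf_lt1 ?ltr1n. Qed.

(** Along this disc each [magic w] after [Psi] has derivative - w at [0], of modulus 1, so rigidity
    makes it t |-> - w t. *)
Let Psi_flat (z : C) : nm z < 1 -> (Psi (penta 0 0 z) 0 1 = 0) /\ (Psi (penta 0 0 z) 0 2 = - z).
Proof.
move=> z1; have E w : nm w = 1 -> magic w (Psi (penta 0 0 z)) = - w * z.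
  move=> w1; pose f t := magic w (Psi (penta 0 0 t)).
  have fd t : nm t < 1 -> exists d, cderiv setT f t d.
    move=> t1; have [L xL] := Psid (flat t1); eexists.
    exact: (magic_curve (flat t1) w1 xL (cderiv_cst _ _ _) (cderiv_id _ _)).
  have f1 t : nm t < 1 -> nm (f t) <= 1.
    by move=> /flat Pt; apply/ltW; apply: (magic_lt1 _ w1); exact: PsiP.
  have z0 : nm (0 : C) < 1 by rewrite nm0.
  have P0 := flat z0.
  have L0d' : fderiv Psi (penta 0 0 0) L0 by rewrite penta0.
  have f0 : f 0 = 0 by rewrite /f penta0 Psi0 /magic !mxE mulr0 subr0 mul0r.
  have f0d : cderiv setT f 0 (- w).
    apply: (cderiv_eq (magic_curve P0 w1 L0d' (cderiv_cst _ _ _) (cderiv_id _ _))).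
    rewrite L0p [penta 0 0 0]penta0 Psi0 !mxE /=.
    by field; rewrite ?mulr0 ?subr0 ?pnatr_eq0.
  by apply: (schwarz_rigidity fd f1 f0 f0d _ z1); rewrite nmN.
have Pz := PsiP (flat z1).
have E' w : nm w = 1 -> 2 * w * Psi (penta 0 0 z) 0 2 - Psi (penta 0 0 z) 0 1 =
    - w * z * (2 - w * Psi (penta 0 0 z) 0 1).
  by move=> w1; rewrite -E// /magic divfK// magic_den.
(* Two values of w suffice to separate s from p; adding the equations for 1 and -1 gives s (1 + z) =
   0. *)
have := E' 1 (nm1 R); have := E' (-1); rewrite nmN nm1 => /(_ erefl).
set s := Psi _ 0 1; set p := Psi _ 0 2 => e1 e2.
have s0 : s * (1 + z) = 0.
  have : (2 * (-1) * p - s) + (2 * 1 * p - s) =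
    - (-1) * z * (2 - (-1) * s) + - 1 * z * (2 - 1 * s) by rewrite e1 e2.
  move/eqP; rewrite -subr_eq0 (_ : _ - _ = - 2 * (s * (1 + z))); last by ring.
  by rewrite mulf_eq0 oppr_eq0 pnatr_eq0 /= => /eqP.
have s00 : s = 0.
  move/eqP: s0; rewrite mulf_eq0 => /orP[/eqP//|].
  rewrite addrC addr_eq0 => /eqP zE; by rewrite zE nmN nm1 ltxx in z1.
split=> //; move: e2; rewrite s00 mulr0 !subr0 => /eqP.
rewrite -subr_eq0 (_ : _ - _ = 2 * (p + z)); last by ring.
by rewrite mulf_eq0 pnatr_eq0 /= addr_eq0 => /eqP.
Qed.

Let moebius_sd (a z : C) : cderiv setT (moebius_s a z) 0 (2 * (a + a^*%C * z)).
Proof.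
have c (x : C) := @cderiv_cst R setT x 0; have i := @cderiv_id R setT 0.
have Ha := cderivM i (c a); have Hj := cderivM i (c a^*%C).
have Hn := cderivM (c 2) (cderivD Ha (cderivM Hj (c z))).
have Hd := cderivD (c 1) (cderivM (cderivM Hj Hj) (c z)).
have d0 : 1 + 0 * a^*%C * (0 * a^*%C) * z != 0 by rewrite !(mul0r, addr0) oner_eq0.
have Hv := cderivV (f := fun t => 1 + t * a^*%C * (t * a^*%C) * z) d0 Hd.
by apply: (cderiv_eq (cderivM Hn Hv)); rewrite !(mul0r, addr0, mulr0, invr1); ring.
Qed.

Let moebius_pd (a z : C) : cderiv setT (moebius_p a z) 0 0.
Proof.
have c (x : C) := @cderiv_cst R setT x 0; have i := @cderiv_id R setT 0.
have Ha := cderivM i (c a); have Hj := cderivM i (c a^*%C).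
have Hn := cderivD (cderivM Ha Ha) (c z).
have Hd := cderivD (c 1) (cderivM (cderivM Hj Hj) (c z)).
have d0 : 1 + 0 * a^*%C * (0 * a^*%C) * z != 0 by rewrite !(mul0r, addr0) oner_eq0.
have Hv := cderivV (f := fun t => 1 + t * a^*%C * (t * a^*%C) * z) d0 Hd.
by apply: (cderiv_eq (cderivM Hn Hv)); rewrite !(mul0r, addr0, mulr0, invr1); ring.
Qed.

Let moebius_zd (a z : C) (t : R) : nm a = 1 -> `|t| < 1 -> nm z < 1 ->
  (exists d, cderiv setT (fun z => moebius_s a z t%:C) z d) /\
  (exists d, cderiv setT (fun z => moebius_p a z t%:C) z d).
Proof.
move=> a1 t1 z1.
have c (x : C) := @cderiv_cst R setT x z; have i := @cderiv_id R setT z.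
have Hd := cderivD (c 1) (cderivM (c ((t%:C * a^*%C) ^+ 2)) i).
have d0 : 1 + (t%:C * a^*%C) ^+ 2 * z != 0.
  rewrite addrC addr_eq0; apply/eqP => E.
  have : nm ((t%:C * a^*%C) ^+ 2 * z) < 1.
    by rewrite !nmM nmJ a1 mulr1 nmr mulr_ilt1 ?nm_ge0 ?mulr_ge0// mulr_ilt1.
  by rewrite E nmN nm1 ltxx.
have Hv := cderivV (f := fun z => 1 + (t%:C * a^*%C) ^+ 2 * z) d0 Hd.
split; eexists.
  exact: cderivM (cderivM (c 2) (cderivD (c (t%:C * a)) (cderivM (c (t%:C * a^*%C)) i))) Hv.
exact: cderivM (cderivD (c ((t%:C * a) ^+ 2)) i) Hv.
Qed.

Lemma no_reflection : False.
Proof.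
have [L xL] := Psid (flat half1).
have [q1 q2] := Psi_flat half1.
set x := penta 0 0 half in xL q1 q2.
pose u := L (penta 0 1 0) 0 1; pose v := L (penta 0 1 0) 0 2.
(* [pick_first_order] for t |-> E 0 t and t |-> E half t, with eta = - w / 2 and rho = 1 / 2. The
   factor 2 a + a^* is the speed 2 (a + a^* z) of [moebius_s] at z = 1 / 2, and what multiplies it
   is the differential of [magic w] at (0, - 1 / 2) applied to (u, v). *)
have rel (a w : C) : nm a = 1 -> nm w = 1 ->
    Re ((- w / 2)^*%C * ((2 * a + a^*%C) * (w * v - u / 2 - w ^+ 2 * u / 4) - a)) +
    2^-1 ^+ 2 * Re (a^*%C * (- w / 2)) = 0.
  move=> a1 w1.
  pose E z t := magic w (Psi (penta 0 (moebius_s a z t) (moebius_p a z t))).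
  have E0 z : E z 0 = magic w (Psi (penta 0 0 z)) by rewrite /E !moebius0.
  have c2 : (2 : C) != 0 by rewrite pnatr_eq0.
  have P0 : P (penta 0 (moebius_s a 0 0) (moebius_p a 0 0)).
    by rewrite !moebius0; apply: flat; rewrite nm0.
  have Ph : P (penta 0 (moebius_s a half 0) (moebius_p a half 0)).
    by rewrite !moebius0; exact: flat.
  have fd : cderiv setT (E 0) 0 a.
    have L0d' : fderiv Psi (penta 0 (moebius_s a 0 0) (moebius_p a 0 0)) L0.
      by rewrite !moebius0 penta0.
    apply: (cderiv_eq (magic_curve P0 w1 L0d' (moebius_sd _ _) (moebius_pd _ _))).
    have -> : penta 0 (2 * (a + a^*%C * 0)) 0 = (2 * a) *: penta 0 1 0.
      by rewrite penta_scale !mulr0 mulr1 addr0.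
    rewrite (fderivZ _ _ L0d) L0s !moebius0 penta0 Psi0 !mxE /=.
    by field; rewrite ?mulr0 ?subr0 ?c2.
  have gd : cderiv setT (E half) 0 ((2 * a + a^*%C) * (w * v - u / 2 - w ^+ 2 * u / 4)).
    have xL' : fderiv Psi (penta 0 (moebius_s a half 0) (moebius_p a half 0)) L.
      by rewrite !moebius0.
    apply: (cderiv_eq (magic_curve Ph w1 xL' (moebius_sd _ _) (moebius_pd _ _))).
    have -> : penta 0 (2 * (a + a^*%C * half)) 0 = (2 * a + a^*%C) *: penta 0 1 0.
      rewrite penta_scale !mulr0 mulr1; congr (penta 0 _ 0); rewrite /half.
      by field.
    rewrite (fderivZ _ _ xL) !moebius0 -/x q1 q2 mxE [in X in _ + X]mxE -/u.
    have -> : ((2 * a + a^*%C) *: L (penta 0 1 0)) 0 1 = (2 * a + a^*%C) * u by rewrite mxE.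
    rewrite -/v /half; by field; rewrite ?mulr0 ?subr0 ?c2.
  apply: (pick_first_order (r := 2^-1) _ fd gd).
  - by rewrite invr_gt0.
  - by rewrite E0 penta0 Psi0 /magic !mxE mulr0 subr0 mul0r.
  - by rewrite E0 /magic -/x q1 q2 /half; field; rewrite ?mulr0 ?subr0 ?c2.
  - by rewrite nmM nmN w1 mul1r -/half nm_half.
  move=> t t2.
  have t1 : `|t| < 1 by rewrite (le_lt_trans t2)// invf_lt1 ?ltr1n.
  rewrite -nm_half.
  apply: (@pick R (fun z => E z t%:C) _ _ half half1).
    move=> z z1; have Pz := pentablock_moebius a1 t1 z1; have [L' zL] := Psid Pz.
    have [[d sd] [d' pd]] := moebius_zd a1 t1 z1; eexists.
    exact: (@magic_curve (fun z => moebius_s a z t%:C) (fun z => moebius_p a z t%:C) z d d' w L' Pz w1 zL sd pd).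
  by move=> z z1; apply: magic_lt1 w1; apply: PsiP; exact: pentablock_moebius.
(* Subtracting the relations for w = a and w = - a eliminates v. With a = 1 this leaves Re u = - 1 /
   3, with a = i it leaves Re u = - 3. *)
have n1 := nm1 R; have ni := nm_i R.
have nN1 : nm (-1 : C) = 1 by rewrite nmN.
have nNi : nm (- 'i : C) = 1 by rewrite nmN.
have := rel 1 1 n1 n1; have := rel 1 (-1) n1 nN1.
have := rel 'i 'i ni ni; have := rel 'i (- 'i) ni nNi.
(* Division becomes multiplication by a real scalar, so that real parts reduce to linear expressions
   without unfolding inverses in [R[i]]. *)
have two (c : C) : c / 2 = c * (2^-1)%:C.
  by rewrite fmorphV /= rmorphD /= rmorph1.
have four (c : C) : c / 4 = c * (4^-1)%:C.
  by rewrite fmorphV /= -(rmorph_nat (@real_complex_def R (Phant R))).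
rewrite !two !four.
case: (u) => u1 u2; case: (v) => v1 v2 /=.
rewrite !(mul0r, mulr0, mul1r, mulr1, add0r, addr0, subr0, sub0r, oppr0, opprK, mulNr, mulrN).
lra.
Qed.
End Reflection.

(** * From a retraction to a reflection *)

Lemma jstar_unit_ballE (R : realType) (H K : hilbertType R) (J : jstar_algebra H K)
    (a : jstar_elt J) : jstar_unit_ball J a <-> nm a < 1.
Proof. by rewrite /jstar_unit_ball /= nmE ltcR. Qed.

Theorem proposition17 (R : realType) (H K : hilbertType R)
    (J : jstar_algebra H K) (hJ : finite_rank J) :
  ~ @analytic_retract R 'rV[R[i]]_3 (jstar_elt J)
      (pentablock R) (jstar_unit_ball J).
Proof.
move=> [phi [psi [phid psid phiB psiP psiphi]]].
have penta0 : penta 0 0 0 = 0 :> 'rV[R[i]]_3.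
  by apply/rowP => j; rewrite !mxE; case: j => -[|[|[|//]]].
have nm0 : nm (0 : R[i]) < 1 by rewrite nm0.
have P0 : pentablock R 0 by have := pentablock_diag nm0 nm0; rewrite addr0 mulr0 penta0.
have phi1 x : pentablock R x -> nm (phi x) < 1.
  by move=> Px; apply/jstar_unit_ballE/phiB; exists x.
have psi1 y : nm y < 1 -> pentablock R (psi y).
  by move=> /jstar_unit_ballE By; apply: psiP; exists y.
have [S [S1 Sb Sd [LS LSd LSN]]] := ball_symmetry (phi1 0 P0).
have [Lphi dphi] := differentiable_fderiv (phid 0 P0).
have [Lpsi dpsi] : exists L, fderiv psi (phi 0) L.
  by apply/differentiable_fderiv/psid/jstar_unit_ballE/phi1.
(* psi (phi x) = x is given on the pentablock only, so it is differentiated along discs through [0]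
   that lie in it; their directions are those of s and p. *)
have retract (f g : R[i] -> R[i]) d d' : f 0 = 0 -> g 0 = 0 ->
    cderiv setT f 0 d -> cderiv setT g 0 d' ->
    (forall z, nm z <= 2^-1 -> pentablock R (penta 0 (f z) (g z))) ->
    Lpsi (Lphi (penta 0 d d')) = penta 0 d d'.
  move=> f0 g0 fd gd fgP; have fg := vderiv_penta fd gd.
  have dcomp : fderiv (psi \o phi) (penta 0 (f 0) (g 0)) (Lpsi \o Lphi).
    by rewrite f0 g0 penta0; exact: fderiv_comp dphi dpsi.
  have half0 : 0 < (2^-1 : R) by rewrite invr_gt0.
  apply/esym; apply: (vderiv_unique _ fg (vderiv_comp fg dcomp)).
  by exists 2^-1 => // z; rewrite subr0 => /fgP/psiphi.
have half1 : 2^-1 < 1 :> R by rewrite invf_lt1 ?ltr1n.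
have Ls : Lpsi (Lphi (penta 0 1 0)) = penta 0 1 0.
  apply: (retract id (fun=> 0)) => //; [exact: cderiv_id|exact: cderiv_cst|].
  move=> z z2; have := pentablock_diag (le_lt_trans z2 half1) nm0.
  by rewrite addr0 mulr0.
have Lp : Lpsi (Lphi (penta 0 0 1)) = penta 0 0 1.
  apply: (retract (fun=> 0) id) => //; [exact: cderiv_cst|exact: cderiv_id|].
  move=> z z2; have := @pentablock_moebius R 1 z 0 (nm1 R).
  rewrite normr0 ltr01 => /(_ isT (le_lt_trans z2 half1)).
  by rewrite rmorph0 /moebius_s /moebius_p !(mul0r, mulr0, addr0, add0r, expr0n, divr1).
have LpsiN y : Lpsi (- y) = - Lpsi y by rewrite -scaleN1r (fderivZ _ _ dpsi) scaleN1r.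
apply: (@no_reflection R (psi \o (S \o phi)) _ _ _ (Lpsi \o (LS \o Lphi))).
- by move=> x Px; apply/psi1/S1/phi1.
- move=> x Px; have [L1 d1] := differentiable_fderiv (phid x Px).
  have [L2 d2] := Sd _ (phi1 _ Px).
  have [L3 d3] : exists L, fderiv psi (S (phi x)) L.
    by apply/differentiable_fderiv/psid/jstar_unit_ballE/S1/phi1.
  by exists (L3 \o (L2 \o L1)); exact: fderiv_comp (fderiv_comp d1 d2) d3.
- by rewrite /= Sb psiphi.
- by apply: fderiv_comp (fderiv_comp dphi LSd) _; rewrite /= Sb.
- by rewrite /= LSN LpsiN Ls.
- by rewrite /= LSN LpsiN Lp.
Qed.
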